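(* Let $(G,H)$ be a Hecke pair and let $L$ be a length function on $(G,H)$. If $(G,H)$ has property (RD) with respect to $L$, then the algebra $H^\infty_L(G,H)$ of rapidly decreasing functions on $G//H$ with respect to $L$ is a smooth subalgebra of $C^*_r(G,H)$, and the inclusion $H^\infty_L(G,H)\subset C^*_r(G,H)$ induces an isomorphism $K_0(H^\infty_L(G,H))\simeq K_0(C^*_r(G,H))$.
   Context: $G$ is a discrete group. A pair $(G,H)$ with $H\le G$ is a Hecke pair if every double coset $HgH$ ($g\in G$) is a finite union of left cosets of $H$ (equivalently, every double coset is a finite union of right cosets $Hx$). Let $H\backslash G$ be the set of right cosets $Hg$ and $G//H$ the set of double cosets $HgH$; functions on these sets are regarded as left $H$-invariant, respectively $H$-bi-invariant, functions on $G$. $\mathcal{H}(G,H)$ is the space of finitely supported functions $G//H\to\mathbb{C}$. For $f\in\mathcal{H}(G,H)$ and $\xi\in\mathcal{H}(G,H)$ or $\xi\in\ell^2(H\backslash G)$ put $$(f*\xi)(g)=\sum_{\gamma H\in G/H} f(\gamma)\xi(\gamma^{-1}g)=\sum_{H\gamma\in H\backslash G} f(g\gamma^{-1})\xi(\gamma),\qquad f^*(g)=\overline{f(g^{-1})}.$$ With these operations $\mathcal{H}(G,H)$ is a unital $*$-algebra (the Hecke algebra), and $\lambda(f)\xi=f*\xi$ defines a $*$-representation $\lambda$ of it by bounded operators on $\ell^2(H\backslash G)$. The reduced Hecke $C^*$-algebra $C^*_r(G,H)$ is the norm closure of $\lambda(\mathcal{H}(G,H))$ in $\mathcal{B}(\ell^2(H\backslash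 G))$. Let $\delta_H\in\ell^2(H\backslash G)$ be the characteristic function of the coset $H$. A length function on $(G,H)$ is a function $L:G\to[0,\infty)$ with $L(gh)\le L(g)+L(h)$, $L(g)=L(g^{-1})$ for all $g,h\in G$, $L(1)=0$, and $L(h)=0$ for all $h\in H$; then $L$ is constant on double cosets. For $s\ge 0$ and $f:G//H\to\mathbb{C}$ put $\|f\|_{s,L}=\left(\sum_{Hg\in H\backslash G}|f(g)|^2(1+L(g))^{2s}\right)^{1/2}$. $(G,H)$ has property (RD) with respect to $L$ if there are $C,s>0$ with $\|\lambda(f)\|\le C\|f\|_{s,L}$ for all $f\in\mathcal{H}(G,H)$. Rapidly decreasing functions: $H^s_L(G,H)=\{f:G//H\to\mathbb{C}\,;\ \|f\|_{s,L}<\infty\}$ and $H^\infty_L(G,H)=\bigcap_{s\ge0}H^s_L(G,H)$. When $(G,H)$ has (RD) with respect to $L$, $\lambda$ extends by continuity to $H^s_L(G,H)$ for $s$ large, and in this way $H^\infty_L(G,H)$ is regarded as a subset of $C^*_r(G,H)$ (a function $f\in H^\infty_L(G,H)$ corresponds to the unique $a\in C^*_r(G,H)$ with $a(\delta_H)=f$). An involutive dense subalgebra $\mathcal{A}$ of a $C^*$-algebra $A$ is called smooth if for every $a\in\mathcal{A}$ and every holomorphic function $f$ defined on an open set containing the spectrum of $a$ in $A$, the element $f(a)$ (holomorphic functional calculus in $A$) belongs to $\mathcal{A}$. *)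

(* Defs.v *)
From HB Require Import structures.
From mathcomp Require Import all_boot all_order all_algebra.
From mathcomp Require Import all_classical all_reals all_analysis.
From mathcomp Require Import complex.
From mathcomp Require Import ring.
From mathcomp.analysis.showcase Require summability.

Set Implicit Arguments.
Unset Strict Implicit.
Unset Printing Implicit Defensive.

Import Order.TTheory GRing.Theory Num.Theory.
Import numFieldNormedType.Exports.

Local Open Scope classical_set_scope.
Local Open Scope ring_scope.
Local Open Scope complex_scope.

Local Open Scope quotient_scope.

(* The Grothendieck group of a commutative monoid. *)
Section Grothendieck.
Variable M : nmodType.

Definition groth_rel (p q : M * M) : bool :=
  `[< exists k : M, p.1 + q.2 + k = q.1 + p.2 + k >].

Lemma groth_rel_refl : reflexive groth_rel.
Proof. by move=> p; apply/asboolP; exists 0. Qed.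

Lemma groth_rel_sym : symmetric groth_rel.
Proof. by move=> p q; apply/asbool_equiv_eq; split=> -[k e]; exists k. Qed.

Lemma groth_rel_trans : transitive groth_rel.
Proof.
move=> q p r /asboolP[k pq] /asboolP[l qr]; apply/asboolP.
exists (q.1 + q.2 + k + l).
have -> : p.1 + r.2 + (q.1 + q.2 + k + l) = (p.1 + q.2 + k) + (q.1 + r.2 + l).
  by rewrite !addrA [LHS](ACl (1*4*5*3*2*6)).
by rewrite pq qr !addrA [LHS](ACl (4*2*1*5*3*6)).
Qed.

Canonical groth_equiv :=
  EquivRel groth_rel groth_rel_refl groth_rel_sym groth_rel_trans.

Definition groth := {eq_quot groth_rel}.

HB.instance Definition _ := EqQuotient.on groth.
HB.instance Definition _ := Choice.on groth.

Definition groth_add := lift_op2 groth (fun p q => (p.1 + q.1, p.2 + q.2)).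

Lemma pi_groth_add :
  {morph \pi_groth : p q / (p.1 + q.1, p.2 + q.2) >-> groth_add p q}.
Proof.
move=> p q; unlock groth_add; apply/eqmodP => /=; apply/asboolP => /=.
have /eqmodP/asboolP[k ep] : p = repr (\pi_groth p) %[mod groth] by rewrite reprK.
have /eqmodP/asboolP[l eq] : q = repr (\pi_groth q) %[mod groth] by rewrite reprK.
exists (k + l); set p' := repr _ in ep *; set q' := repr _ in eq *.
have -> : p.1 + q.1 + (p'.2 + q'.2) + (k + l) =
          (p.1 + p'.2 + k) + (q.1 + q'.2 + l).
  by rewrite !addrA [LHS](ACl (1*3*5*2*4*6)).
by rewrite ep eq !addrA [LHS](ACl (1*4*2*5*3*6)).
Qed.
Canonical pi_groth_add_morph := PiMorph2 pi_groth_add.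

Definition groth_opp := lift_op1 groth (fun p => (p.2, p.1)).

Lemma pi_groth_opp : {morph \pi_groth : p / (p.2, p.1) >-> groth_opp p}.
Proof.
move=> p; unlock groth_opp; apply/eqmodP => /=; apply/asboolP => /=.
have /eqmodP/asboolP[k ep] : p = repr (\pi_groth p) %[mod groth] by rewrite reprK.
by exists k; rewrite [p.2 + _]addrC [_.2 + p.1]addrC ep.
Qed.
Canonical pi_groth_opp_morph := PiMorph1 pi_groth_opp.

Definition groth_zero : groth := lift_cst groth (0, 0).
Canonical pi_groth_zero_morph := PiConst groth_zero.

Lemma groth_addA : associative groth_add.
Proof.
by elim/quotW=> p; elim/quotW=> q; elim/quotW=> r; rewrite !piE /= !addrA.
Qed.

Lemma groth_addC : commutative groth_add.
Proof.
by elim/quotW=> p; elim/quotW=> q; rewrite !piE addrC [q.2 + _]addrC.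
Qed.

Lemma groth_add0 : left_id groth_zero groth_add.
Proof. by elim/quotW=> -[p1 p2]; rewrite !piE !add0r. Qed.

Lemma groth_addN : left_inverse groth_zero groth_opp groth_add.
Proof.
elim/quotW=> -[p1 p2]; rewrite !piE /=; apply/eqmodP/asboolP; exists 0 => /=.
by rewrite !addr0 add0r addrC.
Qed.

HB.instance Definition _ :=
  GRing.isZmodule.Build groth groth_addA groth_addC groth_add0 groth_addN.

End Grothendieck.


Section GrothendieckMap.
Variables (M N : nmodType) (f : {additive M -> N}).

Definition groth_map (c : groth M) : groth N :=
  \pi_(groth N) (f (repr c).1, f (repr c).2).

Lemma pi_groth_map p : groth_map (\pi_(groth M) p) = \pi_(groth N) (f p.1, f p.2).
Proof.
apply/eqmodP/asboolP => /=.
have /eqmodP/asboolP[k e] : repr (\pi_(groth M) p) = p %[mod groth M].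
  by rewrite reprK.
by exists (f k); rewrite -!raddfD e.
Qed.

Lemma groth_map_additive : zmod_morphism groth_map.
Proof.
move=> x y; elim/quotW: x => p; elim/quotW: y => q.
by rewrite !pi_groth_map !piE pi_groth_map /= !raddfD.
Qed.

HB.instance Definition _ :=
  GRing.isZmodMorphism.Build (groth M) (groth N) groth_map groth_map_additive.

End GrothendieckMap.

(* The monoid of Murray-von Neumann classes of idempotent matrices (of any size)
   over a ring, under block-diagonal sum. *)
Section Idempotents.
Variable R : pzRingType.

Definition idem := {n : nat & {e : 'M[R]_n | e *m e == e}}.

Definition mkidem n (e : 'M[R]_n) (he : e *m e == e) : idem :=
  existT _ n (exist _ e he).

Definition murray_von_neumann (e f : idem) : bool :=
  `[< exists (u : 'M[R]_(tag e, tag f)) (v : 'M[R]_(tag f, tag e)),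
        u *m v = val (tagged e) /\ v *m u = val (tagged f) >].

Lemma mvn_refl : reflexive murray_von_neumann.
Proof.
by case=> n [e he]; apply/asboolP; exists e, e; split; apply/eqP.
Qed.

Lemma mvn_sym : symmetric murray_von_neumann.
Proof.
by move=> e f; apply/asbool_equiv_eq; split=> -[u [v []]]; exists v, u.
Qed.

Lemma mvn_trans : transitive murray_von_neumann.
Proof.
case=> m [f hf] [n [e he]] [p [g hg]].
move=> /asboolP[/= u [v [uv vu]]] /asboolP[/= x [y [xy yx]]].
apply/asboolP; exists (u *m x), (y *m v) => /=; split.
  by rewrite mulmxA -(mulmxA u) xy -vu mulmxA uv -mulmxA uv (eqP he).
by rewrite mulmxA -(mulmxA y) vu -xy mulmxA yx -mulmxA yx (eqP hg).
Qed.

Canonical mvn_equiv := EquivRel murray_von_neumann mvn_refl mvn_sym mvn_trans.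

Definition idem_class := {eq_quot murray_von_neumann}.

HB.instance Definition _ := EqQuotient.on idem_class.
HB.instance Definition _ := Choice.on idem_class.

Lemma idem_add_subproof (e f : idem) :
  let s := block_mx (val (tagged e)) 0 0 (val (tagged f)) in s *m s == s.
Proof.
case: e f => n [e /eqP he] [m [f /eqP hf]] /=.
by rewrite mulmx_block !mulmx0 !mul0mx !addr0 add0r he hf.
Qed.

Definition idem_add (e f : idem) : idem := mkidem (idem_add_subproof e f).

Lemma idem_zero_subproof : (0 : 'M[R]_0) *m (0 : 'M[R]_0) == 0.
Proof. by rewrite mulmx0. Qed.

Definition idem_zero : idem := mkidem idem_zero_subproof.

Definition class_add := lift_op2 idem_class idem_add.

Lemma mvn_add e e' f f' : murray_von_neumann e e' -> murray_von_neumann f f' ->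
  murray_von_neumann (idem_add e f) (idem_add e' f').
Proof.
move=> /asboolP[u [v [uv vu]]] /asboolP[x [y [xy yx]]]; apply/asboolP.
exists (block_mx u 0 0 x), (block_mx v 0 0 y) => /=.
by rewrite !mulmx_block !mulmx0 !mul0mx !addr0 !add0r uv vu xy yx.
Qed.

Lemma pi_class_add :
  {morph \pi_idem_class : e f / idem_add e f >-> class_add e f}.
Proof.
move=> e f; unlock class_add; apply/eqmodP => /=.
by apply: mvn_add; apply/eqmodP; rewrite reprK.
Qed.
Canonical pi_class_add_morph := PiMorph2 pi_class_add.

Definition class_zero : idem_class := lift_cst idem_class idem_zero.
Canonical pi_class_zero_morph := PiConst class_zero.

Lemma idem_eq n m (nm : n = m) (e : 'M[R]_n) (f : 'M[R]_m) he hf :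
  castmx (nm, nm) e = f -> @mkidem n e he = @mkidem m f hf.
Proof.
case: m / nm f hf => f hf; rewrite castmx_id => ef.
by rewrite /mkidem; congr existT; apply: val_inj.
Qed.

Lemma class_addA : associative class_add.
Proof.
elim/quotW=> e; elim/quotW=> f; elim/quotW=> g; rewrite !piE.
congr (\pi_idem_class _); apply/esym.
apply: (@idem_eq _ _ (esym (addnA _ _ _))) => /=.
have /= := @block_mxA _ _ _ _ _ _ _ (val (tagged e)) 0 0 0 (val (tagged f)) 0 0 0
  (val (tagged g)).
by rewrite !row_mx0 !col_mx0.
Qed.

Lemma class_addC : commutative class_add.
Proof.
elim/quotW=> -[n [e he]]; elim/quotW=> -[m [f hf]]; rewrite !piE.
apply/eqmodP/asboolP; exists (block_mx 0 e f 0), (block_mx 0 f e 0) => /=.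
rewrite !mulmx_block !mulmx0 !mul0mx !addr0 !add0r.
by rewrite (eqP he) (eqP hf).
Qed.

Lemma class_add0 : left_id class_zero class_add.
Proof.
elim/quotW=> -[n [e he]]; rewrite !piE.
apply/eqmodP/asboolP; exists (col_mx 0 e), (row_mx 0 e) => /=.
rewrite mul_col_row mul_row_col !mulmx0 !mul0mx add0r (eqP he).
by split.
Qed.

HB.instance Definition _ :=
  GRing.isNmodule.Build idem_class class_addA class_addC class_add0.

End Idempotents.

Section IdempotentsMap.
Variables (R S : pzRingType) (f : {rmorphism R -> S}).

Lemma idem_map_subproof (e : idem R) :
  let s := map_mx f (val (tagged e)) in s *m s == s.
Proof. by case: e => n [e /eqP he] /=; rewrite -map_mxM he. Qed.

Definition idem_map (e : idem R) : idem S := mkidem (idem_map_subproof e).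

Definition class_map (c : idem_class R) : idem_class S :=
  \pi_(idem_class S) (idem_map (repr c)).

Lemma mvn_map e e' : murray_von_neumann e e' ->
  murray_von_neumann (idem_map e) (idem_map e').
Proof.
move=> /asboolP[u [v [uv vu]]]; apply/asboolP.
by exists (map_mx f u), (map_mx f v); rewrite -!map_mxM uv vu.
Qed.

Lemma pi_class_map e :
  class_map (\pi_(idem_class R) e) = \pi_(idem_class S) (idem_map e).
Proof.
by apply/eqmodP/mvn_map/eqmodP; rewrite reprK.
Qed.

Lemma class_map_additive : nmod_morphism class_map.
Proof.
split.
  rewrite /(0 : idem_class R) /(0 : idem_class S)/= !piE pi_class_map.
  congr (\pi_(idem_class S) _); apply: (@idem_eq _ _ _ erefl).
  by apply/matrixP => -[].
move=> x y; elim/quotW: x => d; elim/quotW: y => e.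
rewrite !pi_class_map !piE pi_class_map.
congr (\pi_(idem_class S) _); apply: (@idem_eq _ _ _ erefl) => /=.
by rewrite castmx_id map_block_mx !map_mx0.
Qed.

HB.instance Definition _ := GRing.isNmodMorphism.Build
  (idem_class R) (idem_class S) class_map class_map_additive.

End IdempotentsMap.

(* K_0 of a unital ring, and its functoriality under unital ring morphisms.
   K0_map f is additive, so bijectivity of K0_map f means that it is an
   isomorphism of groups. *)
Definition K0 (R : pzRingType) := groth (idem_class R).

HB.instance Definition _ (R : pzRingType) := GRing.Zmodule.on (K0 R).

Definition K0_map (R S : pzRingType) (f : {rmorphism R -> S}) : K0 R -> K0 S :=
  groth_map (class_map f).

HB.instance Definition _ (R S : pzRingType) (f : {rmorphism R -> S}) :=
  GRing.Additive.on (K0_map f).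

(* The Hilbert space of square-summable complex families indexed by X. *)
Section Ell2.
Variables (R : realType) (X : choiceType).
Local Notation C := R[i].
Import Normc.

Definition sqsum (f : X -> C) : \bar R :=
  \esum_(x in [set: X]) (normc (f x) ^+ 2)%:E.

Definition square_summable : {pred X -> C} := [pred f | (sqsum f < +oo)%E].

Lemma normcN (z : C) : normc (- z) = normc z.
Proof. by case: z => a b /=; rewrite !sqrrN. Qed.

Lemma normc_ge0 (z : C) : 0 <= normc z.
Proof. by case: z => a b; exact: sqrtr_ge0. Qed.

Lemma sqsum_ge0 f : (0 <= sqsum f)%E.
Proof. by apply: esum_ge0 => x _; rewrite lee_fin exprn_ge0 ?normc_ge0. Qed.

Lemma esumZ_le (c : R) (a : X -> \bar R) : 0 <= c -> (forall x, (0 <= a x)%E) ->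
  (\esum_(x in [set: X]) (c%:E * a x) <= c%:E * \esum_(x in [set: X]) a x)%E.
Proof.
move=> c0 a0; apply: ge_ereal_sup => _ [F [finF _] <-].
rewrite -ge0_mule_fsumr//; apply: lee_wpmul2l; first by rewrite lee_fin.
by apply: esum_ge; exists F.
Qed.

Lemma sqsumZ c f : (sqsum (c *: f)%R <= (normc c ^+ 2)%:E * sqsum f)%E.
Proof.
rewrite /sqsum; apply: le_trans (esumZ_le _ _); last first.
- by move=> x; rewrite lee_fin exprn_ge0 ?normc_ge0.
- by rewrite exprn_ge0 ?normc_ge0.
by apply: le_esum => x _; rewrite normcM exprMn EFinM.
Qed.

Lemma sqsumD (t : R) (f g : X -> C) : 0 < t ->
  (sqsum (f + g)%R <= (1 + t)%:E * sqsum f + (1 + t^-1)%:E * sqsum g)%E.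
Proof.
move=> t0.
have pos h x : (0 <= (normc (h x : C) ^+ 2)%:E :> \bar R)%E.
  by rewrite lee_fin exprn_ge0 ?normc_ge0.
apply: le_trans; last first.
  by apply: leeD; apply: esumZ_le => // ; rewrite addr_ge0 ?invr_ge0 ?(ltW t0).
rewrite -esumD; last 2 first.
- by move=> x _; rewrite mule_ge0// lee_fin addr_ge0 ?(ltW t0).
- by move=> x _; rewrite mule_ge0// lee_fin addr_ge0 ?invr_ge0 ?(ltW t0).
apply: le_esum => x _; rewrite -!EFinM -EFinD lee_fin.
set a := normc (f x); set b := normc (g x).
have ab : normc ((f + g) x) <= a + b by exact: le_normcD.
have [a0 b0 s0] : [/\ 0 <= a, 0 <= b & 0 <= normc ((f + g) x)].
  by split; exact: normc_ge0.
apply: (@le_trans _ _ ((a + b) ^+ 2)).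
  by rewrite lerXn2r ?nnegrE ?addr_ge0.
rewrite -subr_ge0.
have -> : (1 + t) * a ^+ 2 + (1 + t^-1) * b ^+ 2 - (a + b) ^+ 2 =
          t^-1 * (t * a - b) ^+ 2 by field; rewrite gt_eqF.
by rewrite mulr_ge0 ?invr_ge0 ?sqr_ge0 ?(ltW t0).
Qed.

Lemma sqsum0 : sqsum 0 = 0%E.
Proof. by apply: esum1 => x _; rewrite normc0 expr0n. Qed.

Lemma square_summable_submod : submod_closed square_summable.
Proof.
split=> [|c f g]; rewrite !inE ?sqsum0// => f2 g2.
apply: le_lt_trans (@sqsumD 1 (c *: f) g ltr01) _.
have fin h : (sqsum h < +oo)%E -> sqsum h \is a fin_num.
  by rewrite ge0_fin_numE ?sqsum_ge0.
rewrite lte_add_pinfty// lte_mul_pinfty ?lee_fin//.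
apply: le_lt_trans (sqsumZ c f) _.
by rewrite lte_mul_pinfty ?lee_fin// exprn_ge0 ?normc_ge0.
Qed.

HB.instance Definition _ :=
  GRing.isSubmodClosed.Build C (X -> C) square_summable square_summable_submod.

Record ell2 := Ell2 { ell2_fun :> X -> C; ell2P : ell2_fun \in square_summable }.

HB.instance Definition _ := [isSub for ell2_fun].
HB.instance Definition _ := [Choice of ell2 by <:].
HB.instance Definition _ := [SubChoice_isSubLmodule of ell2 by <:].

Definition ell2_norm (f : ell2) : R := Num.sqrt (fine (sqsum f)).

Lemma sqsumE (f : ell2) : sqsum f = (ell2_norm f ^+ 2)%:E.
Proof.
have f0 := sqsum_ge0 f.
rewrite sqr_sqrtr ?fine_ge0// fineK// ge0_fin_numE//; have := ell2P f.
by rewrite inE.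
Qed.

Lemma ell2_norm_ge0 f : 0 <= ell2_norm f. Proof. exact: sqrtr_ge0. Qed.

Lemma ell2_normZ_le (c : C) f : ell2_norm (c *: f) <= normc c * ell2_norm f.
Proof.
rewrite -(@ler_pXn2r _ 2) ?nnegrE ?mulr_ge0 ?ell2_norm_ge0 ?normc_ge0//.
rewrite exprMn -lee_fin [leRHS]EFinM -!sqsumE; exact: sqsumZ.
Qed.

Lemma ell2_normZ (c : C) f : ell2_norm (c *: f) = normc c * ell2_norm f.
Proof.
have [->|c0] := eqVneq c 0.
  by apply/eqP; rewrite eq_le ell2_normZ_le normc0 mul0r ell2_norm_ge0.
apply/eqP; rewrite eq_le ell2_normZ_le/=.
have nc : 0 < normc c.
  by rewrite lt_neqAle normc_ge0 andbT eq_sym; apply: contra c0 => /eqP/eq0_normc ->.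
rewrite -ler_pdivlMl// -normcV.
by rewrite -{1}[f](scalerK c0) ell2_normZ_le.
Qed.

Lemma ell2_normD f g : ell2_norm (f + g) <= ell2_norm f + ell2_norm g.
Proof.
apply/ler_addgt0Pr => e e0.
pose a := ell2_norm f + e / 2; pose b := ell2_norm g + e / 2.
have [a0 b0] : 0 < a /\ 0 < b by split; rewrite ltr_wpDl ?ell2_norm_ge0 ?divr_gt0.
have -> : ell2_norm f + ell2_norm g + e = a + b by rewrite /a /b; field.
have ab0 : 0 <= a + b by rewrite addr_ge0 ?(ltW a0) ?(ltW b0).
rewrite -(@ler_pXn2r _ 2) ?nnegrE ?ell2_norm_ge0 ?ab0//.
have := sqsumD f g (divr_gt0 b0 a0).
rewrite -[(f : X -> C) + g]/(ell2_fun (f + g)) !sqsumE -!EFinM -EFinD lee_fin => /le_trans; apply.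
have -> : (a + b) ^+ 2 = (1 + b / a) * a ^+ 2 + (1 + (b / a)^-1) * b ^+ 2.
  by field; rewrite !gt_eqF.
have le h : ell2_norm h ^+ 2 <= (ell2_norm h + e / 2) ^+ 2.
  have e2 : 0 <= e / 2 by rewrite divr_ge0 ?(ltW e0).
  by rewrite lerXn2r ?nnegrE ?addr_ge0 ?ell2_norm_ge0// lerDl.
have t0 : 0 < b / a by rewrite divr_gt0.
have s0 : 0 < (b / a)^-1 by rewrite invr_gt0.
by apply: lerD; (apply: ler_wpM2l; [rewrite addr_ge0 ?(ltW t0) ?(ltW s0) | exact: le]).
Qed.

Lemma ell2_norm0_eq0 f : ell2_norm f = 0 -> f = 0.
Proof.
move=> f0; apply/val_inj/funext => x /=.
have : ((normc (f x) ^+ 2)%:E <= sqsum f)%E.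
  by apply: esum_ge; exists [set x]; rewrite ?fsbig_set1.
rewrite sqsumE f0 expr0n lee_fin => fx.
apply: eq0_normc; apply/eqP; rewrite -sqrf_eq0 eq_le fx sqr_ge0//.
Qed.

Lemma complex_normE (z : C) : `|z| = (normc z)%:C.
Proof. by case: z => a b. Qed.

Lemma ell2_normcD f g : (ell2_norm (f + g))%:C <= (ell2_norm f)%:C + (ell2_norm g)%:C.
Proof. by rewrite -rmorphD lecR ell2_normD. Qed.

Lemma ell2_normcZ (c : C) f : (ell2_norm (c *: f))%:C = `|c| * (ell2_norm f)%:C.
Proof. by rewrite ell2_normZ rmorphM complex_normE. Qed.

Lemma ell2_normc_eq0 f : (ell2_norm f)%:C = 0 -> f = 0.
Proof. by case=> /ell2_norm0_eq0. Qed.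

HB.instance Definition _ := @Lmodule_isNormed.Build C ell2
  (fun f => (ell2_norm f)%:C) ell2_normcD ell2_normcZ ell2_normc_eq0.

Lemma delta_subproof (x0 : X) :
  (fun x => (x == x0)%:R : C) \in square_summable.
Proof.
rewrite inE; suff -> : sqsum (fun x => (x == x0)%:R : C) = 1%E by rewrite ltry.
transitivity (\esum_(x in [set x0]) (1%:E : \bar R)); last first.
  by rewrite esum_set1// lee_fin.
rewrite [RHS]esum_mkcond; apply: eq_esum => x _; rewrite classical_sets.in_set1.
by case: (x == x0); rewrite ?normc1 ?normc0 ?expr1n ?expr0n.
Qed.

Definition delta (x0 : X) : ell2 := Ell2 (delta_subproof x0).

Definition inner (xi eta : ell2) : C :=
  summability.sum (fun x => xi x * (eta x)^* : C^o).
End Ell2.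

(* The ring of continuous linear endomorphisms of E, with the operator norm.
   Norms of modules over R[i] are R[i]-valued; complex.Re recovers the real. *)
Section BoundedOperators.
Variables (R : realType) (E : normedModType R[i]).
Local Notation C := R[i].

Definition linear_continuous : {pred E -> E} :=
  [pred T | `[< linear T /\ continuous T >]].

Lemma linear_continuousP (T : E -> E) :
  reflect (linear T /\ continuous T) (T \in linear_continuous).
Proof. exact: asboolP. Qed.

Lemma linear_continuous_submod : submod_closed linear_continuous.
Proof.
split=> [|c S T].
  apply/linear_continuousP; split=> [k x y|x]; last exact: cvg_cst.
  by have z u : (0 : E -> E) u = 0 by []; rewrite !z scaler0 addr0.
move=> /linear_continuousP[Sl Sc] /linear_continuousP[Tl Tc].
apply/linear_continuousP; split=> [k x y|x].
  have app u : (c *: S + T) u = c *: S u + T u by [].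
  by rewrite !app Sl Tl !scalerDr !scalerA [c * k]mulrC !addrA;
     rewrite [LHS](ACl (1*3*2*4)).
by apply: cvgD; [apply: cvgZr; exact: Sc | exact: Tc].
Qed.

HB.instance Definition _ :=
  GRing.isSubmodClosed.Build C (E -> E) linear_continuous linear_continuous_submod.

Record bop := Bop { bop_fun :> E -> E; bopP : bop_fun \in linear_continuous }.

HB.instance Definition _ := [isSub for bop_fun].
HB.instance Definition _ := [Choice of bop by <:].
HB.instance Definition _ := [SubChoice_isSubLmodule of bop by <:].

Lemma bop_linear (T : bop) : linear T.
Proof. by have /linear_continuousP[] := bopP T. Qed.

HB.instance Definition _ (T : bop) := GRing.isLinear.Build C E E _ T (bop_linear T).

Lemma bop_continuous (T : bop) : continuous T.
Proof. by have /linear_continuousP[] := bopP T. Qed.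

Lemma bop_one_subproof : (@idfun E) \in linear_continuous.
Proof. by apply/linear_continuousP; split=> // x; exact: cvg_id. Qed.

Lemma bop_mul_subproof (S T : bop) : S \o T \in linear_continuous.
Proof.
apply/linear_continuousP; split=> [k x y|x] /=.
  by rewrite !linearD !linearZ.
apply: continuous_comp; exact: bop_continuous.
Qed.

Definition bop_one := Bop bop_one_subproof.
Definition bop_mul S T := Bop (bop_mul_subproof S T).

Lemma bop_mulA : associative bop_mul. Proof. by move=> S T U; exact: val_inj. Qed.
Lemma bop_mul1 : left_id bop_one bop_mul. Proof. by move=> S; exact: val_inj. Qed.
Lemma bop_1mul : right_id bop_one bop_mul. Proof. by move=> S; exact: val_inj. Qed.
Lemma bop_mulDl : left_distributive bop_mul +%R.
Proof. by move=> S T U; exact: val_inj. Qed.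
Lemma bop_mulDr : right_distributive bop_mul +%R.
Proof. by move=> S T U; apply/val_inj/funext => x /=; rewrite fctE/= linearD. Qed.

HB.instance Definition _ := GRing.Zmodule_isPzRing.Build bop
  bop_mulA bop_mul1 bop_1mul bop_mulDl bop_mulDr.

Definition opnorm (T : E -> E) : R :=
  sup [set complex.Re `|T x| | x in [set x | `|x| <= 1]].

Lemma Re_norm (x : E) : (complex.Re `|x|)%:C = `|x|.
Proof. by rewrite RRe_real// ger0_real. Qed.

Lemma bop_bounded (T : bop) : exists2 M : R, 0 <= M &
  forall x, complex.Re `|T x| <= M * complex.Re `|x|.
Proof.
have T0 : {for 0, continuous T} by exact: bop_continuous.
have /linear_boundedP := continuous_linear_bounded 0 T0.
move=> /pinfty_ex_gt0[M M0 bT]; exists (complex.Re M).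
  by rewrite -lecR RRe_real ?gtr0_real// ltW.
move=> x; rewrite -lecR rmorphM/= !Re_norm RRe_real ?gtr0_real//; exact: bT.
Qed.

Lemma opnorm_has_sup (T : bop) :
  has_sup [set complex.Re `|T x| | x in [set x : E | `|x| <= 1]].
Proof.
split; first by exists (complex.Re `|T 0|), 0 => //=; rewrite normr0.
have [M M0 bT] := bop_bounded T; exists M => _ [x /= x1 <-].
apply: le_trans (bT x) _; rewrite -[leRHS]mulr1 ler_wpM2l//.
by rewrite -lecR Re_norm.
Qed.

Lemma opnorm_le (T : bop) (M : R) :
  (forall x, `|x| <= 1 -> complex.Re `|T x| <= M) -> opnorm T <= M.
Proof.
move=> TM; apply: ge_sup; first by case: (opnorm_has_sup T).
by move=> _ [x /= x1 <-]; exact: TM.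
Qed.

Lemma opnorm_unit (T : bop) x : `|x| <= 1 -> complex.Re `|T x| <= opnorm T.
Proof.
move=> x1; apply: ub_le_sup; first by case: (opnorm_has_sup T).
by exists x.
Qed.

Lemma opnorm_ge0 (T : bop) : 0 <= opnorm T.
Proof.
by apply: le_trans (@opnorm_unit T 0 _); rewrite ?linear0 normr0//= ler01.
Qed.

Lemma Re_normZ (c : C) (x : E) :
  complex.Re `|c *: x| = Normc.normc c * complex.Re `|x|.
Proof.
apply: (@complexI R); rewrite rmorphM/= !Re_norm normrZ.
by case: c.
Qed.

Lemma Re_normD (x y : E) :
  complex.Re `|x + y| <= complex.Re `|x| + complex.Re `|y|.
Proof. by rewrite -lecR rmorphD/= !Re_norm ler_normD. Qed.

Lemma opnormP (T : bop) x : complex.Re `|T x| <= opnorm T * complex.Re `|x|.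
Proof.
have [->|x0] := eqVneq x 0; first by rewrite linear0 normr0 mulr0.
have nx : 0 < complex.Re `|x| by rewrite -ltcR Re_norm normr_gt0.
have nc : Normc.normc (complex.Re `|x|)^-1%:C = (complex.Re `|x|)^-1.
  by rewrite /= expr0n/= addr0 sqrtr_sqr ger0_norm// invr_ge0 ltW.
have := @opnorm_unit T ((complex.Re `|x|)^-1%:C *: x).
rewrite linearZ/= Re_normZ nc mulrC ler_pdivrMr//; apply.
by rewrite -Re_norm Re_normZ nc mulVf ?gt_eqF.
Qed.

Lemma opnormD (S T : bop) : opnorm (S + T) <= opnorm S + opnorm T.
Proof.
apply: opnorm_le => x x1; apply: le_trans (Re_normD _ _) _.
by rewrite lerD// opnorm_unit.
Qed.

Lemma opnormZ_le (c : C) (T : bop) :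
  opnorm (c *: T) <= Normc.normc c * opnorm T.
Proof.
apply: opnorm_le => x x1; rewrite Re_normZ ler_wpM2l ?opnorm_unit//.
by case: c => a b; exact: sqrtr_ge0.
Qed.

Lemma opnormZ (c : C) (T : bop) : opnorm (c *: T) = Normc.normc c * opnorm T.
Proof.
have [->|c0] := eqVneq c 0.
  apply/eqP; rewrite eq_le opnormZ_le Normc.normc0 mul0r opnorm_ge0//.
apply/eqP; rewrite eq_le opnormZ_le/=.
have nc : 0 < Normc.normc c by rewrite -ltcR -[ltRHS]/`|c| normr_gt0.
by rewrite -ler_pdivlMl// -Normc.normcV -{1}[T](scalerK c0) opnormZ_le.
Qed.

Lemma opnorm0_eq0 (T : bop) : opnorm T = 0 -> T = 0.
Proof.
move=> T0; apply/val_inj/funext => x /=; apply/eqP; rewrite -normr_eq0.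
have := opnormP T x; rewrite T0 mul0r => Tx.
by rewrite eq_le normr_ge0 andbT -Re_norm -(rmorph0 (real_complex R)) lecR.
Qed.

Lemma opnormcD (S T : bop) :
  (opnorm (S + T))%:C <= (opnorm S)%:C + (opnorm T)%:C.
Proof. by rewrite -rmorphD lecR opnormD. Qed.

Lemma opnormcZ (c : C) (T : bop) : (opnorm (c *: T))%:C = `|c| * (opnorm T)%:C.
Proof. by rewrite opnormZ rmorphM; case: c. Qed.

Lemma opnormc_eq0 (T : bop) : (opnorm T)%:C = 0 -> T = 0.
Proof. by case=> /opnorm0_eq0. Qed.

HB.instance Definition _ := @Lmodule_isNormed.Build C bop
  (fun T => (opnorm T)%:C) opnormcD opnormcZ opnormc_eq0.

End BoundedOperators.

(* Subsets of a ring closed under the ring operations, seen as rings. *)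
Section Subrings.
Variable A : pzRingType.

Definition set_subring (S : set A) := [/\ S 1,
  forall x y, S x -> S y -> S (x - y) & forall x y, S x -> S y -> S (x * y)].

Section SubringType.
Variables (S : set A) (sS : set_subring S).

Record subring_of (sS : set_subring S) :=
  SubringOf { subring_val :> A; subring_valP : subring_val \in S }.

HB.instance Definition _ := [isSub for @subring_val sS].
HB.instance Definition _ := [Choice of subring_of sS by <:].

Lemma set_subring_closed : subring_closed [in S].
Proof.
have [S1 SB SM] := sS; split=> [|x y|x y]; rewrite !inE //; first exact: SB.
exact: SM.
Qed.

HB.instance Definition _ :=
  GRing.SubChoice_isSubPzRing.Build A [in S] (subring_of sS) set_subring_closed.

End SubringType.

Section Inclusion.
Variables (S T : set A) (sS : set_subring S) (sT : set_subring T).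
Hypothesis ST : S `<=` T.

Lemma subring_incl_subproof (x : subring_of sS) : subring_val x \in T.
Proof. by apply/mem_set/ST/set_mem/subring_valP. Qed.

Definition subring_incl (x : subring_of sS) : subring_of sT :=
  SubringOf sT (subring_incl_subproof x).

Lemma subring_incl_additive : zmod_morphism subring_incl.
Proof. by move=> x y; exact: val_inj. Qed.

Lemma subring_incl_multiplicative : monoid_morphism subring_incl.
Proof. by split=> [|x y]; exact: val_inj. Qed.

HB.instance Definition _ := GRing.isZmodMorphism.Build
  (subring_of sS) (subring_of sT) subring_incl subring_incl_additive.
HB.instance Definition _ := GRing.isMonoidMorphism.Build
  (subring_of sS) (subring_of sT) subring_incl subring_incl_multiplicative.

End Inclusion.
End Subrings.

Arguments subring_incl {A S T} sS sT ST x.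

(* A contour is a finite family of closed polygons, each given by the list of its
   vertices. Integrals of functions that are continuous on the contour are
   limits of the Riemann sums (left endpoints) obtained by cutting every edge in
   n equal parts. *)
Section ContourIntegrals.
Variable R : realType.
Local Notation C := R[i].

Definition edges (Gamma : seq (seq C)) : seq (C * C) :=
  flatten [seq zip s (rot 1 s) | s <- Gamma].

Definition segment (e : C * C) : set C :=
  [set e.1 + t%:C * (e.2 - e.1) | t in `[0, 1]%classic].

Definition riemann_sum (V : lmodType C) (F : C -> V) (Gamma : seq (seq C))
    (n : nat) : V :=
  \sum_(e <- edges Gamma) \sum_(k < n)
    ((e.2 - e.1) / n%:R) *: F (e.1 + (k%:R / n%:R) * (e.2 - e.1)).

Definition contour_integral (V : normedModType C) (F : C -> V)
    (Gamma : seq (seq C)) (v : V) : Prop :=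
  riemann_sum F Gamma @ \oo --> v.

Definition two_pi_i : C := (2 * pi) *i.

(* Gamma lies in U minus K, winds once around each point of K, and does not wind
   around any point outside U. *)
Definition surrounds (Gamma : seq (seq C)) (K U : set C) :=
  [/\ forall e, e \in edges Gamma -> segment e `<=` U `\` K,
    forall w, K w ->
      contour_integral (fun z => (z - w)^-1 : C^o) Gamma two_pi_i &
    forall w, ~ U w -> contour_integral (fun z => (z - w)^-1 : C^o) Gamma 0].

Definition holomorphic (U : set C) (f : C -> C) :=
  forall z, U z -> derivable (f : C^o -> C^o) z 1.

End ContourIntegrals.

Section SmoothSubalgebras.
Variables (R : realType) (X : choiceType).
Local Notation C := R[i].
Local Notation B := (bop (ell2 R X)).
Implicit Types (A S : set B) (a b : B).

Definition adjoint a b := forall xi eta : ell2 R X, inner (a xi) eta = inner xi (b eta).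

Record star_subalgebra S : Prop := StarSubalgebra {
  star_subalgebra_subring : set_subring S;
  star_subalgebraZ : forall (c : C) a, S a -> S (c *: a);
  star_subalgebra_adjoint : forall a, S a -> exists2 b : B, S b & adjoint a b }.

Definition spectrum A a : set C :=
  [set z : C | ~ exists2 b : B, A b & b * (z *: (1 : B) - a) = 1 /\ (z *: (1 : B) - a) * b = 1].

(* (z - a)^-1 in A; the default 0 is taken only when z is in the spectrum. *)
Definition resolvent A a (z : C) : B :=
  xget 0 [set b | A b /\ (b * (z *: (1 : B) - a) = 1 /\ (z *: (1 : B) - a) * b = 1)].

(* b = f(a), by the Cauchy formula
   2 pi i f(a) = \oint_Gamma f(z) (z - a)^-1 dz. *)
Definition holomorphic_calculus A a (f : C -> C) (Gamma : seq (seq C)) b :=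
  contour_integral (fun z => f z *: resolvent A a z) Gamma (two_pi_i R *: b).

Record smooth_subalgebra A S : Prop := SmoothSubalgebra {
  smooth_star : star_subalgebra S;
  smooth_sub : S `<=` A;
  smooth_dense : A `<=` closure S;
  smooth_calculus : forall a (U : set C) (f : C -> C) Gamma,
    S a -> open (U : set C^o) -> spectrum A a `<=` U -> holomorphic U f ->
    surrounds Gamma (spectrum A a) U ->
    exists2 b, holomorphic_calculus A a f Gamma b & S b }.

End SmoothSubalgebras.

Section Cosets.
Variables (G : groupType) (H : set G).

Definition subgroup := [/\ H 1%g, forall x y, H x -> H y -> H (x * y)%g &
  forall x, H x -> H (x^-1)%g].

Definition rcoset (g : G) : set G := [set (h * g)%g | h in H].
Definition lcoset (g : G) : set G := [set (g * h)%g | h in H].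
Definition dcoset (g : G) : set G := [set (h * g * k)%g | h in H & k in H].

Definition hecke_pair := subgroup /\
  forall g, exists s : seq G, dcoset g = \bigcup_(x in [set` s]) lcoset x.

(* The set H\G of right cosets Hg. A function xi on H\G is the left
   H-invariant function g |-> xi (rclass g) on G; conversely a left H-invariant
   function f on G has value f (rrepr x) at the coset x. *)
Definition rcosets := {K : set G | `[< exists g, K = rcoset g >]}.

HB.instance Definition _ := Choice.on rcosets.

Lemma rcosets_subproof g : `[< exists g', rcoset g = rcoset g' >].
Proof. by apply/asboolP; exists g. Qed.

Definition rclass (g : G) : rcosets := exist _ (rcoset g) (rcosets_subproof g).

Definition rrepr (x : rcosets) : G := xget 1%g (val x).

Definition bi_invariant (T : Type) (f : G -> T) :=
  forall h k g, H h -> H k -> f (h * g * k)%g = f g.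

Section Theory.
Hypothesis sH : subgroup.

Lemma rcoset_refl g : rcoset g g.
Proof. by case: sH => H1 _ _; exists 1%g; rewrite ?mul1g. Qed.

Lemma eq_rclass g g' : rcoset g' g -> rclass g = rclass g'.
Proof.
case: sH => H1 HM HV [h Hh <-]; apply/val_inj/seteqP => /=; split=> _ [k Hk <-].
  by exists (k * h)%g; [exact: HM | rewrite mulgA].
by exists (k * h^-1)%g; [apply: HM => //; exact: HV | rewrite mulgA mulgVK].
Qed.

Lemma eq_lcoset g g' : lcoset g g' -> lcoset g' = lcoset g.
Proof.
case: sH => H1 HM HV [h Hh <-]; apply/seteqP => /=; split=> _ [k Hk <-].
  by exists (h * k)%g; [exact: HM | rewrite mulgA].
by exists (h^-1 * k)%g; [apply: HM => //; exact: HV | rewrite mulgA mulgK].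
Qed.

Lemma rreprK x : rclass (rrepr x) = x.
Proof.
case: x => K K0; have /asboolP[g eK] := K0.
suff : K (rrepr (exist _ K K0)).
  rewrite {1}eK => /eq_rclass ->; apply: val_inj; exact: esym.
by apply: (@xgetI _ 1%g K g); rewrite eK; exact: rcoset_refl.
Qed.

Lemma rrepr_class g : rcoset g (rrepr (rclass g)).
Proof. by apply: (@xgetI _ 1%g _ g); exact: rcoset_refl. Qed.

End Theory.
End Cosets.

Section Translation.
Variables (R : realType) (G : groupType) (H : set G).
Hypothesis hecke : hecke_pair H.
Local Notation C := R[i].
Let sH : subgroup H := hecke.1.
Variable g : G.

Let phi (x : rcosets H) : rcosets H := rclass H (g^-1 * rrepr x)%g.

Lemma translation_fibers : exists s : seq G,
  forall x, exists2 y, y \in s & x = rclass H (y * rrepr (phi x))%g.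
Proof.
have [H1 HM HV] := sH; have [s es] := hecke.2 g^-1%g.
exists [seq y^-1%g | y <- s] => x.
have [h Hh ew] := rrepr_class sH (g^-1 * rrepr x)%g.
have : dcoset H g^-1%g (h * g^-1)%g.
  by exists h => //; exists 1%g => //; rewrite mulg1.
rewrite es => -[y /= ys [k Hk yk]]; exists y^-1%g; first exact: map_f.
rewrite /phi -ew [(h * _)%g]mulgA -yk -mulgA mulKg -{1}[x](rreprK sH).
apply: eq_rclass => //; exists k^-1%g; first exact: HV.
by rewrite mulKg.
Qed.

Lemma translation_bounded : exists n : nat, forall xi : rcosets H -> C,
  (sqsum (xi \o phi) <= n%:R%:E * sqsum xi)%E.
Proof.
have [s hs] := translation_fibers; exists (size s) => xi.
pose a z := (Normc.normc (xi z) ^+ 2)%:E.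
have a0 z : (0 <= a z)%E by rewrite lee_fin exprn_ge0 ?normc_ge0.
pose X y := [set x | x = rclass H (y * rrepr (phi x))%g].
apply: (@le_trans _ _ (\esum_(x in [set: rcosets H])
    \sum_(y <- s) if x \in X y then a (phi x) else 0)%E).
  apply: le_esum => x _; have [y ys xy] := hs x.
  rewrite (big_rem y)//= ifT ?leeDl//; last by rewrite inE.
  by apply: sume_ge0 => z _; case: ifP.
rewrite esum_sum; last by move=> x y _ _; case: ifP.
apply: (@le_trans _ _ (\sum_(y <- s) sqsum xi)%E); last first.
  rewrite mule_natl big_const_seq count_predT.
  elim: (size s) => [//|[|n]] /= IHn; first by rewrite adde0.
  exact: leeD2l.
apply: lee_sum => y _; rewrite -esum_mkcond -(esum_image _ phi); last first.
  by move=> x x'; rewrite !inE /X/= => {2}-> {2}-> ->.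
rewrite esum_mkcond; apply: le_esum => z _.
by case: ifP => // _; exact: a0.
Qed.

End Translation.

Section HeckeAlgebra.
Variables (R : realType) (G : groupType) (H : set G).
Local Notation C := R[i].
Local Notation ell2 := (ell2 R (rcosets H)).

Definition hecke_algebra : set (G -> C) :=
  [set f | bi_invariant H f /\
           finite_set [set dcoset H g | g in [set g | f g != 0]]].

(* The sum runs over the left cosets K = kH; it does not depend on the choice of
   the representative k when f is H-bi-invariant. *)
Definition convolution (f : G -> C) (xi : rcosets H -> C) (x : rcosets H) : C :=
  \sum_(K \in range (lcoset H))
    let k := xget 1%g K in f k * xi (rclass H (k^-1 * rrepr x)%g).

(* The bounded operator xi |-> f * xi. The default 0 is irrelevant for f in the
   Hecke algebra of a Hecke pair, see lambdaE. *)
Definition lambda (f : G -> C) : bop ell2 :=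
  xget 0 [set T : bop ell2 | forall xi : ell2, T xi = convolution f xi :> (_ -> _)].

Section Lambda.
Hypothesis hecke : hecke_pair H.
Let sH : subgroup H := hecke.1.

Section Translate.
Variable g : G.

Lemma translate_subproof (xi : ell2) :
  (fun x => xi (rclass H (g^-1 * rrepr x)%g)) \in @square_summable R (rcosets H).
Proof.
have [n hn] := translation_bounded R hecke g; rewrite inE.
apply: le_lt_trans (hn xi) _.
by rewrite sqsumE -EFinM ltry.
Qed.

Definition translate (xi : ell2) : ell2 := Ell2 (translate_subproof xi).

Lemma translate_linear : linear translate.
Proof. by move=> c xi eta; exact: val_inj. Qed.

HB.instance Definition _ := GRing.isLinear.Build C ell2 ell2 _ translate
  translate_linear.

Lemma translate_continuous : continuous translate.
Proof.
have [n hn] := translation_bounded R hecke g.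
apply: bounded_linear_continuous; apply/linear_boundedP.
near=> r => xi.
apply: (@le_trans _ _ ((Num.sqrt n%:R)%:C * `|xi|)).
  have key : ell2_norm (translate xi) ^+ 2 <= n%:R * ell2_norm xi ^+ 2.
    by rewrite -lee_fin [leRHS]EFinM -!sqsumE; exact: hn.
  have le : ell2_norm (translate xi) <= Num.sqrt n%:R * ell2_norm xi.
    rewrite -(@ler_pXn2r _ 2) ?nnegrE ?mulr_ge0 ?sqrtr_ge0//.
    by rewrite exprMn (sqr_sqrtr (ler0n R n)).
  by rewrite -[leRHS](rmorphM (real_complex R)) lecR.
rewrite ler_wpM2r//; near: r; apply: nbhs_pinfty_ge.
by rewrite ger0_real// -(rmorph0 (real_complex R)) lecR sqrtr_ge0.
Unshelve. all: by end_near. Qed.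

Lemma translate_bop : translate \in @linear_continuous R ell2.
Proof.
by apply/linear_continuousP; split; [exact: translate_linear|exact: translate_continuous].
Qed.

End Translate.

Lemma finite_lcosets f : hecke_algebra f ->
  finite_set [set K | range (lcoset H) K /\ f (xget 1%g K) != 0].
Proof.
move=> [bf ff]; have [H1 HM HV] := sH.
pose reps (D : set G) : seq G := xget [::] [set s : seq G |
  D = \bigcup_(x in [set` s]) lcoset H x].
apply: (@sub_finite_set _ _ (\bigcup_(D in [set dcoset H g | g in [set g | f g != 0]])
    [set lcoset H x | x in [set` reps D]])); last first.
  by apply: bigcup_finite => // D _; apply: finite_image; exact: finite_seq.
move=> K /= [[g _ gK] fK].
have kK : K (xget 1%g K).
  by apply: (@xgetI _ 1%g K g); rewrite -gK; exists 1%g; rewrite ?mulg1.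
set k := xget 1%g K in fK kK; exists (dcoset H k); first by exists k.
have eD : dcoset H k = \bigcup_(x in [set` reps (dcoset H k)]) lcoset H x.
  by have [s es] := hecke.2 k; apply: (@xgetI _ [::] [set s : seq G |
    dcoset H k = \bigcup_(x in [set` s]) lcoset H x] s).
have : dcoset H k k by exists 1%g => //; exists 1%g => //; rewrite mul1g mulg1.
rewrite {1}eD => -[x xs xk] /=; exists x => //.
by rewrite -(eq_lcoset sH xk) -gK; apply: eq_lcoset => //; rewrite gK.
Qed.

Lemma lambdaE f : hecke_algebra f -> forall (xi : ell2) x,
  lambda f xi x = convolution f xi x.
Proof.
move=> ff; suff [T TE] : exists T : bop ell2,
    forall xi : ell2, T xi = convolution f xi :> (_ -> _).
  by move=> xi x; rewrite /lambda; case: xgetP => [S _ ->|/(_ T)].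
have finA := finite_lcosets ff; set A := [set K | _] in finA.
pose T K : bop ell2 := Bop (translate_bop (xget 1%g K)).
exists (\sum_(K <- finmap.enum_fset (fset_set A)) f (xget 1%g K) *: T K).
move=> xi; apply/funext => x; rewrite /convolution -(fsbig_widen A) /=; last 2 first.
- by move=> K [].
- move=> K [/= rK /not_andP[//|/negP]]; rewrite negbK => /eqP ->.
  by rewrite mul0r.
rewrite fsbig_finite//.
by apply: (big_morph (fun S : bop ell2 => S xi x)).
Qed.

End Lambda.
End HeckeAlgebra.

Section RapidDecay.
Variables (R : realType) (G : groupType) (H : set G).
Local Notation C := R[i].
Local Notation ell2 := (ell2 R (rcosets H)).

Definition reduced_hecke_algebra : set (bop ell2) :=
  closure (lambda H @` @hecke_algebra R G H).

Definition length_function (L : G -> R) :=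
  [/\ forall g, 0 <= L g, forall g h, L (g * h)%g <= L g + L h,
    forall g, L (g^-1)%g = L g, L 1%g = 0 & forall h, H h -> L h = 0].

Variable L : G -> R.

Definition weighted_norm (s : R) (f : G -> C) : \bar R :=
  ((\esum_(x in [set: rcosets H])
     (Normc.normc (f (rrepr x)) ^+ 2 * (1 + L (rrepr x)) `^ (2 * s))%:E)
   `^ 2^-1)%E.

Definition property_RD := exists C0 s : R, [/\ 0 < C0, 0 < s &
  forall f, hecke_algebra H f ->
    ((opnorm (lambda H f))%:E <= C0%:E * weighted_norm s f)%E].

Definition sobolev (s : R) : set (G -> C) :=
  [set f | bi_invariant H f /\ (weighted_norm s f < +oo)%E].

Definition rapidly_decreasing : set (G -> C) :=
  \bigcap_(s in [set s | 0 <= s]) sobolev s.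

(* a is the element of C*_r(G,H) with a(delta_H) = f. *)
Definition represents (a : bop ell2) (f : G -> C) :=
  reduced_hecke_algebra a /\
  forall g, a (delta R (rclass H 1%g)) (rclass H g) = f g.

(* H^oo_L(G,H) regarded as a subset of C*_r(G,H). *)
Definition rapid_operators : set (bop ell2) :=
  [set a | exists2 f, rapidly_decreasing f & represents a f].

End RapidDecay.

Arguments reduced_hecke_algebra R {G} H _.
Arguments rapid_operators {R G} H L _.

(* Main.v *)
(* The length l on X = H\G is replaced by its truncations min(l, n), which act as
   bounded self-adjoint multiplication operators D_n on l^2(X).  Property (RD) says
   that every rapidly decreasing f is the symbol of an operator of C*_r(G,H); applied
   to L^k |f|, it yields an operator whose matrix dominates that of the k-th iterated
   commutator of D_n with the operator of f, so these commutators are bounded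
   uniformly in n.  Conversely, applying the commutators to delta_H recovers the
   weighted norms.  Hence H^oo_L(G,H) is the set of the a in C*_r(G,H) whose iterated
   commutators with D_n are bounded uniformly in n.  Since [D_n, .] is a derivation,
   this condition passes to products, to inverses, to uniformly bounded families of
   resolvents (hence to contour integrals), and to idempotents of matrix algebras that
   commute with, and are close to, a matrix satisfying it.  A dense subalgebra with
   these matrix properties has the same Murray-von Neumann classes of idempotents as
   the whole algebra, hence the same K_0. *)

Require Import Defs.
From HB Require Import structures.
From mathcomp Require Import all_boot all_order all_algebra finmap.
From mathcomp Require Import all_classical all_reals all_analysis.
From mathcomp Require Import complex.
From mathcomp Require Import ring lra.
From mathcomp.analysis.showcase Require summability.

Set Implicit Arguments.
Unset Strict Implicit.
Unset Printing Implicit Defensive.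

Import Order.TTheory GRing.Theory Num.Theory.
Import numFieldNormedType.Exports.

Local Open Scope classical_set_scope.
Local Open Scope ring_scope.
Local Open Scope quotient_scope.

Local Notation normc := Normc.normc.

(** * Norms on abelian groups and rings *)

(** Multiplication by l is unbounded, so its commutator with an operator need not be defined on all
    of l^2(X). Truncation avoids domains and loses no uniformity, because min(., n) is 1-Lipschitz
    for every n. The obstacle is that an idempotent near a matrix over H^oo is produced as a norm
    limit, and such limits do not in general keep commutators bounded. It is therefore not
    differentiated through its approximations. The relations that characterise it (q q = q and q b =
    b q; for inverses W M = M W = 1) are differentiated instead, which controls the derivatives of
    order k+1 by those of order k. For an idempotent this yields a linear equation for d q, and the
    smallness of b - q lets the terms containing d q be absorbed. Inverses and idempotents are fixed
    points of contractions of closed subsets, so membership in the algebra and commutation relations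
    come with them. This needs only a complete submultiplicative norm, so matrix algebras need no
    C*-norm. *)

Section ZmodNorms.
Variables (R : realType) (V : zmodType) (nu : V -> R).
Implicit Types (u v : nat -> V) (x y l : V).

(** The norm is an explicit real-valued function rather than a structure on the type, so that the
    same lemmas serve complex numbers, [ell2], operators and matrices, each with its own [nu]. *)
Record zmod_norm : Prop := ZmodNorm {
  zn_ge0 : forall x, 0 <= nu x;
  zn_0 : nu 0 = 0;
  zn_eq0 : forall x, nu x = 0 -> x = 0;
  zn_D : forall x y, nu (x + y) <= nu x + nu y;
  zn_N : forall x, nu (- x) = nu x }.

Definition converges u l :=
  forall e, 0 < e -> exists N, forall n, (N <= n)%N -> nu (u n - l) < e.

Definition norm_cauchy u :=
  forall e, 0 < e -> exists N, forall m n, (N <= m)%N -> (N <= n)%N ->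
    nu (u m - u n) < e.

Definition complete_norm := forall u, norm_cauchy u -> exists l, converges u l.

Definition seq_closed (A : set V) :=
  forall u l, (forall n, A (u n)) -> converges u l -> A l.

Hypothesis nuP : zmod_norm.

Lemma zn_B x y : nu (x - y) <= nu x + nu y.
Proof. by apply: le_trans (zn_D nuP _ _) _; rewrite (zn_N nuP). Qed.

Lemma zn_distC x y : nu (x - y) = nu (y - x).
Proof. by rewrite -(zn_N nuP) opprB. Qed.

Lemma zn_distD z x y : nu (x - y) <= nu (x - z) + nu (z - y).
Proof. by apply: le_trans (zn_D nuP _ _); rewrite addrA subrK. Qed.

Lemma zn_sub_le x y : nu x <= nu y + nu (x - y).
Proof. by apply: le_trans (zn_D nuP _ _); rewrite addrC subrK. Qed.

Lemma zn_sum (I : Type) (r : seq I) (P : pred I) (F : I -> V) :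
  nu (\sum_(i <- r | P i) F i) <= \sum_(i <- r | P i) nu (F i).
Proof.
elim/big_rec2: _ => [|i y x _ le]; first by rewrite (zn_0 nuP).
by apply: le_trans (zn_D nuP _ _) _; rewrite lerD2l.
Qed.

Lemma zn_small_eq0 x : (forall e, 0 < e -> nu x < e) -> x = 0.
Proof.
move=> h; apply: (zn_eq0 nuP); apply/eqP; rewrite eq_le (zn_ge0 nuP) andbT.
by rewrite leNgt; apply/negP => /h; rewrite ltxx.
Qed.

Lemma converges_cst x : converges (fun=> x) x.
Proof. by move=> e e0; exists 0%N => n _; rewrite subrr (zn_0 nuP). Qed.

Lemma converges_ext u v l : (forall n, u n = v n) -> converges u l -> converges v l.
Proof. by move=> uv ul e /ul[N h]; exists N => n /h; rewrite uv. Qed.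

Lemma convergesB u v l k :
  converges u l -> converges v k -> converges (fun n => u n - v n) (l - k).
Proof.
move=> ul vk e e0; have e2 : 0 < e / 2 by rewrite divr_gt0.
have [N hN] := ul _ e2; have [M hM] := vk _ e2.
exists (maxn N M) => n; rewrite geq_max => /andP[/hN h1 /hM h2].
have -> : u n - v n - (l - k) = (u n - l) - (v n - k).
  by rewrite !opprB !addrA [LHS](ACl (1*4*3*2)).
by apply: le_lt_trans (zn_B _ _) _; lra.
Qed.

Lemma converges_unique u l k : converges u l -> converges u k -> l = k.
Proof.
move=> ul uk; apply/eqP; rewrite -subr_eq0; apply/eqP/zn_small_eq0 => e e0.
have := convergesB uk ul; rewrite [X in converges X _](_ : _ = fun=> 0).
  by move=> /(_ _ e0)[N /(_ N (leqnn N))]; rewrite sub0r opprB.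
by apply/funext => n; rewrite subrr.
Qed.

Lemma converges_le u l C : (forall n, nu (u n) <= C) -> converges u l -> nu l <= C.
Proof.
move=> uC ul; apply/ler_addgt0Pr => e /ul[N /(_ N (leqnn N)) h].
have := zn_sub_le l (u N); rewrite zn_distC => h2.
by have := uC N; lra.
Qed.

Lemma converges_cauchy u l : converges u l -> norm_cauchy u.
Proof.
move=> ul e e0; have e2 : 0 < e / 2 by rewrite divr_gt0.
have [N hN] := ul _ e2; exists N => m n /hN h1 /hN h2.
by have := zn_distD l (u m) (u n); rewrite (zn_distC l); lra.
Qed.

Lemma geometric_cauchy u (C : R) :
  (forall j, nu (u j.+1 - u j) <= C / 2 ^+ j) -> norm_cauchy u.
Proof.
move=> hu.
have C0 : 0 <= C by have := hu 0%N; rewrite expr0 divr1; apply: le_trans; apply: zn_ge0.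
(* The partial geometric sum is written as a difference, so that the induction on [k] telescopes. *)
have step n k : nu (u (n + k)%N - u n) <= 2 * C / 2 ^+ n - 2 * C / 2 ^+ (n + k).
  elim: k => [|k IH]; first by rewrite addn0 !subrr (zn_0 nuP).
  rewrite addnS; apply: le_trans (zn_distD (u (n + k)%N) _ _) _.
  have := hu (n + k)%N.
  by move: IH; rewrite exprS invfM; set p := (2 ^+ (n + k))^-1; lra.
have lim n k : nu (u (n + k)%N - u n) <= 2 * C / 2 ^+ n.
  apply: le_trans (step n k) _; rewrite gerBl.
  by rewrite divr_ge0 ?exprn_ge0// mulr_ge0.
move=> e e0.
have [N hN] : exists N, 4 * C / 2 ^+ N < e.
  pose N := Num.truncn (4 * C / e); exists N.
  rewrite ltr_pdivrMr ?exprn_gt0// [e * _]mulrC -ltr_pdivrMr//.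
  apply: lt_le_trans (truncnS_gt _) _.
  have : (N.+1%:R <= (2 ^ N)%:R :> R) by rewrite ler_nat; exact: ltn_expl.
  by rewrite natrX.
have NN n : (N <= n)%N -> nu (u n - u N) <= 2 * C / 2 ^+ N.
  by move=> Nn; have := lim N (n - N)%N; rewrite subnKC.
exists N => m n /NN h1 /NN h2.
have := zn_distD (u N) (u m) (u n); rewrite (zn_distC (u N)).
move: hN h1 h2; set p := (2 ^+ N)^-1; lra.
Qed.

(** The closed set [K] carries whatever the fixed point must inherit: membership in a subalgebra,
    commutation relations, a norm bound. *)
Lemma contraction_fixpoint (K : set V) (phi : V -> V) x :
  complete_norm -> seq_closed K -> K x -> (forall y, K y -> K (phi y)) ->
  (forall y z, K y -> K z -> nu (phi y - phi z) <= 2^-1 * nu (y - z)) ->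
  exists2 y, K y & phi y = y.
Proof.
move=> nuC cK Kx Kphi con; pose u n := iter n phi x.
have Ku n : K (u n) by elim: n => //= n; exact: Kphi.
have [|y uy] := nuC u.
  apply: (@geometric_cauchy _ (nu (phi x - x))); elim=> [|j IH].
    by rewrite expr0 divr1.
  apply: (le_trans (con (u j.+1) (u j) (Ku _) (Ku _))) => /=.
  by rewrite exprS invfM mulrCA ler_wpM2l.
have Ky : K y by exact: cK uy.
exists y => //; apply: (@converges_unique (fun n => u n.+1)) => e e0.
  have [N hN] := uy _ e0; exists N => n /hN h.
  apply: le_lt_trans (con _ _ (Ku n) Ky) _.
  by have := zn_ge0 nuP (u n - y); lra.
by have [N hN] := uy _ e0; exists N => n Nn; apply: hN; exact: leqW.
Qed.

End ZmodNorms.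

Section Bilinear.
Variables (R : realType) (U V W : zmodType) (mu : U -> R) (nu : V -> R) (ka : W -> R).
Variable op : U -> V -> W.
Hypotheses (muP : zmod_norm mu) (nuP : zmod_norm nu) (kaP : zmod_norm ka)
  (opBl : forall x y z, op (x - y) z = op x z - op y z)
  (opBr : forall x y z, op x (y - z) = op x y - op x z)
  (opM : forall x y, ka (op x y) <= mu x * nu y).

(** Three different groups are allowed so that this covers ring products, products of rectangular
    matrices and the inner product. *)
Lemma converges_bilinear u v l k : converges mu u l -> converges nu v k ->
  converges ka (fun n => op (u n) (v n)) (op l k).
Proof.
move=> ul vk e e0.
have mu0 := zn_ge0 muP; have nu0 := zn_ge0 nuP.
pose M := mu l + nu k + 1.
have M1 : 1 <= M by have := mu0 l; have := nu0 k; rewrite /M; lra.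
have M0 : 0 < M by lra.
(* The bound [d <= 1] gives [nu (v n) <= nu k + 1], so the total error is at most [d * M], which is
   at most half of [e]. *)
pose d := Num.min 1 (e / (2 * M)).
have d0 : 0 < d by rewrite lt_min ltr01 divr_gt0// mulr_gt0.
have [N hN] := ul _ d0; have [P hP] := vk _ d0.
exists (maxn N P) => n; rewrite geq_max => /andP[/hN h1 /hP h2].
have -> : op (u n) (v n) - op l k = op (u n - l) (v n) + op l (v n - k).
  by rewrite opBl opBr addrA subrK.
have d1 : d <= 1 by rewrite ge_min lexx.
have d2 : d * (2 * M) <= e.
  by rewrite -ler_pdivlMr ?mulr_gt0// ge_min lexx orbT.
have h3 : nu (v n) <= nu k + 1 by have := zn_sub_le nuP (v n) k; lra.
apply: le_lt_trans (zn_D kaP _ _) _.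
have h4 : ka (op (u n - l) (v n)) <= d * (nu k + 1).
  by apply: le_trans (opM _ _) _; apply: ler_pM => //; exact: ltW.
have h5 : ka (op l (v n - k)) <= mu l * d.
  by apply: le_trans (opM _ _) _; rewrite ler_wpM2l// ltW.
have : d * (nu k + 1) + mu l * d <= d * M by rewrite /M; lra.
nra.
Qed.

End Bilinear.

(** * Inverses and idempotents in complete normed rings *)

Section RingNorms.
Variables (R : realType) (B : pzRingType) (nu : B -> R).
Implicit Types (a b c e q x y w t : B) (A : set B).

(** The value [nu 1] is left free because the entrywise norm of an identity matrix grows with its
    size; hence the factors [nu 1] in the estimates below. *)
Definition ring_norm :=
  zmod_norm nu /\ forall x y, nu (x * y) <= nu x * nu y.

Hypothesis nuP : ring_norm.
Let zP : zmod_norm nu := nuP.1.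
Let nuM := nuP.2.
Let nu_ge0 := zn_ge0 zP.

Lemma rnM3 x y z : nu (x * y * z) <= nu x * nu y * nu z.
Proof. by apply: le_trans (nuM _ _) _; rewrite ler_wpM2r. Qed.

Lemma rnM_le x y C D : nu x <= C -> nu y <= D -> nu (x * y) <= C * D.
Proof.
by move=> xC yD; apply: le_trans (nuM _ _) _; apply: ler_pM.
Qed.

Lemma convergesM u v l k : converges nu u l -> converges nu v k ->
  converges nu (fun n => u n * v n) (l * k).
Proof.
by apply: (converges_bilinear zP zP zP (op := @GRing.mul B)) => // x y z;
  rewrite ?mulrBl ?mulrBr.
Qed.

Lemma converges_mull x u l : converges nu u l -> converges nu (fun n => x * u n) (x * l).
Proof. by move=> ul; apply: convergesM => //; exact: converges_cst. Qed.

Lemma converges_mulr x u l : converges nu u l -> converges nu (fun n => u n * x) (l * x).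
Proof. by move=> ul; apply: convergesM => //; exact: converges_cst. Qed.

Section Complete.
Hypothesis nuC : complete_norm nu.
Variable A : set B.
Hypotheses (sA : set_subring A) (cA : seq_closed nu A).

Lemma set_subring1 : A 1. Proof. by case: sA. Qed.
Lemma set_subringB x y : A x -> A y -> A (x - y).
Proof. by case: sA => _ + _; apply. Qed.
Lemma set_subringM x y : A x -> A y -> A (x * y).
Proof. by case: sA => _ _; apply. Qed.
Lemma set_subring0 : A 0.
Proof. by rewrite -(subrr 1); apply: set_subringB; apply: set_subring1. Qed.
Lemma set_subringN x : A x -> A (- x).
Proof. by move=> Ax; rewrite -sub0r; apply: set_subringB => //; apply: set_subring0. Qed.
Lemma set_subringD x y : A x -> A y -> A (x + y).
Proof. by move=> Ax Ay; rewrite -[y]opprK; apply: set_subringB => //; apply: set_subringN. Qed.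
Lemma set_subring_sum (I : Type) (r : seq I) (P : pred I) (F : I -> B) :
  (forall i, P i -> A (F i)) -> A (\sum_(i <- r | P i) F i).
Proof.
move=> h; elim/big_rec: _ => [|i x Pi Ax]; first exact: set_subring0.
by apply: set_subringD => //; apply: h.
Qed.
Lemma set_subring_nat n : A n%:R.
Proof.
elim: n => [|n IH]; first exact: set_subring0.
by rewrite -natr1; apply: set_subringD => //; apply: set_subring1.
Qed.

Definition commutes_set (b : B) : set B := [set y | b * y = y * b].

Lemma seq_closed_commutes b : seq_closed nu (commutes_set b).
Proof.
move=> u l ub ul; apply: (converges_unique zP (u := fun n => b * u n)).
  exact: converges_mull.
by apply: converges_ext (converges_mulr b ul) => n; rewrite ub.
Qed.

Lemma seq_closed_ball r : seq_closed nu [set y | nu y <= r].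
Proof. by move=> u l ur ul; apply: (converges_le zP ur ul). Qed.

Lemma seq_closedI (E F : set B) :
  seq_closed nu E -> seq_closed nu F -> seq_closed nu (E `&` F).
Proof.
by move=> cE cF u l uEF ul; split;
  [apply: cE ul => n|apply: cF ul => n]; case: (uEF n).
Qed.

(** The inverse of [1 - x] is the fixed point of [y = 1 + x y], sought among the elements of [A]
    that commute with everything commuting with [x]. Taking [b = x] turns the one-sided inverse into
    a two-sided one; other choices of [b] are needed when the inverse has to commute with a given
    idempotent or approximate idempotent. *)
Lemma neumann x : A x -> nu x <= 2^-1 ->
  exists y, [/\ A y, (1 - x) * y = 1, y * (1 - x) = 1, nu y <= 2 * nu 1 &
    forall b, x * b = b * x -> y * b = b * y].
Proof.
move=> Ax x2.
have [||||y [Ay yc] yfix] := @contraction_fixpoint _ _ nu zP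
    (A `&` \bigcap_(b in commutes_set x) commutes_set b) (fun y => 1 + x * y) 1 nuC.
- apply: seq_closedI => // u l ub ul b xb.
  by apply: (seq_closed_commutes (u := u)) => // n; apply: ub.
- by split; [apply: set_subring1|move=> b _; rewrite /commutes_set/= mulr1 mul1r].
- move=> y [Ay yc]; split.
    by apply: set_subringD; [apply: set_subring1|apply: set_subringM].
  move=> b xb; rewrite /commutes_set/= mulrDr mulrDl mulr1 mul1r; congr (_ + _).
  by rewrite mulrA -xb -mulrA (yc b xb) mulrA.
- move=> y z _ _; rewrite opprD addrACA subrr add0r -mulrBr.
  exact: rnM_le.
have xy : x * y = y * x by apply: yc.
exists y; split => //.
- by rewrite mulrBl mul1r -{1}yfix addrK.
- by rewrite mulrBr mulr1 -xy -{1}yfix addrK.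
- have := rnM_le x2 (lexx (nu y)); have := zn_D zP 1 (x * y).
  by rewrite yfix; lra.
- by move=> b xb; apply/esym/yc.
Qed.

(* q = b - (2b - 1) y, where y is the small root of y = y^2 + t and
   t = c (1 + 4c)^-1 for c = b^2 - b; indeed
   q^2 - q = c - (2b - 1)^2 (y - y^2) and (2b - 1)^2 = 1 + 4c. *)
Lemma idempotent_lift b : A b -> 16 * nu 1 * nu (b * b - b) <= 1 ->
    8 * nu (b * b - b) <= 1 ->
  exists q, [/\ A q, q * q = q, q * b = b * q &
    nu (q - b) <= 4 * nu 1 * nu (2 * b - 1) * nu (b * b - b)].
Proof.
move=> Ab; set c := b * b - b => c16 c8.
have Ac : A c by apply: set_subringB => //; apply: set_subringM.
have n4 : nu (- (c *+ 4)) <= 4 * nu c.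
  rewrite (zn_N zP); have := zn_D zP c c; rewrite -mulr2n => h.
  by have := zn_D zP (c *+ 2) (c *+ 2); rewrite -mulrnDr; lra.
(* Here [w] is the inverse of [1 + 4 c]; the assumption [8 * nu c <= 1] makes [- 4 c] small
   enough. *)
have [||w [Aw cw wc nw comw]] := @neumann (- (c *+ 4)).
- by apply: set_subringN; rewrite -mulr_natr; apply: set_subringM => //; apply: set_subring_nat.
- by lra.
rewrite opprK in cw wc.
have cb : c * b = b * c by rewrite mulrBl mulrBr mulrA.
have wb : w * b = b * w.
  by apply: comw; rewrite mulNr mulrN mulrnAl mulrnAr cb.
pose t := c * w.
have tb : b * t = t * b by rewrite /t mulrA -cb -!mulrA wb.
have At : A t by apply: set_subringM.
have nt : nu t <= nu c * (2 * nu 1) by exact: rnM_le.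
have t8 : nu t <= 8^-1.
  by move: nt c16; set X := nu c; set Y := nu 1; lra.
have t0 := nu_ge0 t.
(* Since [nu t <= 1/8], the ball of radius [2 * nu t] has radius at most 1/4. There
   [y |-> t + y * y] stays in the ball, and it contracts by twice the radius, hence by 1/2. *)
have [||||y [[Ay yb] yt] yfix] := @contraction_fixpoint _ _ nu zP
    (A `&` commutes_set b `&` [set y | nu y <= 2 * nu t]) (fun y => t + y * y) t nuC.
- apply: seq_closedI; last exact: seq_closed_ball.
  by apply: seq_closedI => //; exact: seq_closed_commutes.
- by split; [split|rewrite /=; lra].
- move=> y [[Ay yb] /= yt]; split; [split|].
  + by apply: set_subringD => //; apply: set_subringM.
  + by rewrite /commutes_set/= mulrDr mulrDl tb mulrA yb -mulrA yb mulrA.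
  + have := zn_D zP t (y * y); have := rnM_le yt yt; rewrite /=; nra.
- move=> y z [[Ay yb] /= yt] [[Az zb] /= zt].
  have -> : t + y * y - (t + z * z) = y * (y - z) + (y - z) * z.
    by rewrite mulrBr mulrBl addrA subrK opprD addrACA subrr add0r.
  have := zn_D zP (y * (y - z)) ((y - z) * z).
  have := rnM_le yt (lexx (nu (y - z))).
  by have := rnM_le (lexx (nu (y - z))) zt; have := nu_ge0 (y - z); nra.
pose v := 2 * b - 1; rewrite -/v.
have Av : A v.
  apply: set_subringB; last exact: set_subring1.
  by apply: set_subringM => //; apply: set_subring_nat.
have vb : v * b = b * v by rewrite /v mulr_natl mulrBl mulrBr mul1r mulr1 mulrnAl mulrnAr.
have vy : v * y = y * v.
  by rewrite /v mulr_natl mulrBl mulrBr mul1r mulr1 mulrnAl mulrnAr yb.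
have vv : v * v = 1 + c *+ 4.
  rewrite /v mulr_natl mulrBl mul1r mulrBr mulr1 mulrnAl mulrnAr -mulrnA.
  have -> : c *+ 4 = b * b *+ 4 - (b *+ 2 + b *+ 2) by rewrite mulrnBl -mulrnDr.
  move: (b * b *+ (2 * 2)) (b *+ 2) => s u.
  by rewrite opprB opprD !addrA [RHS](ACl (2*3*1*4)).
have e2 : 2 * b = v + 1 by rewrite subrK.
(* From here on only [v * v = 1 + 4 c], [2 * b = v + 1] and the commutation of [v] with [b] and [y]
   matter. *)
clearbody v; exists (b - v * y); split.
- by apply: set_subringB => //; apply: set_subringM.
- have e1 : (b - v * y) * (b - v * y) = b * b - v * y * (2 * b) + v * v * (y * y).
    rewrite mulrBl !mulrBr.
    have -> : b * (v * y) = v * y * b by rewrite mulrA -vb -!mulrA yb.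
    have -> : v * y * (v * y) = v * v * (y * y).
      by rewrite -!mulrA; congr (_ * _); rewrite !mulrA vy.
    have -> : v * y * (2 * b) = v * y * b + v * y * b.
      by rewrite mulr_natl mulrnAr mulr2n.
    by rewrite opprB opprD !addrA [LHS](ACl (1*2*4*3)).
  apply/eqP; rewrite -subr_eq0; apply/eqP.
  have -> : (b - v * y) * (b - v * y) - (b - v * y) = c - v * v * (y - y * y).
    rewrite e1 e2 mulrDr mulr1 [v * y * v](_ : _ = v * v * y); last first.
      by rewrite -mulrA -vy mulrA.
    rewrite mulrBr /c; move: (v * v * y) (v * v * (y * y)) (v * y) (b * b) => k l m n.
    by rewrite !opprD !opprK !addrA [LHS](ACl (1*5*2*4*3*6)) /= subrK.
  have -> : y - y * y = t by rewrite -{1}yfix addrK.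
  have cc x : (1 + x *+ 4) * x = x * (1 + x *+ 4).
    by rewrite mulrDl mulrDr mul1r mulr1 mulrnAl mulrnAr.
  by rewrite vv /t mulrA cc -mulrA cw mulr1 subrr.
- by rewrite mulrBl mulrBr; congr (_ - _); rewrite [RHS]mulrA -vb -!mulrA yb.
- rewrite addrC addKr (zn_N zP).
  have := rnM_le (lexx (nu v)) yt.
  have := nu_ge0 v; have := nu_ge0 1; have := nu_ge0 c.
  move: nt; set X := nu c; set Y := nu 1; set Z := nu v; nra.
Qed.

End Complete.
End RingNorms.

(** * Elements with bounded iterated derivatives *)

Section Tame.
Variables (R : realType) (B : pzRingType) (nu : B -> R) (I : Type) (d : I -> B -> B).
Hypotheses (nuP : ring_norm nu)
  (dB : forall i x y, d i (x - y) = d i x - d i y)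
  (dM : forall i x y, d i (x * y) = d i x * y + x * d i y).
Implicit Types (a b h q u v w y : I -> B).

Let zP : zmod_norm nu := nuP.1.
Let nuM := nuP.2.

Lemma derivation1 i : d i 1 = 0.
Proof.
have := dM i 1 1; rewrite !mulr1 mul1r => /eqP.
by rewrite -subr_eq0 opprD addrA subrr add0r oppr_eq0 => /eqP.
Qed.

Lemma derivation0 i : d i 0 = 0.
Proof. by have := dB i 0 0; rewrite !subrr. Qed.

Lemma derivationD i (x y : B) : d i (x + y) = d i x + d i y.
Proof.
by have := dB i x (- y); have := dB i 0 y; rewrite opprK sub0r derivation0 sub0r => ->; rewrite opprK.
Qed.

Definition uniformly_bounded a := exists C, forall i, nu (a i) <= C.

Definition derive_family a : I -> B := fun i => d i (a i).
Local Notation D := derive_family.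

(** Families rather than single elements are differentiated, because the bounds must be uniform in
    the index of the derivation and, for contour integrals, also in the point of the contour. A
    single element is a constant family. Only powers of one and the same [d i] occur, never mixed
    derivatives. *)
Fixpoint tame k a : Prop :=
  uniformly_bounded a /\ if k is k'.+1 then tame k' (D a) else True.

Lemma tame_bounded k a : tame k a -> uniformly_bounded a.
Proof. by case: k => [|k] []. Qed.

Lemma tameW k a : tame k.+1 a -> tame k a.
Proof.
elim: k a => [a []//|k IH a [ba ta]]; split=> //; exact: IH.
Qed.

Lemma tame_iter k a : (forall j, (j <= k)%N -> uniformly_bounded (iter j D a)) <->
  tame k a.
Proof.
elim: k a => [|k IH] a.
  by split=> [h|[h _] [|//]] //; split => //; exact: (h 0%N).
split=> [h|[ba /IH h] [//|j jk]]; last by rewrite iterSr; exact: h.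
split; first exact: (h 0%N).
by apply/IH => j jk; rewrite -iterSr; exact: h.
Qed.

Lemma bounded_lin a b h : uniformly_bounded a -> uniformly_bounded b ->
  (forall i, nu (h i) <= nu (a i) + nu (b i)) -> uniformly_bounded h.
Proof.
move=> [C aC] [E bE] hab; exists (C + E) => i.
by apply: le_trans (hab i) _; exact: lerD.
Qed.

Lemma tameB k a b : tame k a -> tame k b -> tame k (fun i => a i - b i).
Proof.
elim: k a b => [|k IH] a b [ba ta] [bb tb]; split=> //;
  try by apply: (bounded_lin ba bb) => i; exact: zn_B.
rewrite (_ : D _ = fun i => D a i - D b i); first exact: IH.
by apply/funext => i; exact: dB.
Qed.

Lemma tame_eq k a b : (forall i, a i = b i) -> tame k a -> tame k b.
Proof. by move=> /funext ->. Qed.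

Lemma tame0 k : tame k (fun=> 0).
Proof.
elim: k => [|k IH]; split=> //; try by exists 0 => _; rewrite (zn_0 zP).
by apply: tame_eq IH => i; rewrite /derive_family derivation0.
Qed.

Lemma tameN k a : tame k a -> tame k (fun i => - a i).
Proof. by move=> ta; apply: tame_eq (tameB (tame0 k) ta) => i; rewrite sub0r. Qed.

Lemma tameD k a b : tame k a -> tame k b -> tame k (fun i => a i + b i).
Proof. by move=> ta tb; apply: tame_eq (tameB ta (tameN tb)) => i; rewrite opprK. Qed.

Lemma tame1 k : tame k (fun=> 1).
Proof.
case: k => [|k]; split=> //; try by exists (nu 1).
apply: tame_eq (tame0 k) => i; rewrite /derive_family.
by rewrite derivation1.
Qed.

Lemma tameM k a b : tame k a -> tame k b -> tame k (fun i => a i * b i).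
Proof.
have bM a' b' : uniformly_bounded a' -> uniformly_bounded b' ->
    uniformly_bounded (fun i => a' i * b' i).
  by move=> [C aC] [E bE]; exists (C * E) => i; exact: rnM_le.
elim: k a b => [|k IH] a b ta tb.
  by split=> //; apply: bM; apply: (@tame_bounded 0).
split; first by apply: bM; [exact: tame_bounded ta|exact: tame_bounded tb].
rewrite (_ : D _ = fun i => D a i * b i + a i * D b i).
  by apply: tameD; apply: IH; [case: ta|exact: tameW|exact: tameW|case: tb].
by apply/funext => i; exact: dM.
Qed.

(* Differentiating b a = 1 gives d b = - b (d a) b. *)
Lemma tame_inv k a b : (forall i, b i * a i = 1 /\ a i * b i = 1) ->
  uniformly_bounded b -> tame k a -> tame k b.
Proof.
move=> ab bb; elim: k => [|k IH] ta; first by split.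
have tb : tame k b by exact/IH/tameW.
split=> //; apply: (@tame_eq _ (fun i => - (b i * D a i * b i))); last first.
  by apply: tameN; apply: tameM => //; apply: tameM => //; exact: ta.2.
move=> i; have [ba ab1] := ab i; apply/eqP; rewrite eq_sym -addr_eq0.
have d1 : d i 1 = 0.
  have := dM i 1 1; rewrite !mulr1 mul1r => /eqP.
  by rewrite -subr_eq0 opprD addNKr oppr_eq0 => /eqP.
have : (d i (b i) * a i + b i * d i (a i)) * b i = 0 by rewrite -dM ba derivation1 mul0r.
by rewrite mulrDl -mulrA ab1 mulr1 => /eqP.
Qed.

(** The terms containing [y] besides [y] itself have norm at most half of [nu (y i)] and are
    absorbed on the left, which gives the factor 2. *)
Lemma bounded_solution y u v w h :
  (forall i, y i + u i * y i + v i * y i * w i = h i) ->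
  (forall i, nu (u i) + nu (v i) * nu (w i) <= 2^-1) ->
  uniformly_bounded h -> uniformly_bounded y.
Proof.
move=> yh small [C hC]; exists (2 * C) => i.
have h2 : nu (u i * y i) <= nu (u i) * nu (y i) by exact: nuM.
have h3 : nu (v i * y i * w i) <= nu (v i) * nu (y i) * nu (w i) by exact: rnM3.
have h4 := zn_sub_le zP (y i) (h i).
rewrite -{2}yh -!addrA opprD addNKr (zn_N zP) in h4.
have h5 := zn_D zP (u i * y i) (v i * y i * w i).
by have := small i; have := hC i; have := zn_ge0 zP (y i); nra.
Qed.

(** Differentiating the equation gives one of the same shape for [D y], with the same small
    coefficients [u], [v], [w]. The new right-hand side contains [y] undifferentiated, whose
    tameness of order [k] is already known, so the order rises one step at a time. *)
Lemma tame_linear k y u v w h :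
  (forall i, y i + u i * y i + v i * y i * w i = h i) ->
  (forall i, nu (u i) + nu (v i) * nu (w i) <= 2^-1) ->
  tame k u -> tame k v -> tame k w -> tame k h -> tame k y.
Proof.
move=> + small; elim: k y h => [|k IH] y h yh tu tv tw th.
  by split=> //; exact: bounded_solution yh small (tame_bounded th).
split; first exact: bounded_solution yh small (tame_bounded th).
have ty : tame k y by apply: (IH _ h) => //; exact: tameW.
pose g i := D h i - D u i * y i - D v i * y i * w i - v i * y i * D w i.
have tg : tame k g.
  apply: tameB; [apply: tameB; [apply: tameB|]|].
  - exact: th.2.
  - by apply: tameM => //; exact: tu.2.
  - by apply: tameM; [apply: tameM => //; exact: tv.2|exact: tameW].
  - by apply: tameM; [apply: tameM => //; exact: tameW|exact: tw.2].
have yg i : D y i + u i * D y i + v i * D y i * w i = g i.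
  rewrite /g /derive_family -yh !derivationD !dM !mulrDl.
  set a1 := d i (y i); set a2 := d i (u i) * y i; set a3 := _ * d i (y i) in a2 *.
  set a4 := d i (v i) * _ * _; set a5 := _ * w i; set a6 := _ * d i (w i).
  rewrite !addrA.
  by rewrite [RHS](ACl (1*3*5*(2*7)*(4*8)*(6*9)))/= !subrr !addr0.
by apply: (IH (D y) g) => //; exact: tameW.
Qed.

(* For y = d q one has q y + y q = y, so (2q - 1)(q y - y q) = y, while
   q b = b q gives b y - y b = q (d b) - (d b) q. *)
Lemma tame_idempotent k (b q : B) : q * q = q -> q * b = b * q ->
  4 * nu (2 * q - 1) * nu (b - q) <= 1 ->
  (forall k, tame k (fun=> b)) -> tame k (fun=> q).
Proof.
move=> qq qb small tb.
pose s := 2 * q - 1; pose r := b - q.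
(* Multiplying [q y + y q = y] by [q] gives [q y q = 0], so that [(2 q - 1)(q y - y q)] reduces to
   [q y + y q]. *)
have ss (y : B) : q * y + y * q = y -> s * (q * y - y * q) = y.
  move=> qy; have qyq : q * y * q = 0.
    have : q * (q * y + y * q) = q * y by rewrite qy.
    by rewrite mulrDr !mulrA qq => /eqP; rewrite -subr_eq0 addrC addKr => /eqP.
  rewrite /s mulrBl mul1r mulrBr !mulrA -(mulrA 2) qq -(mulrA 2 q) -(mulrA 2) qyq mulr0 subr0.
  rewrite mulr_natl mulr2n opprB addrA -addrA addrCA.
  by rewrite -[RHS]qy !addrA addrK addrC.
elim: k => [|k IH]; first by split=> //; exists (nu q).
split; first by exists (nu q).
have td : tame k (D (fun=> b)) by exact: (tb k.+1).2.
have t2 : tame k (fun=> s).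
  apply: tameB; last exact: tame1.
  by apply: tame_eq (tameD IH IH) => i; rewrite mulr_natl mulr2n.
have tr : tame k (fun=> r) by apply: tameB.
have rE : r = b - q by [].
rewrite -/s -/r in small; clearbody s r.
(* With [b = q + r], the product [s (b y - y b)] equals [y + s r y - s y r]. The commutation
   [q b = b q] makes it equal to a right-hand side in which [q] is not differentiated. The
   coefficients have total size at most [2 * nu s * nu r], hence at most 1/2. *)
apply: (@tame_linear k _ (fun=> s * r) (fun=> - s) (fun=> r)
  (fun i => s * (q * d i b - d i b * q))).
- move=> i; rewrite /derive_family; set y := d i q.
  have qy : q * y + y * q = y by rewrite addrC -dM qq.
  have byb : b * y - y * b = q * d i b - d i b * q.
    have : d i (q * b) = d i (b * q) by rewrite qb.
    rewrite !dM -/y => e; apply/eqP.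
    by rewrite subr_eq addrAC eq_sym subr_eq addrC e addrC.
  have -> : y + s * r * y + - s * y * r = s * (q * y - y * q) + s * (r * y - y * r).
    by rewrite (ss y qy) mulrBr !mulNr !mulrA addrA.
  rewrite -byb -mulrDr; congr (s * _); rewrite rE mulrBl mulrBr.
  move: (q * y) (y * q) (b * y) (y * b) => e f g h.
  by rewrite opprB !addrA [LHS](ACl (3*6*1*4*2*5)) /= addrK subrK.
- move=> i; rewrite (zn_N zP); have := nuM s r; lra.
- exact: tameM.
- exact: tameN.
- by [].
- apply: tameM => //; apply: tameB; exact: tameM.
Qed.

End Tame.

(** * Matrices over a normed ring *)

Section MatrixNorm.
Variables (R : realType) (B : pzRingType) (nu : B -> R).
Hypothesis nuP : ring_norm nu.
Let zP : zmod_norm nu := nuP.1.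
Let nuM := nuP.2.
Let nu_ge0 := zn_ge0 zP.

(** The sum of the entry norms is complete and submultiplicative, which is all that is needed;
    matrices need not be realised as operators on a sum of Hilbert spaces. *)
Definition mxnorm m n (M : 'M[B]_(m, n)) : R := \sum_i \sum_j nu (M i j).

(** Matrices over a subring are kept as matrices over [B], so that norms and limits live in one
    ring; the subring types return only when classes of idempotents are compared. *)
Definition mx_in (A : set B) m n (M : 'M[B]_(m, n)) := forall i j, A (M i j).

Lemma le_mxnorm m n (M : 'M[B]_(m, n)) i j : nu (M i j) <= mxnorm M.
Proof.
rewrite /mxnorm (bigD1 i)//= (bigD1 j)//= -addrA lerDl addr_ge0//.
  by apply: sumr_ge0 => k _.
by apply: sumr_ge0 => k _; apply: sumr_ge0.
Qed.

Lemma mxnorm_zmod m n : zmod_norm (@mxnorm m n).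
Proof.
split=> [M||M M0|M N|M].
- by apply: sumr_ge0 => i _; apply: sumr_ge0.
- by apply: big1 => i _; apply: big1 => j _; rewrite mxE (zn_0 zP).
- apply/matrixP => i j; rewrite mxE; apply: (zn_eq0 zP); apply/eqP.
  by rewrite eq_le nu_ge0 andbT -M0 le_mxnorm.
- rewrite /mxnorm -big_split; apply: ler_sum => i _.
  by rewrite -big_split; apply: ler_sum => j _; rewrite mxE; exact: zn_D.
- by apply: eq_bigr => i _; apply: eq_bigr => j _; rewrite mxE (zn_N zP).
Qed.

Lemma mxnormM m n p (M : 'M[B]_(m, n)) (N : 'M[B]_(n, p)) :
  mxnorm (M *m N) <= mxnorm M * mxnorm N.
Proof.
rewrite /mxnorm mulr_suml; apply: ler_sum => i _.
apply: (@le_trans _ _ (\sum_j \sum_k nu (M i k) * nu (N k j))).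
  apply: ler_sum => j _; rewrite mxE; apply: le_trans (zn_sum zP _ _ _) _.
  by apply: ler_sum => k _.
rewrite exchange_big/= mulr_suml; apply: ler_sum => k _.
rewrite -mulr_sumr ler_wpM2l// (bigD1 k)//= lerDl.
by apply: sumr_ge0 => i' _; apply: sumr_ge0.
Qed.

Lemma mxnorm_ring n : ring_norm (@mxnorm n n).
Proof. by split; [exact: mxnorm_zmod|exact: mxnormM]. Qed.

Lemma mx_converges m n (U : nat -> 'M[B]_(m, n)) (L : 'M[B]_(m, n)) :
  (forall i j, converges nu (fun k => U k i j) (L i j)) -> converges (@mxnorm m n) U L.
Proof.
move=> UL e e0.
(* The additional 1 keeps [c] positive for empty matrices and makes the final bound [m n e / c]
   strictly smaller than [e]. *)
pose c := (m * n).+1%:R : R; have c0 : 0 < c by rewrite ltr0n.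
have ec : 0 < e / c by rewrite divr_gt0.
have /choice[f hf] i : exists F, forall k, (F <= k)%N ->
    forall j, nu (U k i j - L i j) < e / c.
  have /choice[f hf] j := UL i j _ ec.
  exists (\max_j f j) => k kf j; apply: hf.
  by apply: leq_trans kf; exact: (leq_bigmax j).
exists (\max_i f i) => k kf.
apply: (@le_lt_trans _ _ (\sum_(i < m) \sum_(j < n) (e / c))).
  apply: ler_sum => i _; apply: ler_sum => j _.
  have := hf i k _ j; rewrite !mxE => h; apply/ltW/h.
  by apply: leq_trans kf; exact: (leq_bigmax i).
rewrite !sumr_const !card_ord -mulrnA -mulr_natl mulrCA gtr_pMr//.
by rewrite ltr_pdivrMr// mul1r ltr_nat mulnC ltnS.
Qed.

Lemma converges_mx m n (U : nat -> 'M[B]_(m, n)) (L : 'M[B]_(m, n)) i j :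
  converges (@mxnorm m n) U L -> converges nu (fun k => U k i j) (L i j).
Proof.
move=> UL e /UL[N hN]; exists N => k /hN; apply: le_lt_trans.
by have := le_mxnorm (U k - L) i j; rewrite !mxE.
Qed.

Lemma mx_complete m n : complete_norm nu -> complete_norm (@mxnorm m n).
Proof.
move=> nuC U cU.
have ex i j : exists l, converges nu (fun k => U k i j) l.
  apply: nuC => e /cU[N hN]; exists N => k l kN lN; apply: le_lt_trans (hN _ _ kN lN).
  by have := le_mxnorm (U k - U l) i j; rewrite !mxE.
have /choice[F hF] (ij : 'I_m * 'I_n) := ex ij.1 ij.2.
exists (\matrix_(i, j) F (i, j)); apply: mx_converges => i j; rewrite mxE.
exact: hF (i, j).
Qed.

Lemma mx_seq_closed A m n : seq_closed nu A -> seq_closed (@mxnorm m n) (@mx_in A m n).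
Proof.
move=> cA U L UA UL i j; apply: cA (converges_mx i j UL) => k; exact: UA.
Qed.

Section MatrixIn.
Variable A : set B.
Hypothesis sA : set_subring A.

Lemma mx_inB m n (M N : 'M[B]_(m, n)) : mx_in A M -> mx_in A N -> mx_in A (M - N).
Proof. by move=> MA NA i j; rewrite !mxE; apply: set_subringB. Qed.

Lemma mx_inM m n p (M : 'M[B]_(m, n)) (N : 'M[B]_(n, p)) :
  mx_in A M -> mx_in A N -> mx_in A (M *m N).
Proof.
move=> MA NA i j; rewrite mxE; apply: set_subring_sum => // k _.
exact: set_subringM.
Qed.

Lemma mx_in1 n : mx_in A (1%:M : 'M[B]_n).
Proof.
by move=> i j; rewrite mxE; exact: set_subring_nat.
Qed.

Lemma mx_subring n : set_subring (@mx_in A n n).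
Proof. by split; [exact: mx_in1|exact: mx_inB|move=> x y; exact: mx_inM]. Qed.

End MatrixIn.

Lemma mx_dense (A S : set B) m n (M : 'M[B]_(m, n)) :
  (forall a, A a -> forall e, 0 < e -> exists2 s, S s & nu (a - s) < e) ->
  mx_in A M -> exists2 U : nat -> 'M[B]_(m, n),
    (forall k, mx_in S (U k)) & converges (@mxnorm m n) U M.
Proof.
move=> dS MA.
have h (x : 'I_m * 'I_n * nat) : exists s, S s /\ nu (M x.1.1 x.1.2 - s) < x.2.+1%:R^-1.
  have [|s Ss hs] := dS _ (MA x.1.1 x.1.2) (x.2.+1%:R^-1); first by rewrite invr_gt0 ltr0n.
  by exists s.
have [f hf] := choice h.
exists (fun k => \matrix_(i, j) f (i, j, k)).
  by move=> k i j; rewrite mxE; case: (hf (i, j, k)).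
apply: mx_converges => i j e e0; exists (Num.truncn e^-1) => k ke.
rewrite mxE zn_distC//; have [_ /= h1] := hf (i, j, k).
apply: lt_le_trans h1 _; rewrite invf_ple ?posrE ?ltr0n//.
apply: ltW; apply: lt_le_trans (truncnS_gt _) _.
by rewrite ler_nat ltnS.
Qed.

Section MatrixTame.
Variables (I : Type) (d : I -> B -> B).
Hypotheses (dB : forall i x y, d i (x - y) = d i x - d i y)
  (dM : forall i x y, d i (x * y) = d i x * y + x * d i y).

(** When [d i] is the commutator with an operator, this is the commutator with the corresponding
    scalar matrix. *)
Definition mx_derive n i (M : 'M[B]_n) : 'M[B]_n := map_mx (d i) M.

Lemma mx_deriveB n i (M N : 'M[B]_n) :
  mx_derive i (M - N) = mx_derive i M - mx_derive i N.
Proof. by apply/matrixP => k l; rewrite !mxE dB. Qed.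

Lemma mx_deriveM n i (M N : 'M[B]_n) :
  mx_derive i (M * N) = mx_derive i M * N + M * mx_derive i N.
Proof.
apply/matrixP => k l; rewrite !mxE -big_split/=.
rewrite (big_morph (d i) (derivationD dB i) (derivation0 dB i)).
by apply: eq_bigr => j _; rewrite !mxE dM.
Qed.

Lemma tame_mx n k (M : I -> 'M[B]_n) :
  tame (@mxnorm n n) (@mx_derive n) k M <-> forall a b, tame nu d k (fun i => M i a b).
Proof.
have bnd (M' : I -> 'M[B]_n) : uniformly_bounded (@mxnorm n n) M' <->
    forall a b, uniformly_bounded nu (fun i => M' i a b).
  split=> [[C hC] a b|h].
    by exists C => i; apply: le_trans (hC i); exact: le_mxnorm.
  have /choice[C hC] (x : 'I_n * 'I_n) := h x.1 x.2.
  exists (\sum_a \sum_b C (a, b)) => i.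
  by apply: ler_sum => a _; apply: ler_sum => b _; exact: (hC (a, b)).
elim: k M => [|k IH] M /=.
  split=> [[/bnd h _] a b|h]; split => //; apply/bnd => a b; by case: (h a b).
have E a b : derive_family d (fun i => M i a b) =
    (fun i => derive_family (@mx_derive n) M i a b).
  by apply/funext => i; rewrite /derive_family mxE.
split=> [[/bnd h /IH t] a b|h]; first by rewrite E; split.
split; first by apply/bnd => a b; case: (h a b).
by apply/IH => a b; rewrite -E; case: (h a b).
Qed.

End MatrixTame.

End MatrixNorm.

(** * K-theory of a dense subring *)

Lemma groth_map_bijective (M N : nmodType) (f : {additive M -> N}) :
  bijective f -> bijective (groth_map f).
Proof.
move=> [g fK gK].
have gD : {morph g : x y / x + y} by move=> x y; rewrite -[RHS]fK raddfD !gK.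
rewrite -setTT_bijective; split=> //.
- move=> x y _ _; elim/quotW: x => p; elim/quotW: y => q.
  rewrite !pi_groth_map => /eqmodP/asboolP[k /= e].
  apply/eqmodP/asboolP; exists (g k).
  by apply: (can_inj fK); rewrite !raddfD gK.
- move=> y _; elim/quotW: y => q; exists (\pi_(groth M) (g q.1, g q.2)) => //.
  by rewrite pi_groth_map /= !gK; case: q.
Qed.

Section DenseSubring.
Variables (R : realType) (B : pzRingType) (nu : B -> R).
Hypotheses (nuP : ring_norm nu) (nuC : complete_norm nu).
Variables (S A : set B) (sS : set_subring S) (sA : set_subring A).
Hypothesis SA : S `<=` A.
Hypothesis cA : seq_closed nu A.
Hypothesis dS : forall a, A a -> forall e, 0 < e -> exists2 s, S s & nu (a - s) < e.
(** These two closure properties stand in for holomorphic calculus in the matrix algebras: stability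
    under inverses gives injectivity on classes of idempotents, stability under nearby commuting
    idempotents gives surjectivity. *)
Hypothesis invS : forall n (M W : 'M[B]_n), mx_in S M -> mx_in A W ->
  W * M = 1 -> M * W = 1 -> mx_in S W.
Hypothesis idemS : forall n (b q : 'M[B]_n), mx_in S b -> mx_in A q ->
  q * q = q -> q * b = b * q ->
  4 * mxnorm nu (2 * q - 1) * mxnorm nu (b - q) <= 1 -> mx_in S q.

Let mzP m n := @mxnorm_zmod R B nu nuP m n.
Let mrP n := @mxnorm_ring R B nu nuP n.
Let mC n := @mx_complete R B nu nuP n n nuC.
Let msA n := mx_subring sA n.
Let mcA n := @mx_seq_closed R B nu nuP A n n cA.

Lemma mx_in_sub m n (M : 'M[B]_(m, n)) : mx_in S M -> mx_in A M.
Proof. by move=> h i j; apply: SA. Qed.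

(* Multiplying the intertwiners u2, v2 close to u, v by the inverses of the
   matrices 1 - (e - u2 v2) and 1 - (f - v2 u2) corrects them. *)
Lemma intertwiner_descent n m (e : 'M[B]_n) (f : 'M[B]_m)
    (u : 'M[B]_(n, m)) (v : 'M[B]_(m, n)) :
  mx_in S e -> mx_in S f -> e *m e = e -> f *m f = f ->
  mx_in A u -> mx_in A v -> u *m v = e -> v *m u = f ->
  exists u' v', [/\ mx_in S u', mx_in S v', u' *m v' = e & v' *m u' = f].
Proof.
move=> Se Sf ee ff Au Av uv vu.
have [U SU Uu] := mx_dense nuP dS Au; have [V SV Vv] := mx_dense nuP dS Av.
have cM p q r (X : nat -> 'M[B]_(p, q)) (Y : nat -> 'M[B]_(q, r)) x y :
    converges (@mxnorm _ _ nu _ _) X x -> converges (@mxnorm _ _ nu _ _) Y y ->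
    converges (@mxnorm _ _ nu _ _) (fun k => X k *m Y k) (x *m y).
  apply: (converges_bilinear (mzP _ _) (mzP _ _) (mzP _ _) (op := @mulmx B p q r)) => *.
  - exact: mulmxBl.
  - exact: mulmxBr.
  - exact: mxnormM.
have cc p q (x : 'M[B]_(p, q)) := converges_cst (mzP p q) x.
(* Compressing the approximations by [e] and [f] makes [e u2 = u2 = u2 f] hold exactly, while the
   limits still multiply to [e] and [f]. *)
pose U2 k := e *m U k *m f; pose V2 k := f *m V k *m e.
have cU : converges (@mxnorm _ _ nu _ _) U2 (e *m u *m f) by do 2 apply: (cM) => //.
have cV : converges (@mxnorm _ _ nu _ _) V2 (f *m v *m e) by do 2 apply: (cM) => //.
have uf : u *m f = e *m u by rewrite -vu -uv mulmxA.
have ve : v *m e = f *m v by rewrite -vu -uv mulmxA.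
have [|N1 hN1] := cM _ _ _ _ _ _ _ cU cV 2^-1; first by rewrite invr_gt0.
have [|N2 hN2] := cM _ _ _ _ _ _ _ cV cU 2^-1; first by rewrite invr_gt0.
set N := maxn N1 N2.
have := hN1 N (leq_maxl _ _); have := hN2 N (leq_maxr _ _).
have -> : f *m v *m e *m (e *m u *m f) = f.
  rewrite -!mulmxA uf (mulmxA e e) ee (mulmxA e e) ee (mulmxA v) ve.
  by rewrite -mulmxA vu !ff.
have -> : e *m u *m f *m (f *m v *m e) = e.
  rewrite -!mulmxA ve (mulmxA f f) ff (mulmxA f f) ff (mulmxA u) uf.
  by rewrite -mulmxA uv !ee.
set u2 := U2 N; set v2 := V2 N.
have Su2 : mx_in S u2 by do 2 apply: mx_inM => //.
have Sv2 : mx_in S v2 by do 2 apply: mx_inM => //.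
have eu2 : e *m u2 = u2 by rewrite /u2 /U2 !mulmxA ee.
have u2f : u2 *m f = u2 by rewrite /u2 /U2 -!mulmxA ff.
have fv2 : f *m v2 = v2 by rewrite /v2 /V2 !mulmxA ff.
have v2e : v2 *m e = v2 by rewrite /v2 /V2 -!mulmxA ee.
clearbody u2 v2 => n2 n1.
(* An element [z] of the corner of [g] that is close to [g] is invertible in this corner: the
   inverse of [1 - (g - z)], cut down by [g], is its inverse there. *)
have inv p (g z : 'M[B]_p) : mx_in S g -> mx_in S z -> g * z = z -> z * g = z ->
    g * g = g -> mxnorm nu (z - g) < 2^-1 ->
    exists2 w, mx_in S w & z * w = g /\ w * z = g.
  move=> Sg Sz gz zg gg ng.
  have Sx : mx_in S (g - z) by exact: mx_inB.
  have [||w [Aw cw wc _ comw]] := @neumann _ _ _ (mrP p) (@mC p) _ (msA p) (@mcA p) (g - z).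
  - exact: mx_in_sub.
  - by rewrite zn_distC ?ltW.
  have Sw : mx_in S w by apply: invS wc cw => //; apply: mx_inB => //; exact: mx_in1.
  have gw : w * g = g * w by apply: comw; rewrite mulrBl mulrBr gg gz zg.
  have zE : z = g * (1 - (g - z)) by rewrite opprB addrC mulrDr mulrBr mulr1 gg gz subrK.
  have zE' : z = (1 - (g - z)) * g by rewrite opprB addrC mulrDl mulrBl mul1r gg zg subrK.
  exists (w * g); first exact: (mx_inM sS).
  split; last by rewrite -mulrA gz {1}zE' mulrA wc mul1r.
  by rewrite {1}zE -!mulrA (mulrA _ w) cw mul1r gg.
have [||||||w Sw [uvw _]] := inv n e (u2 *m v2) => //.
- exact: mx_inM.
- by rewrite -[LHS]/(_ *m _) mulmxA eu2.
- by rewrite -[LHS]/(_ *m _) -mulmxA v2e.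
have [||||||t St [_ tvu]] := inv m f (v2 *m u2) => //.
- exact: mx_inM.
- by rewrite -[LHS]/(_ *m _) mulmxA fv2.
- by rewrite -[LHS]/(_ *m _) -mulmxA u2f.
have {}uvw : u2 *m v2 *m w = e by [].
have {}tvu : t *m (v2 *m u2) = f by [].
exists u2, (v2 *m w); split => //.
- exact: mx_inM.
- by rewrite mulmxA.
(* The correction on the right of [v2] agrees with the one on its left, since both [u2 v2 w = e] and
   [t v2 u2 = f]; hence one [v'] serves both products. *)
have -> : v2 *m w = t *m v2.
  by rewrite -[v2 in LHS]fv2 -tvu -!mulmxA (mulmxA u2) uvw v2e.
by rewrite -mulmxA.
Qed.

(** A matrix [b] over [S] close to [e] is nearly idempotent. It is corrected to an idempotent [q]
    commuting with it, which lies over [S] by [idemS]. As [q] is also close to [e], the two are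
    similar by the classical intertwiner [q e + (1 - q)(1 - e)]. *)
Lemma idempotent_approximation n (e : 'M[B]_n) : mx_in A e -> e * e = e ->
  exists q : 'M[B]_n, [/\ mx_in S q, q * q = q &
    exists2 w : 'M[B]_n, mx_in A w /\ exists2 w', mx_in A w' & w * w' = 1 /\ w' * w = 1 &
      w * e = q * w].
Proof.
move=> Ae ee; pose N := @mxnorm _ _ nu n n; have zP : zmod_norm N := mzP n n.
pose E := N e; pose O := N 1; pose M := 2 * E + 2 + O.
have [E0 O0] : 0 <= E /\ 0 <= O by split; exact: (zn_ge0 zP).
(* If [b] is within [delta] of [e], then [M] bounds the norm of [2 b - 1], [(2 E + 2) delta] that of
   [b b - b], and [K delta] that of [q - b]. The numbers [a1] and [a2] serve the hypotheses of
   [idempotent_lift], [a3] that of [idemS], and [a4] the invertibility of the intertwiner. Dividing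
   1 by a number above all of them meets every requirement. *)
have M0 : 0 <= M by rewrite /M; lra.
pose K := 4 * O * M * (2 * E + 2).
have K0 : 0 <= K by rewrite !mulr_ge0//; lra.
pose a1 := 16 * O * (2 * E + 2); pose a2 := 8 * (2 * E + 2).
pose a3 := 4 * (M + 2) * K; pose a4 := 2 * ((K + 1) * (2 * E + O)).
have [a10 a20 a30 a40] : [/\ 0 <= a1, 0 <= a2, 0 <= a3 & 0 <= a4].
  by split; rewrite /a1 /a2 /a3 /a4 ?mulr_ge0//; lra.
pose T := 1 + K + a1 + a2 + a3 + a4; pose delta := T^-1.
have T0 : 0 < T by rewrite /T; lra.
have dl0 : 0 < delta by rewrite invr_gt0.
have dT : delta * T = 1 by rewrite mulVf ?gt_eqF.
have le1 x : 0 <= x -> x <= T -> x * delta <= 1.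
  by move=> x0 xT; rewrite -dT mulrC ler_wpM2l// ltW.
have [U SU /(_ _ dl0)[k /(_ k (leqnn k)) hk]] := mx_dense nuP dS Ae.
set b := U k in hk; have hbe : N (b - e) < delta by exact: hk.
have Sb : mx_in S b by exact: SU.
have Ab := mx_in_sub Sb.
have nuM' := (mrP n).2 : forall x y, N (x * y) <= N x * N y.
set c := b * b - b.
have nb : N b <= E + 1.
  have := zn_sub_le zP b e; rewrite -/E.
  have : 1 * delta <= 1 by apply: le1 => //; rewrite /T; lra.
  lra.
have nc : N c <= (2 * E + 2) * delta.
  have -> : c = (b - e) * b + e * (b - e) - (b - e).
    by rewrite mulrBl mulrBr ee opprB !addrA subrK subrK.
  have h1 : N ((b - e) * b) <= delta * (E + 1).
    by apply: (rnM_le (mrP n)) => //; exact: ltW.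
  have h2 : N (e * (b - e)) <= E * delta.
    by apply: (rnM_le (mrP n)) => //; exact: ltW.
  have h3 := zn_D zP ((b - e) * b) (e * (b - e)).
  have h4 := zn_B zP ((b - e) * b + e * (b - e)) (b - e).
  by lra.
have c0 : 0 <= N c by exact: zn_ge0 zP _.
have nv : N (2 * b - 1) <= M.
  have := zn_D zP b b; have := zn_B zP (2 * b) 1.
  by rewrite (mulr_natl b 2) mulr2n -/O /M; lra.
have small x : 0 <= x -> x * (2 * E + 2) <= T -> x * N c <= 1.
  move=> x0 xT; apply: le_trans (ler_wpM2l x0 nc) _.
  by rewrite mulrA; apply: le1 => //; rewrite mulr_ge0//; lra.
have [|||q [Aq qq qb nq]] := @idempotent_lift _ _ _ (mrP n) (@mC n) _ (msA n) (@mcA n) b.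
- exact: Ab.
- by apply: small; [rewrite mulr_ge0|rewrite -/a1 /T -/N -/O -/a1; lra].
- by apply: small; rewrite // -/a2 /T; lra.
rewrite -/c -/N -/O in nq.
have nqK : N (q - b) <= K * delta.
  apply: le_trans nq _; apply: le_trans (_ : 4 * O * M * ((2 * E + 2) * delta) <= _).
    apply: ler_pM => //; first by rewrite !mulr_ge0//; exact: zn_ge0 zP _.
    by rewrite ler_wpM2l// mulr_ge0.
  by rewrite /K mulrA.
have Kd1 : K * delta <= 1 by apply: le1 => //; rewrite /T; lra.
have nqs : N (2 * q - 1) <= M + 2.
  have -> : 2 * q - 1 = (2 * b - 1) + ((q - b) + (q - b)).
    rewrite (mulr_natl q 2) (mulr_natl b 2) !mulr2n !addrA.
    by rewrite [RHS](ACl (4*6*3*1*5*2*7)) /= !addrK.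
  have := zn_D zP (2 * b - 1) ((q - b) + (q - b)).
  have := zn_D zP (q - b) (q - b); lra.
have Sq : mx_in S q.
  apply: (idemS Sb) => //; rewrite -/N (zn_distC zP b).
  apply: le_trans (_ : 4 * (M + 2) * (K * delta) <= 1).
    apply: ler_pM => //; first by rewrite mulr_ge0//; exact: zn_ge0 zP _.
      exact: zn_ge0 zP _.
    by rewrite ler_wpM2l.
  by rewrite mulrA; apply: le1 => //; rewrite -/a3 /T; lra.
exists q; split=> //.
(* This [x] is chosen so that [1 - x] is the intertwiner [q e + (1 - q)(1 - e)]; the factor [q - e]
   makes it small. *)
pose x := (q - e) * (1 - e - e).
have Ax : mx_in A x.
  by apply: (mx_inM sA); repeat apply: (mx_inB sA) => //; exact: mx_in1.
have nx : N x <= 2^-1.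
  have h1 : N (q - e) <= (K + 1) * delta.
    by have := zn_distD zP b q e; rewrite mulrDl mul1r; lra.
  have h2 : N (1 - e - e) <= 2 * E + O.
    by have := zn_B zP (1 - e) e; have := zn_B zP 1 e; rewrite -/E -/O; lra.
  have h3 := rnM_le (mrP n) h1 h2.
  have : a4 * delta <= 1 by apply: le1 => //; rewrite /T; lra.
  by rewrite /a4; move: h3; rewrite -/N; lra.
have [||w' [Aw' cw wc _ _]] := @neumann _ _ _ (mrP n) (@mC n) _ (msA n) (@mcA n) x => //.
have wE : 1 - x = q * e + (1 - q) * (1 - e).
  rewrite /x !mulrBl !mulrBr !mulr1 !mul1r ee !opprB !addrA.
  by rewrite [LHS](ACl (5*1*3*6*7*(2*4))) /= subrr addr0.
exists (1 - x); last first.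
  have e0 : (1 - e) * e = 0 by rewrite mulrBl mul1r ee subrr.
  have q0 : q * (1 - q) = 0 by rewrite mulrBr mulr1 qq subrr.
  rewrite wE [LHS]mulrDl [RHS]mulrDr -(mulrA q) ee -(mulrA (1 - q)) e0 mulr0.
  by rewrite !mulrA qq q0 mul0r.
split; first by apply: (mx_inB sA) => //; exact: mx_in1.
by exists w'.
Qed.

Lemma mx_val (T : set B) (sT : set_subring T) m n (M : 'M[subring_of sT]_(m, n)) :
  mx_in T (map_mx val M).
Proof. by move=> i j; rewrite mxE; apply/set_mem/subring_valP. Qed.

Lemma mx_lift (T : set B) (sT : set_subring T) m n (M : 'M[B]_(m, n)) :
  mx_in T M -> exists M' : 'M[subring_of sT]_(m, n), map_mx val M' = M.
Proof.
move=> TM; exists (\matrix_(i, j) SubringOf sT (mem_set (TM i j))).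
by apply/matrixP => i j; rewrite !mxE.
Qed.

Lemma mx_val_inj (T : set B) (sT : set_subring T) m n :
  injective (map_mx val : 'M[subring_of sT]_(m, n) -> 'M[B]_(m, n)).
Proof.
by move=> M N /matrixP MN; apply/matrixP => i j; have := MN i j; rewrite !mxE => /val_inj.
Qed.

Local Notation incl := (subring_incl sS sA SA).

Lemma val_incl m n (M : 'M[subring_of sS]_(m, n)) :
  map_mx val (map_mx incl M) = map_mx val M.
Proof. by apply/matrixP => i j; rewrite !mxE. Qed.

Lemma class_map_incl_inj : injective (class_map incl).
Proof.
elim/quotW=> -[n [e he]]; elim/quotW=> -[m [f hf]].
rewrite !pi_class_map => /eqmodP/asboolP[u [v [/= uv vu]]].
have /eqP ee := he; have /eqP ff := hf.
have [||||||||u' [v' [Su' Sv' uv' vu']]] := @intertwiner_descent n m (map_mx val e)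
  (map_mx val f) (map_mx val u) (map_mx val v).
- exact: mx_val.
- exact: mx_val.
- by rewrite -map_mxM ee.
- by rewrite -map_mxM ff.
- exact: mx_val.
- exact: mx_val.
- by rewrite -map_mxM uv val_incl.
- by rewrite -map_mxM vu val_incl.
have [u2 u2E] := mx_lift sS Su'; have [v2 v2E] := mx_lift sS Sv'.
apply/eqmodP/asboolP; exists u2, v2; split; apply: mx_val_inj.
  by rewrite map_mxM u2E v2E.
by rewrite map_mxM u2E v2E.
Qed.

Lemma class_map_incl_surj y : exists x, class_map incl x = y.
Proof.
elim/quotW: y => -[n [e he]]; have /eqP ee := he.
have [||q [Sq qq [w [Aw [w' Aw' [ww' w'w]]] wq]]] := @idempotent_approximation n (map_mx val e).
- exact: mx_val.
- by rewrite -[LHS]map_mxM ee.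
have [q' q'E] := mx_lift sS Sq.
have hq' : q' *m q' == q'.
  by apply/eqP/mx_val_inj; rewrite map_mxM q'E.
exists (\pi_(idem_class _) (mkidem hq')); rewrite pi_class_map.
have [a aE] := mx_lift sA Aw; have [a' a'E] := mx_lift sA Aw'.
(* The similarity [w e = q w] yields the Murray-von Neumann pair [w e] and [w' q], with [w'] the
   inverse of [w]. *)
apply/eqmodP/asboolP; exists (a *m e), (a' *m map_mx incl q'); split; apply: mx_val_inj.
- rewrite !map_mxM val_incl q'E aE a'E.
  rewrite [_ *m map_mx val e](wq : w *m map_mx val e = q *m w).
  rewrite -mulmxA (mulmxA w) [w *m w'](ww' : _ = 1%:M) mul1mx; exact: qq.
- rewrite !map_mxM val_incl q'E aE a'E.
  rewrite [w *m _](wq : w *m map_mx val e = q *m w).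
  rewrite -mulmxA (mulmxA q) [q *m q](qq : _ = q) -(wq : w *m map_mx val e = q *m w).
  by rewrite mulmxA [w' *m w](w'w : _ = 1%:M) mul1mx.
Qed.

Theorem dense_subring_K0 : bijective (K0_map incl).
Proof.
apply: groth_map_bijective; rewrite -setTT_bijective; split=> //.
- by move=> x y _ _; exact: class_map_incl_inj.
- by move=> y _; have [x <-] := class_map_incl_surj y; exists x.
Qed.

End DenseSubring.

(** * The Hilbert space of square-summable families *)

Section Ell2Norm.
Variables (R : realType) (X : choiceType).
Local Notation C := R[i].
Local Notation ell2 := (ell2 R X).
Implicit Types (xi eta : ell2) (F : {fset X}).

Lemma normc_zmod : zmod_norm (@normc R).
Proof.
split=> [z||z|z w|z].
- exact: normc_ge0.
- exact: Normc.normc0.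
- exact: Normc.eq0_normc.
- exact: le_normcD.
- exact: normcN.
Qed.

Lemma esum_fset_le (a : X -> R) (M : R) : (forall x, 0 <= a x) ->
  (\esum_(x in [set: X]) (a x)%:E <= M%:E)%E <->
  forall F : {fset X}, \sum_(x <- F) a x <= M.
Proof.
move=> a0; split=> [h F|h].
  rewrite -lee_fin; apply: le_trans h; apply: esum_ge; exists [set` F] => //.
  by rewrite -fsbig_seq// sumEFin.
apply: ge_ereal_sup => _ [A [finA _] <-].
by rewrite fsbig_finite// sumEFin lee_fin.
Qed.

Lemma ell2_norm_le xi (M : R) : 0 <= M ->
  ell2_norm xi <= M <-> forall F, \sum_(x <- F) normc (xi x) ^+ 2 <= M ^+ 2.
Proof.
move=> M0; rewrite -(@ler_pXn2r _ 2) ?nnegrE ?ell2_norm_ge0// -lee_fin -sqsumE.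
by apply: esum_fset_le => x; rewrite sqr_ge0.
Qed.

Lemma ell2_sum_le xi F : \sum_(x <- F) normc (xi x) ^+ 2 <= ell2_norm xi ^+ 2.
Proof. by have [h _] := ell2_norm_le xi (ell2_norm_ge0 xi); apply: h. Qed.

Lemma normc_le_ell2 xi x : normc (xi x) <= ell2_norm xi.
Proof.
rewrite -(@ler_pXn2r _ 2) ?nnegrE ?ell2_norm_ge0 ?normc_ge0//.
by have := ell2_sum_le xi [fset x]%fset; rewrite big_seq_fset1.
Qed.

Lemma ell2_ex (f : X -> C) (M : R) :
  (forall F, \sum_(x <- F) normc (f x) ^+ 2 <= M) ->
  exists xi : ell2, xi = f :> (X -> C).
Proof.
move=> h; have f2 : f \in @square_summable R X.
  rewrite inE; apply: (@le_lt_trans _ _ M%:E); last exact: ltry.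
  by apply/esum_fset_le => // x; rewrite sqr_ge0.
by exists (Ell2 f2).
Qed.

Lemma ell2_normN xi : ell2_norm (- xi) = ell2_norm xi.
Proof. by rewrite -scaleN1r ell2_normZ normcN Normc.normc1 mul1r. Qed.

Lemma ell2_norm0 : ell2_norm (0 : ell2) = 0.
Proof. by rewrite -(scale0r (0 : ell2)) ell2_normZ Normc.normc0 mul0r. Qed.

Lemma ell2_zmod : zmod_norm (@ell2_norm R X).
Proof.
split=> [xi||xi|xi eta|xi].
- exact: ell2_norm_ge0.
- exact: ell2_norm0.
- exact: ell2_norm0_eq0.
- exact: ell2_normD.
- exact: ell2_normN.
Qed.

Lemma normc_complete : complete_norm (@normc R).
Proof.
move=> u cu.
have ReIm (z : C) : `|complex.Re z| <= normc z /\ `|complex.Im z| <= normc z.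
  case: z => a b /=; split; rewrite -sqrtr_sqr ler_sqrt ?addr_ge0 ?sqr_ge0//.
    by rewrite lerDl sqr_ge0.
  by rewrite lerDr sqr_ge0.
have normc_le (z : C) : normc z <= `|complex.Re z| + `|complex.Im z|.
  case: z => a b /=; rewrite -[leRHS]ger0_norm ?addr_ge0// -sqrtr_sqr ler_wsqrtr//.
  rewrite sqrrD !real_normK ?num_real// lerD2r lerDl mulrn_wge0// mulr_ge0//.
have real_cauchy (v : nat -> R) : (forall e, 0 < e -> exists N, forall m n,
    (N <= m)%N -> (N <= n)%N -> `|v m - v n| < e) ->
    exists l, forall e, 0 < e -> exists N, forall n, (N <= n)%N -> `|v n - l| < e.
  move=> cv; have /cauchy_cvgP cvv : cauchy (v @ \oo).
    apply/cauchy_ballP => e e0; have [N hN] := cv e e0.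
    exists (v @` [set n | (N <= n)%N], v @` [set n | (N <= n)%N]).
      by split; exists N => // n Nn; exists n.
    by move=> [_ _] /= [[m Nm <-] [n Nn <-]]; apply: hN.
  exists (lim (v @ \oo)) => e e0; have /cvgrPdist_lt/(_ e e0)[N _ hN] := cvv.
  by exists N => n Nn; rewrite distrC; exact: hN.
have [|r hr] := @real_cauchy (fun n => complex.Re (u n)).
  move=> e /cu[N hN]; exists N => m n Nm Nn; apply: le_lt_trans (hN _ _ Nm Nn).
  by have [+ _] := ReIm (u m - u n); rewrite raddfB.
have [|s hs] := @real_cauchy (fun n => complex.Im (u n)).
  move=> e /cu[N hN]; exists N => m n Nm Nn; apply: le_lt_trans (hN _ _ Nm Nn).
  by have [_ +] := ReIm (u m - u n); rewrite raddfB.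
exists (Complex r s) => e e0; have e2 : 0 < e / 2 by rewrite divr_gt0.
have [N hN] := hr _ e2; have [M hM] := hs _ e2.
exists (maxn N M) => n; rewrite geq_max => /andP[/hN h1 /hM h2].
by apply: le_lt_trans (normc_le _) _; rewrite !raddfB/=; lra.
Qed.

(** This is Fatou's inequality over a finite set, where continuity of a finite sum is enough. *)
Lemma sum_normc_fatou (u : nat -> X -> C) (f : X -> C) (M : R) F :
  (forall x, converges (@normc R) (fun n => u n x) (f x)) ->
  (exists N, forall n, (N <= n)%N -> \sum_(x <- F) normc (u n x) ^+ 2 <= M) ->
  \sum_(x <- F) normc (f x) ^+ 2 <= M.
Proof.
move=> uf [N hN].
apply: (@cvgr_to_le _ \oo _ R (fun n => \sum_(x <- F) normc (u n x) ^+ 2)); last first.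
  by exists N.
apply: cvg_big => [|x _]; first exact: add_continuous.
have cn : normc (u n x) @[n --> \oo] --> normc (f x).
  apply/cvgrPdist_lt => e e0; have [K hK] := uf x _ e0; exists K => // n Kn.
  apply: le_lt_trans (hK n Kn); rewrite ler_norml lerBrDr lerBlDr.
  have := zn_sub_le normc_zmod (f x) (u n x); have := zn_sub_le normc_zmod (u n x) (f x).
  by rewrite (zn_distC normc_zmod (f x)); lra.
exact: cvgM.
Qed.

Lemma ell2_complete : complete_norm (@ell2_norm R X).
Proof.
move=> u cu.
have /choice[f hf] x : exists l, converges (@normc R) (fun n => u n x) l.
  apply: normc_complete => e /cu[N hN]; exists N => m n Nm Nn.
  by apply: le_lt_trans (hN _ _ Nm Nn); exact: (normc_le_ell2 (u m - u n) x).
have tail n e F : 0 <= e -> (forall m, (n <= m)%N -> ell2_norm (u m - u n) <= e) ->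
    \sum_(x <- F) normc (f x - u n x) ^+ 2 <= e ^+ 2.
  move=> e0 h; apply: (sum_normc_fatou (u := fun m x => u m x - u n x)).
    by move=> x; apply: (convergesB normc_zmod (hf x)); exact: converges_cst normc_zmod _.
  by exists n => m /h /ell2_norm_le; apply.
have [N hN] := cu 1 ltr01.
have [|w wE] := @ell2_ex (fun x => f x - u N x) (1 ^+ 2).
  by move=> F; apply: tail => // m Nm; apply/ltW/hN.
(* The pointwise limit [f] is at first only a function. The tail bound makes [f - u N]
   square-summable, and adding [u N] back gives the limit in [ell2]. *)
exists (w + u N) => e e0; have e2 : 0 < e / 2 by rewrite divr_gt0.
have [K hK] := cu _ e2; exists K => n Kn.
rewrite (zn_distC ell2_zmod); apply: (@le_lt_trans _ _ (e / 2)); last lra.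
apply/ell2_norm_le => [|F]; first exact: ltW.
have -> : (w + u N - u n : ell2) = (fun x => f x - u n x) :> (X -> C).
  by apply/funext => x; rewrite -[LHS]/(w x + u N x - u n x) wE subrK.
apply: tail => [|m Km]; first exact: ltW.
by apply/ltW/hK => //; exact: leq_trans Km.
Qed.

Lemma ell2_converges_at u xi x :
  converges (@ell2_norm R X) u xi -> converges (@normc R) (fun n => u n x) (xi x).
Proof.
move=> uxi e /uxi[N hN]; exists N => n /hN; apply: le_lt_trans.
exact: (normc_le_ell2 (u n - xi)).
Qed.

(** Written as a combination of deltas, not as a cut-off of values, so that a linear operator can be
    applied term by term. *)
Definition truncation xi F : ell2 := \sum_(x <- F) xi x *: delta R x.

Lemma sum_ell2E (I : Type) (r : seq I) (f : I -> ell2) x :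
  (\sum_(i <- r) f i : ell2) x = \sum_(i <- r) f i x.
Proof. by elim: r => [|i r IH]; rewrite ?big_nil ?big_cons// -IH. Qed.

Lemma truncationE xi F x : truncation xi F x = if x \in F then xi x else 0.
Proof.
have E y : (xi y *: delta R y : ell2) x = xi y * (x == y)%:R by [].
rewrite sum_ell2E (eq_bigr _ (fun y _ => E y)); case: ifPn => xF.
  rewrite (big_fsetD1 x)//= eqxx mulr1 big1_fset ?addr0// => y.
  by rewrite !inE => /andP[yx _] _; rewrite eq_sym (negbTE yx) mulr0.
rewrite big1_fset// => y yF _; case: eqP => [xy|_]; last by rewrite mulr0.
by rewrite xy yF in xF.
Qed.

Lemma ler_sum_fsubset (U V : {fset X}) (f : X -> R) : (U `<=` V)%fset ->
  (forall x, 0 <= f x) -> \sum_(x <- U) f x <= \sum_(x <- V) f x.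
Proof.
move=> UV f0; rewrite [leRHS](big_fsetID _ (mem U))/=.
have -> : [fset x in V | x \in U]%fset = U.
  apply/fsetP => x; rewrite !inE/=; apply/andP/idP => [[]//|xU]; split=> //.
  exact: (fsubsetP UV).
by rewrite lerDl sumr_ge0.
Qed.

Lemma ell2_sum_approx xi e : 0 < e ->
  exists F, ell2_norm xi ^+ 2 - e < \sum_(x <- F) normc (xi x) ^+ 2.
Proof.
move=> e0; apply: contrapT => /forallNP h.
have /esum_fset_le : forall F : {fset X},
    \sum_(x <- F) normc (xi x) ^+ 2 <= ell2_norm xi ^+ 2 - e.
  by move=> F; have /negP := h F; rewrite -leNgt.
move=> /(_ (fun x => sqr_ge0 _)).
by rewrite -[X in (X <= _)%E]/(sqsum xi) sqsumE lee_fin; lra.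
Qed.

Lemma truncation_approx xi e : 0 < e -> exists F, forall A, (F `<=` A)%fset ->
  ell2_norm (xi - truncation xi A) < e.
Proof.
move=> e0; pose n2 := ell2_norm xi ^+ 2.
have [|F hF] := @ell2_sum_approx xi ((e / 2) ^+ 2).
  by rewrite exprn_gt0// divr_gt0.
exists F => A FA; apply: (@le_lt_trans _ _ (e / 2)); last lra.
apply/ell2_norm_le => [|K]; first by rewrite divr_ge0// ltW.
(* On any finite [K] the error is carried by the points of [K] outside [A]. Together with [A] they
   form a finite set, so what [A] already captures of the squared norm leaves them less than
   [(e / 2) ^ 2]. *)
have := ell2_sum_le xi (A `|` K)%fset; rewrite -/n2.
rewrite -/n2 in hF.
have h1 := ler_sum_fsubset (f := fun x => normc (xi x) ^+ 2) FA (fun x => sqr_ge0 _).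
rewrite (big_fsetID _ (mem A))/=.
have -> : [fset x in (A `|` K) | x \in A]%fset = A.
  by apply/fsetP => x; rewrite !inE/=; case: (x \in A); rewrite ?andbT ?andbF.
move=> h2.
have h3 : \sum_(x <- K) normc ((xi - truncation xi A) x) ^+ 2 <=
    \sum_(x <- [fset x in (A `|` K) | x \notin A]%fset) normc (xi x) ^+ 2.
  rewrite (big_fsetID _ (mem A))/= big1_fset ?add0r.
  - apply: le_trans (_ : \sum_(x <- [fset x in K | x \notin A]%fset) normc (xi x) ^+ 2 <= _).
      rewrite big_seq_cond [leRHS]big_seq_cond; apply: ler_sum => x.
      rewrite !inE/= andbT => /andP[_ xA].
      by rewrite -[(_ - _) x]/(xi x - truncation xi A x) truncationE (negbTE xA) subr0.
    apply: (@ler_sum_fsubset _ _ (fun x => normc (xi x) ^+ 2)) => [|x]; last exact: sqr_ge0.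
    by apply/fsubsetP => x; rewrite !inE/= => /andP[-> ->]; rewrite orbT.
  - move=> x; rewrite !inE/= => /andP[_ xA] _.
    by rewrite -[(_ - _) x]/(xi x - truncation xi A x) truncationE xA subrr Normc.normc0 expr0n.
by apply: le_trans h3 _; lra.
Qed.

Lemma truncation_converges xi : exists F : nat -> {fset X},
  converges (@ell2_norm R X) (fun n => truncation xi (F n)) xi.
Proof.
have /choice[F hF] n : exists F, ell2_norm (xi - truncation xi F) < n.+1%:R^-1.
  have [|F hF] := @truncation_approx xi (n.+1%:R^-1); first by rewrite invr_gt0 ltr0n.
  by exists F; apply: hF; exact: fsubset_refl.
exists F => e e0; exists (Num.truncn e^-1) => n ne.
rewrite (zn_distC ell2_zmod); apply: lt_le_trans (hF n) _.
rewrite invf_ple ?posrE ?ltr0n//.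
apply: ltW; apply: lt_le_trans (truncnS_gt _) _.
by rewrite ler_nat ltnS.
Qed.

End Ell2Norm.

(** * The inner product *)

#[local] Instance totally_proper (I : choiceType) : ProperFilter (@summability.totally I) :=
  summability.totally_filter.

Section Inner.
Variables (R : realType) (X : choiceType).
Local Notation C := R[i].
Local Notation ell2 := (ell2 R X).
Implicit Types (xi eta : ell2) (F : {fset X}).

Let FF : Filter (@summability.totally X) := filter_filter.

Lemma norm_sq_cvg xi :
  (fun A : {fset X} => (\sum_(x <- A) normc (xi x) ^+ 2)%:C%C : C^o)
    @ @summability.totally X -->
  ((ell2_norm xi ^+ 2)%:C%C : C^o).
Proof.
apply/cvgrPdist_lt => e e0.
have eR : e = (complex.Re e)%:C%C by rewrite RRe_real// gtr0_real.
have e0' : 0 < complex.Re e by rewrite -ltcR -eR.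
have [F hF] := ell2_sum_approx xi e0'.
exists F => // A /= FA; rewrite eR -rmorphB/= complex_normE ltcR.
have h1 := ler_sum_fsubset (f := fun x => normc (xi x) ^+ 2) FA (fun x => sqr_ge0 _).
have h2 := ell2_sum_le xi A.
rewrite /= expr0n/= addr0 sqrtr_sqr ger0_norm; lra.
Qed.

Lemma partial_sumE (f : X -> C^o) F :
  summability.partial_sum f F = \sum_(x <- F) f x.
Proof. by rewrite /summability.partial_sum big_seq_fsetE. Qed.

Lemma normc_sq (z : C) : (normc z ^+ 2)%:C%C = z * conjc z.
Proof.
case: z => a b; apply/eqP; rewrite eq_complex/= sqr_sqrtr ?addr_ge0 ?sqr_ge0//.
by apply/andP; split; apply/eqP; ring.
Qed.

Lemma conjcD (z w : C) : conjc (z + w) = conjc z + conjc w.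
Proof. exact: rmorphD. Qed.

Lemma conjcM (z w : C) : conjc (z * w) = conjc z * conjc w.
Proof. exact: rmorphM. Qed.

Lemma conjcN (z : C) : conjc (- z) = - conjc z.
Proof. exact: rmorphN. Qed.

Definition imaginary_unit : C := Complex 0 1.
Local Notation ii := imaginary_unit.

Lemma conjc_i : conjc ii = - ii.
Proof. by apply/eqP; rewrite eq_complex/= !oppr0 !eqxx. Qed.

Lemma sqr_ii : ii * ii = -1.
Proof. by apply/eqP; rewrite eq_complex/= !mul0r !mulr0 !mulr1 !addr0 sub0r oppr0 !eqxx. Qed.

Lemma normc_ii : normc ii = 1.
Proof. by rewrite /= expr0n expr1n add0r sqrtr1. Qed.

(** The series of products is not monotone, whereas the partial sums of a squared norm are.
    Polarization writes the former with four of the latter, which gives both convergence and a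
    closed formula for [inner]. *)
Definition inner_polar xi eta : C :=
  4^-1 * ((ell2_norm (xi + eta) ^+ 2)%:C - (ell2_norm (xi - eta) ^+ 2)%:C
   + ii * ((ell2_norm (xi + ii *: eta) ^+ 2)%:C - (ell2_norm (xi - ii *: eta) ^+ 2)%:C))%C.

Lemma polarization (z w : C) : z * conjc w = 4^-1 *
  ((normc (z + w) ^+ 2)%:C - (normc (z - w) ^+ 2)%:C
   + ii * ((normc (z + ii * w) ^+ 2)%:C - (normc (z - ii * w) ^+ 2)%:C))%C.
Proof.
rewrite !normc_sq !(conjcD, conjcN, conjcM) conjc_i.
have i2 := sqr_ii.
have n4 : (4 : C) != 0 by rewrite pnatr_eq0.
apply: (mulfI n4); rewrite [RHS]mulrA divff// mul1r.
move: (conjc z) (conjc w) ii i2 => z' w' i i2.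
ring: i2.
Qed.

Lemma inner_cvg_polar xi eta :
  summability.partial_sum (fun x => xi x * conjc (eta x) : C^o)
    @ @summability.totally X --> (inner_polar xi eta : C^o).
Proof.
have -> : summability.partial_sum (fun x => xi x * conjc (eta x) : C^o) =
  (fun A : {fset X} => 4^-1 *: (((\sum_(x <- A) normc ((xi + eta) x) ^+ 2)%:C%C : C^o)
     - ((\sum_(x <- A) normc ((xi - eta) x) ^+ 2)%:C%C : C^o)
   + ii *: (((\sum_(x <- A) normc ((xi + ii *: eta) x) ^+ 2)%:C%C : C^o)
     - ((\sum_(x <- A) normc ((xi - ii *: eta) x) ^+ 2)%:C%C : C^o))) : C^o).
  apply/funext => A; rewrite partial_sumE/=.
  rewrite (eq_bigr _ (fun x _ => polarization _ _)) -mulr_sumr big_split/=.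
  by rewrite -mulr_sumr !sumrB -!rmorph_sum.
have c1 := cvgB (FF := FF) (@norm_sq_cvg (xi + eta)) (@norm_sq_cvg (xi - eta)).
have c2 := cvgB (FF := FF) (@norm_sq_cvg (xi + ii *: eta)) (@norm_sq_cvg (xi - ii *: eta)).
exact: (cvgZr (FF := FF) (cvgD (FF := FF) c1 (cvgZr (FF := FF) c2))).
Qed.

Lemma innerE xi eta : inner xi eta = inner_polar xi eta.
Proof. by apply: (cvg_lim (@norm_hausdorff _ C^o)); exact: inner_cvg_polar. Qed.

Lemma inner_cvg xi eta :
  summability.partial_sum (fun x => xi x * conjc (eta x) : C^o)
    @ @summability.totally X --> (inner xi eta : C^o).
Proof. by rewrite innerE; exact: inner_cvg_polar. Qed.

Lemma inner_unique xi eta (l : C) :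
  summability.partial_sum (fun x => xi x * conjc (eta x) : C^o)
    @ @summability.totally X --> (l : C^o) -> inner xi eta = l.
Proof. by move=> h; apply: (cvg_lim (@norm_hausdorff _ C^o)). Qed.

Lemma inner_linear c xi xi' eta :
  inner (c *: xi + xi') eta = c * inner xi eta + inner xi' eta.
Proof.
apply: inner_unique.
have -> : summability.partial_sum (fun x => (c *: xi + xi') x * conjc (eta x) : C^o) =
    (fun A => c *: summability.partial_sum (fun x => xi x * conjc (eta x) : C^o) A +
      summability.partial_sum (fun x => xi' x * conjc (eta x) : C^o) A : C^o).
  apply/funext => A; rewrite !partial_sumE scaler_sumr -big_split/=.
  apply: eq_bigr => x _.
  by rewrite -[RHS]/(c * (xi x * conjc (eta x)) + xi' x * conjc (eta x)) mulrA -mulrDl.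
exact: (cvgD (FF := FF) (cvgZr (FF := FF) (@inner_cvg xi eta)) (@inner_cvg xi' eta)).
Qed.

Lemma innerC xi eta : inner eta xi = conjc (inner xi eta).
Proof.
rewrite !innerE /inner_polar.
have iN (z : ell2) : ell2_norm (ii *: z) = ell2_norm z.
  by rewrite ell2_normZ normc_ii mul1r.
rewrite [eta + xi]addrC -[eta - xi]opprB ell2_normN.
have -> : eta + ii *: xi = ii *: (xi - ii *: eta).
  by rewrite scalerBr scalerA sqr_ii scaleN1r opprK addrC.
have -> : eta - ii *: xi = - (ii *: (xi + ii *: eta)).
  by rewrite scalerDr scalerA sqr_ii scaleN1r opprB.
rewrite ell2_normN !iN !(conjcD, conjcN, conjcM) !conjc_real conjc_inv conjc_nat conjc_i.
congr (_ * (_ + _)).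
by rewrite mulNr -mulrN opprB.
Qed.

Lemma inner0l eta : inner 0 eta = 0.
Proof. by have := inner_linear (-1) 0 0 eta; rewrite scaler0 addr0 mulN1r addNr. Qed.

Lemma innerDl xi xi' eta : inner (xi + xi') eta = inner xi eta + inner xi' eta.
Proof. by have := inner_linear 1 xi xi' eta; rewrite scale1r mul1r. Qed.

Lemma innerZl c xi eta : inner (c *: xi) eta = c * inner xi eta.
Proof. by have := inner_linear c xi 0 eta; rewrite inner0l !addr0. Qed.

Lemma innerBl xi xi' eta : inner (xi - xi') eta = inner xi eta - inner xi' eta.
Proof. by rewrite innerDl -scaleN1r innerZl mulN1r. Qed.

Lemma innerBr xi eta eta' : inner xi (eta - eta') = inner xi eta - inner xi eta'.
Proof. by rewrite innerC innerBl conjcD conjcN -!innerC. Qed.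

Lemma innerZr c xi eta : inner xi (c *: eta) = conjc c * inner xi eta.
Proof. by rewrite innerC innerZl conjcM -!innerC. Qed.

Lemma inner_norm xi : inner xi xi = (ell2_norm xi ^+ 2)%:C%C.
Proof.
apply: inner_unique.
have -> : summability.partial_sum (fun x => xi x * conjc (xi x) : C^o) =
    (fun A : {fset X} => (\sum_(x <- A) normc (xi x) ^+ 2)%:C%C : C^o).
  apply/funext => A; rewrite partial_sumE rmorph_sum/=.
  by apply: eq_bigr => x _; rewrite normc_sq.
exact: norm_sq_cvg.
Qed.

Lemma inner_delta xi x : inner xi (delta R x) = xi x.
Proof.
apply: inner_unique; apply/cvgrPdist_lt => e e0.
exists [fset x]%fset => // A /=; rewrite fsub1set => xA.
rewrite partial_sumE/= (big_fsetD1 x)//= big1_fset => [|y].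
  by rewrite /= eqxx conjc_nat mulr1 addr0 subrr normr0.
by rewrite !inE => /andP[yx _] _; rewrite (negbTE yx) conjc0 mulr0.
Qed.

Lemma cauchy_schwarz xi eta : normc (inner xi eta) <= ell2_norm xi * ell2_norm eta.
Proof.
have [->|eta0] := eqVneq eta 0.
  by rewrite innerC inner0l conjc0 Normc.normc0 mulr_ge0// ell2_norm_ge0.
set a := ell2_norm xi; set b := ell2_norm eta; set z := inner xi eta.
have a0 : 0 <= a by exact: ell2_norm_ge0.
have b0 : 0 < b.
  rewrite lt_neqAle ell2_norm_ge0 andbT eq_sym; apply: contra eta0 => /eqP h.
  by apply/eqP/ell2_norm0_eq0.
have b2 : 0 < b ^+ 2 by rewrite exprn_gt0.
(* The coefficient of the orthogonal projection of [xi] on [eta]. *)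
pose c := ((b ^+ 2)^-1)%:C%C * z.
have E (p k m : R) : (p - k * m)%:C%C = p%:C%C - k%:C%C * m%:C%C :> C.
  by rewrite rmorphB rmorphM.
have : (ell2_norm (xi - c *: eta) ^+ 2)%:C%C = (a ^+ 2 - (b ^+ 2)^-1 * normc z ^+ 2)%:C%C.
  rewrite -inner_norm innerBl !innerBr !innerZl !innerZr !inner_norm -/a -/b.
  rewrite (innerC xi eta) -/z /c conjcM conjc_real E normc_sq.
  have bb : ((b ^+ 2)^-1)%:C%C * (b ^+ 2)%:C%C = 1 :> C.
    by rewrite -rmorphM/= mulVf ?gt_eqF.
  move: (conjc z) ((b ^+ 2)^-1)%:C%C (b ^+ 2)%:C%C bb => z' u v uv.
  ring: uv.
move=> [h]; have := sqr_ge0 (ell2_norm (xi - c *: eta)); rewrite h subr_ge0.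
rewrite ler_pdivrMl// mulrC -exprMn => h2.
by rewrite -(@ler_pXn2r _ 2) ?nnegrE ?normc_ge0 ?mulr_ge0// ltW.
Qed.

(** The functional is a bare function with explicit linearity, so that differences of matrix
    coefficients and conjugated inner products can be plugged in directly. *)
Lemma ell2_functional_eq0 (phi : ell2 -> C) (K : R) :
  (forall c xi eta, phi (c *: xi + eta) = c * phi xi + phi eta) ->
  (forall xi, normc (phi xi) <= K * ell2_norm xi) ->
  (forall x, phi (delta R x) = 0) -> forall xi, phi xi = 0.
Proof.
move=> lin bnd d0 xi.
have phi0 : phi 0 = 0.
  by have := lin (-1) 0 0; rewrite scaler0 addr0 mulN1r addNr.
have trunc F : phi (truncation xi F) = 0.
  rewrite /truncation; elim/big_rec: _ => // x eta _ IH.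
  by rewrite lin d0 IH mulr0 addr0.
have [F hF] := truncation_converges xi.
have K0 : 0 <= `|K| by [].
apply: (zn_small_eq0 (normc_zmod R)) => e e0.
have [|N /(_ N (leqnn N)) hN] := hF (e / (`|K| + 1)).
  by rewrite divr_gt0// ltr_wpDl.
have -> : phi xi = phi (xi - truncation xi (F N)).
  by rewrite addrC -scaleN1r lin trunc mulr0 add0r.
apply: le_lt_trans (bnd _) _; move: hN; rewrite (zn_distC (ell2_zmod R X)).
rewrite ltr_pdivlMr ?ltr_wpDl// => hN; apply: le_lt_trans hN.
set n := ell2_norm _; have n0 : 0 <= n by exact: ell2_norm_ge0.
have := ler_norm K; nra.
Qed.

End Inner.

(** * Bounded operators *)

Section Bops.
Variables (R : realType) (X : choiceType).
Local Notation C := R[i].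
Local Notation ell2 := (ell2 R X).
Local Notation B := (bop ell2).
Implicit Types (xi eta : ell2) (F : {fset X}) (a b c S T : B).

Definition bnorm : B -> R := fun T => opnorm T.

Lemma bnormP T xi : ell2_norm (T xi) <= bnorm T * ell2_norm xi.
Proof. by have := opnormP T xi. Qed.

Lemma bnorm_le T (M : R) : 0 <= M ->
  (forall xi, ell2_norm (T xi) <= M * ell2_norm xi) -> bnorm T <= M.
Proof.
move=> M0 h; apply: opnorm_le => xi x1; apply: le_trans (h xi) _.
rewrite -[leRHS]mulr1 ler_wpM2l// -lecR.
exact: x1.
Qed.

Lemma bnorm_ge0 T : 0 <= bnorm T. Proof. exact: opnorm_ge0. Qed.

Lemma bnormZ (z : C) T : bnorm (z *: T) = normc z * bnorm T.
Proof. exact: opnormZ. Qed.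

Lemma bnormM S T : bnorm (S * T) <= bnorm S * bnorm T.
Proof.
apply: bnorm_le => [|xi]; first by rewrite mulr_ge0 ?bnorm_ge0.
apply: le_trans (bnormP S (T xi)) _; rewrite -mulrA ler_wpM2l ?bnorm_ge0//.
exact: bnormP.
Qed.

Lemma bnorm_ring : ring_norm bnorm.
Proof.
split; last exact: bnormM.
split=> [T||T|S T|T].
- exact: bnorm_ge0.
- by rewrite -(scale0r (0 : B)) bnormZ Normc.normc0 mul0r.
- exact: opnorm0_eq0.
- exact: opnormD.
- by rewrite -scaleN1r bnormZ normcN Normc.normc1 mul1r.
Qed.

Lemma bop_ex (T : ell2 -> ell2) (M : R) : 0 <= M ->
  (forall (z : C) xi eta, T (z *: xi + eta) = z *: T xi + T eta) ->
  (forall xi, ell2_norm (T xi) <= M * ell2_norm xi) ->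
  exists2 S : B, (forall xi, S xi = T xi) & bnorm S <= M.
Proof.
move=> M0 lin bnd.
pose Tl := GRing.isLinear.Build C ell2 ell2 *:%R T lin.
pose T' : {linear ell2 -> ell2} := HB.pack T Tl.
have cT : continuous T'.
  apply: bounded_linear_continuous; apply/linear_boundedP.
  near=> r => xi; apply: (@le_trans _ _ (M%:C%C * `|xi|)).
    by rewrite -[leRHS](rmorphM (real_complex R)) lecR; exact: bnd.
  rewrite ler_wpM2r//; near: r; apply: nbhs_pinfty_ge.
  by rewrite ger0_real// -(rmorph0 (real_complex R)) lecR.
have Tin : T \in @Defs.linear_continuous R ell2.
  by apply/linear_continuousP; split.
exists (Bop Tin) => //; apply: bnorm_le => // xi; exact: bnd.
Unshelve. all: by end_near. Qed.

Lemma bop_linearE T (z : C) xi eta x : T (z *: xi + eta) x = z * T xi x + T eta x.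
Proof. by rewrite linearD linearZ. Qed.

Lemma bop_ext S T : (forall x, S (delta R x) = T (delta R x)) -> S = T.
Proof.
move=> ST; apply/val_inj/funext => xi; apply/val_inj/funext => x /=.
apply/eqP; rewrite -subr_eq0; apply/eqP.
apply: (@ell2_functional_eq0 _ _ (fun xi => S xi x - T xi x) (bnorm S + bnorm T)).
- by move=> z u v; rewrite !bop_linearE opprD addrACA mulrBr.
- move=> u; apply: le_trans (zn_B (normc_zmod R) _ _) _; rewrite mulrDl.
  by apply: lerD; apply: le_trans (normc_le_ell2 _ _) (bnormP _ _).
- by move=> y; rewrite ST subrr.
Qed.

Lemma bop_complete : complete_norm bnorm.
Proof.
move=> u cu.
have zB := (bnorm_ring).1; have zE := ell2_zmod R X.
have at_cauchy xi : norm_cauchy (@ell2_norm R X) (fun n => u n xi).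
  move=> e e0; have n1 : 0 < ell2_norm xi + 1 by rewrite ltr_wpDl// ell2_norm_ge0.
  have [|N hN] := cu (e / (ell2_norm xi + 1)); first by rewrite divr_gt0.
  exists N => m n Nm Nn; have := hN m n Nm Nn; rewrite ltr_pdivlMr// => h.
  apply: le_lt_trans h; apply: le_trans (bnormP (u m - u n) xi) _.
  by rewrite ler_wpM2l ?bnorm_ge0// lerDl.
have /choice[T hT] xi := ell2_complete (at_cauchy xi).
have [N hN] := cu 1 ltr01.
have lin (z : C) xi eta : T (z *: xi + eta) = z *: T xi + T eta.
  apply/val_inj/funext => x /=.
  apply: (converges_unique (normc_zmod R) (ell2_converges_at x (hT _))).
  have h1 := ell2_converges_at x (hT xi); have h2 := ell2_converges_at x (hT eta).
  have h3 : converges (@normc R) (fun n => z * u n xi x) (z * T xi x).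
    move=> e e0; have n1 : 0 < normc z + 1 by rewrite ltr_wpDl// normc_ge0.
    have [|K hK] := h1 (e / (normc z + 1)); first by rewrite divr_gt0.
    exists K => n /hK; rewrite -mulrBr Normc.normcM ltr_pdivlMr// => h.
    by apply: le_lt_trans h; rewrite mulrC ler_wpM2l ?normc_ge0// lerDl.
  have h4 := convergesB (normc_zmod R) h3 (convergesB (normc_zmod R)
    (converges_cst (normc_zmod R) 0) h2).
  rewrite sub0r opprK in h4; apply: converges_ext h4 => n.
  by rewrite sub0r opprK bop_linearE.
have bnd e K xi : 0 <= e -> (forall m n, (K <= m)%N -> (K <= n)%N -> bnorm (u m - u n) < e) ->
    forall n, (K <= n)%N -> ell2_norm (T xi - u n xi) <= e * ell2_norm xi.
  move=> e0 h n Kn.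
  have c := convergesB zE (hT xi) (converges_cst zE (u n xi)).
  (* The shift by [K] makes the Cauchy bound valid for all terms, as [converges_le] requires. *)
  apply: (@converges_le _ _ _ zE (fun m => u (m + K)%N xi - u n xi)).
    move=> m; apply: le_trans (bnormP (u (m + K)%N - u n) xi) _.
    by rewrite ler_wpM2r ?ell2_norm_ge0// ltW// h// leq_addl.
  by move=> d /c[P hP]; exists P => m Pm; apply: hP; rewrite (leq_trans Pm)// leq_addr.
have [||S SE _] := @bop_ex T (1 + bnorm (u N)) _ lin.
- by rewrite addr_ge0 ?bnorm_ge0.
- move=> xi; rewrite mulrDl; apply: le_trans (zn_sub_le zE _ (u N xi)) _.
  rewrite addrC; apply: lerD; last exact: bnormP.
  exact: (@bnd 1 N xi ler01 hN N (leqnn N)).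
exists S => e e0; have e2 : 0 < e / 2 by rewrite divr_gt0.
have [K hK] := cu _ e2; exists K => n Kn; rewrite (zn_distC zB).
apply: (@le_lt_trans _ _ (e / 2)); last lra.
apply: bnorm_le => [|xi]; first exact: ltW.
rewrite -[(S - u n) xi]/(S xi - u n xi) SE.
by apply: (@bnd _ K) => //; exact: ltW.
Qed.

Lemma closure_bnormP (A : set B) T :
  closure A T <-> forall e, 0 < e -> exists2 a, A a & bnorm (T - a) < e.
Proof.
split=> [cl e e0|h].
  have [|a [Aa Ta]] := cl (ball T e%:C%C).
    by apply: nbhsx_ballx; rewrite -(rmorph0 (real_complex R)) ltcR.
  exists a => //; move: Ta; rewrite -ball_normE /ball_/= -[X in X < _]/((bnorm (T - a))%:C%C).
  by rewrite ltcR.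
move=> U /nbhs_ballP[e /= e0 eU].
have eR : e = (complex.Re e)%:C%C by rewrite RRe_real// gtr0_real.
have [|a Aa Ta] := h (complex.Re e); first by rewrite -ltcR -eR.
exists a; split => //; apply: eU; rewrite -ball_normE /ball_/= eR.
by rewrite -[X in X < _]/((bnorm (T - a))%:C%C) ltcR.
Qed.

Lemma closure_seq (A : set B) T : closure A T ->
  exists2 u : nat -> B, (forall n, A (u n)) & converges bnorm u T.
Proof.
move=> /closure_bnormP h.
have /choice[u hu] n : exists a, A a /\ bnorm (T - a) < n.+1%:R^-1.
  have [|a Aa Ta] := h (n.+1%:R^-1); first by rewrite invr_gt0 ltr0n.
  by exists a.
exists u => [n|e e0]; first by case: (hu n).
exists (Num.truncn e^-1) => n ne; rewrite (zn_distC bnorm_ring.1).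
have [_ h1] := hu n; apply: lt_le_trans h1 _.
rewrite invf_ple ?posrE ?ltr0n//.
by apply: ltW; apply: lt_le_trans (truncnS_gt _) _; rewrite ler_nat ltnS.
Qed.

Lemma seq_closure (A : set B) u T :
  (forall n, A (u n)) -> converges bnorm u T -> closure A T.
Proof.
move=> Au uT; apply/closure_bnormP => e /uT[N hN]; exists (u N) => //.
by rewrite (zn_distC bnorm_ring.1); exact: hN.
Qed.

Lemma closure_seq_closed (A : set B) : seq_closed bnorm (closure A).
Proof.
move=> u T Au uT; apply/closure_bnormP => e e0.
have e2 : 0 < e / 2 by rewrite divr_gt0.
have [N /(_ N (leqnn N)) hN] := uT _ e2.
have [a Aa ha] := (closure_bnormP A (u N)).1 (Au N) _ e2; exists a => //.
apply: le_lt_trans (zn_distD bnorm_ring.1 (u N) T a) _.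
by rewrite [e]splitr (zn_distC bnorm_ring.1 T); exact: ltrD.
Qed.

Lemma bop_converges_at u T xi : converges bnorm u T ->
  converges (@ell2_norm R X) (fun n => u n xi) (T xi).
Proof.
move=> uT e e0; have n1 : 0 < ell2_norm xi + 1 by rewrite ltr_wpDl// ell2_norm_ge0.
have [|N hN] := uT (e / (ell2_norm xi + 1)); first by rewrite divr_gt0.
exists N => n /hN; rewrite ltr_pdivlMr// => h.
apply: le_lt_trans h; apply: le_trans (bnormP (u n - T) xi) _.
by rewrite ler_wpM2l ?bnorm_ge0// lerDl.
Qed.

Lemma ell2_norm_mono xi eta :
  (forall x, normc (xi x) <= normc (eta x)) -> ell2_norm xi <= ell2_norm eta.
Proof.
move=> h; apply/ell2_norm_le => [|F]; first exact: ell2_norm_ge0.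
apply: le_trans (ell2_sum_le eta F); apply: ler_sum => x _.
by rewrite lerXn2r ?nnegrE ?normc_ge0.
Qed.

Lemma truncation_norm_le xi F : ell2_norm (truncation xi F) <= ell2_norm xi.
Proof.
apply: ell2_norm_mono => x; rewrite truncationE; case: ifP => // _.
by rewrite Normc.normc0 normc_ge0.
Qed.

Lemma bop_truncation T xi F x :
  T (truncation xi F) x = \sum_(y <- F) xi y * T (delta R y) x.
Proof.
rewrite /truncation linear_sum sum_ell2E; apply: eq_bigr => y _.
by rewrite linearZ.
Qed.

End Bops.

(** * Adjoints, domination and commutators *)

Section Adjoints.
Variables (R : realType) (X : choiceType).
Local Notation C := R[i].
Local Notation ell2 := (ell2 R X).
Local Notation B := (bop ell2).
Implicit Types (xi eta : ell2) (F : {fset X}) (a b c D S T : B).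

Lemma bop_subE S T xi x : (S - T) xi x = S xi x - T xi x.
Proof. by []. Qed.

Lemma bop_scaleE (z : C) T xi x : (z *: T) xi x = z * T xi x.
Proof. by []. Qed.

Lemma bop_mulE S T xi : (S * T) xi = S (T xi).
Proof. by []. Qed.

Lemma normc_real (r : R) : 0 <= r -> normc r%:C%C = r.
Proof. by move=> r0; rewrite /= expr0n addr0 sqrtr_sqr ger0_norm. Qed.

(* |b xi| <= c |xi| pointwise for finitely supported xi. *)
Lemma domination b c (k : X -> X -> R) :
  (forall x y, c (delta R y) x = (k x y)%:C%C) ->
  (forall x y, normc (b (delta R y) x) <= k x y) -> bnorm b <= bnorm c.
Proof.
move=> ck bk.
have k0 x y : 0 <= k x y by apply: le_trans (bk x y); exact: normc_ge0.
apply: bnorm_le => [|xi]; first exact: bnorm_ge0.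
have [|axi axiE] := @ell2_ex _ _ (fun x => (normc (xi x))%:C%C) (ell2_norm xi ^+ 2).
  move=> F; apply: le_trans (ell2_sum_le xi F); apply: ler_sum => x _.
  by rewrite normc_real ?normc_ge0.
have naxi : ell2_norm axi <= ell2_norm xi.
  by apply: ell2_norm_mono => x; rewrite axiE normc_real ?normc_ge0.
have [F hF] := truncation_converges xi.
have zE := ell2_zmod R X.
(* Matrix coefficients describe [b] only on finite combinations of deltas, so the estimate is made
   for truncations and passed to the limit. *)
apply: (@converges_le _ _ _ zE (fun n => b (truncation xi (F n)))); last first.
  move=> e e0; have n1 : 0 < bnorm b + 1 by rewrite ltr_wpDl// bnorm_ge0.
  have [|N hN] := hF (e / (bnorm b + 1)); first by rewrite divr_gt0.
  exists N => n /hN; rewrite ltr_pdivlMr// => h; rewrite -linearB.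
  apply: le_lt_trans (bnormP _ _) _; apply: le_lt_trans h.
  by rewrite mulrC ler_wpM2l ?ell2_norm_ge0// lerDl.
move=> n; apply: (@le_trans _ _ (ell2_norm (c (truncation axi (F n))))); last first.
  apply: le_trans (bnormP _ _) _; rewrite ler_wpM2l ?bnorm_ge0//.
  exact: le_trans (truncation_norm_le _ _) naxi.
apply: ell2_norm_mono => x; rewrite !bop_truncation.
have -> : \sum_(y <- F n) axi y * c (delta R y) x =
    (\sum_(y <- F n) normc (xi y) * k x y)%:C%C :> C.
  by rewrite rmorph_sum/=; apply: eq_bigr => y _; rewrite axiE ck -rmorphM.
rewrite normc_real; last by apply: sumr_ge0 => y _; rewrite mulr_ge0 ?normc_ge0.
apply: le_trans (zn_sum (normc_zmod R) _ _ _) _; apply: ler_sum => y _.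
by rewrite Normc.normcM ler_wpM2l ?normc_ge0.
Qed.

Lemma adjoint_sym a b : Defs.adjoint a b -> Defs.adjoint b a.
Proof. by move=> ab xi eta; rewrite innerC -ab -innerC. Qed.

(** The square of the norm of [b eta] is the inner product of [a (b eta)] with [eta]; Cauchy-Schwarz
    and division by the norm of [b eta] give the bound. *)
Lemma adjoint_norm_le a b : Defs.adjoint a b -> bnorm b <= bnorm a.
Proof.
move=> ab; apply: bnorm_le => [|eta]; first exact: bnorm_ge0.
have h : ell2_norm (b eta) ^+ 2 <= ell2_norm (a (b eta)) * ell2_norm eta.
  have := cauchy_schwarz (a (b eta)) eta.
  by rewrite ab inner_norm normc_real// sqr_ge0.
have h2 := bnormP a (b eta).
have n0 := ell2_norm_ge0 (b eta); have m0 := ell2_norm_ge0 eta.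
have [z|nz] := eqVneq (ell2_norm (b eta)) 0.
  by rewrite z mulr_ge0 ?bnorm_ge0.
have np : 0 < ell2_norm (b eta) by rewrite lt_neqAle eq_sym nz.
rewrite -(ler_pM2l np) -expr2; apply: le_trans h _.
by rewrite mulrCA mulrA; apply: ler_wpM2r.
Qed.

Lemma adjoint_norm a b : Defs.adjoint a b -> bnorm b = bnorm a.
Proof.
move=> ab; apply/eqP; rewrite eq_le adjoint_norm_le// adjoint_norm_le//.
exact: adjoint_sym.
Qed.

Lemma adjointB a a' b b' :
  Defs.adjoint a b -> Defs.adjoint a' b' -> Defs.adjoint (a - a') (b - b').
Proof.
move=> ab ab' xi eta.
rewrite -[(a - a') xi]/(a xi - a' xi) -[(b - b') eta]/(b eta - b' eta).
by rewrite innerBl innerBr ab ab'.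
Qed.

Lemma adjointM a a' b b' :
  Defs.adjoint a b -> Defs.adjoint a' b' -> Defs.adjoint (a * a') (b' * b).
Proof. by move=> ab ab' xi eta; rewrite [LHS]ab ab'. Qed.

Lemma adjoint_limit (u v : nat -> B) a b : (forall n, Defs.adjoint (u n) (v n)) ->
  converges (@bnorm R X) u a -> converges (@bnorm R X) v b -> Defs.adjoint a b.
Proof.
move=> uv ua vb xi eta.
have cl := @converges_bilinear R ell2 ell2 C _ _ _ (@inner R X) (ell2_zmod R X)
  (ell2_zmod R X) (normc_zmod R) (@innerBl R X) (@innerBr R X) (@cauchy_schwarz R X).
have cE := @converges_cst _ _ _ (ell2_zmod R X).
apply: (converges_unique (normc_zmod R) (cl _ _ _ _ (bop_converges_at xi ua) (cE eta))).
apply: converges_ext (cl _ _ _ _ (cE xi) (bop_converges_at eta vb)) => n.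
by rewrite uv.
Qed.

Lemma adjoint_of_deltas a b :
  (forall x y, a (delta R y) x = conjc (b (delta R x) y)) -> Defs.adjoint a b.
Proof.
move=> ab.
have bnd xi eta : normc (inner (a xi) eta - inner xi (b eta)) <=
    (bnorm a + bnorm b) * ell2_norm xi * ell2_norm eta.
  apply: le_trans (zn_B (normc_zmod R) _ _) _; rewrite !mulrDl; apply: lerD.
    by apply: le_trans (cauchy_schwarz _ _) _; rewrite ler_wpM2r ?ell2_norm_ge0 ?bnormP.
  apply: le_trans (cauchy_schwarz _ _) _; rewrite mulrAC mulrC.
  by rewrite ler_wpM2r ?ell2_norm_ge0 ?bnormP.
have step x xi : inner (a xi) (delta R x) - inner xi (b (delta R x)) = 0.
  apply: (@ell2_functional_eq0 _ _
    (fun xi => inner (a xi) (delta R x) - inner xi (b (delta R x)))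
    ((bnorm a + bnorm b) * ell2_norm (delta R x))).
  - move=> z u v; rewrite linearD linearZ !inner_linear opprD addrACA mulrBr.
    by [].
  - by move=> u; rewrite mulrAC; exact: bnd.
  - by move=> y; rewrite inner_delta ab (innerC (b _)) inner_delta subrr.
move=> xi eta; apply/eqP; rewrite -subr_eq0; apply/eqP.
(* Conjugation makes the expression linear in [eta], so that the vanishing criterion applies to the
   second variable too. *)
apply: (can_inj (@conjcK R)); rewrite conjc0.
apply: (@ell2_functional_eq0 _ _
  (fun eta => conjc (inner (a xi) eta - inner xi (b eta)))
  ((bnorm a + bnorm b) * ell2_norm xi)).
- move=> z u v; rewrite !conjcD !conjcN -!innerC linearD linearZ.
  by rewrite !inner_linear opprD addrACA mulrBr.
- move=> u; apply: le_trans (bnd xi u).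
  by case: (_ - _) => p q; rewrite /= sqrrN.
- by move=> y; rewrite step conjc0.
Qed.

Section Diagonal.
Variables (m : X -> R) (M : R).
Hypothesis mM : forall x, `|m x| <= M.

Lemma diagonal_ex : exists2 D : B,
  (forall xi x, D xi x = (m x)%:C%C * xi x) & Defs.adjoint D D.
Proof.
have bnd xi x : normc ((m x)%:C%C * xi x) ^+ 2 <= M ^+ 2 * normc (xi x) ^+ 2.
  rewrite Normc.normcM exprMn ler_wpM2r ?sqr_ge0//.
  by rewrite /= expr0n addr0 sqrtr_sqr lerXn2r ?nnegrE ?(le_trans _ (mM x)).
have /choice[T hT] xi : exists eta, eta = (fun x => (m x)%:C%C * xi x) :> (X -> C).
  apply: (@ell2_ex _ _ _ (M ^+ 2 * ell2_norm xi ^+ 2)) => F.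
  apply: (@le_trans _ _ (M ^+ 2 * \sum_(x <- F) normc (xi x) ^+ 2)).
    by rewrite mulr_sumr; apply: ler_sum => x _.
  by rewrite ler_wpM2l ?sqr_ge0// ell2_sum_le.
(* The absolute value covers an empty index type, over which [mM] says nothing about the sign of
   [M]. *)
have M0 : 0 <= `|M| by [].
have [||D DE _] := @bop_ex R X T `|M| M0.
- move=> z xi eta; apply/val_inj/funext => x.
  have hT' w : T w x = (m x)%:C%C * w x by rewrite hT.
  rewrite -[LHS]/(T (z *: xi + eta) x) -[RHS]/(z * T xi x + T eta x) !hT'.
  by rewrite -[(z *: xi + eta) x]/(z * xi x + eta x) mulrDr mulrCA.
- move=> xi; apply/ell2_norm_le => [|F]; first by rewrite mulr_ge0 ?ell2_norm_ge0.
  rewrite exprMn real_normK ?num_real//.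
  apply: (@le_trans _ _ (M ^+ 2 * \sum_(x <- F) normc (xi x) ^+ 2)).
    by rewrite mulr_sumr; apply: ler_sum => x _; rewrite hT.
  by rewrite ler_wpM2l ?sqr_ge0// ell2_sum_le.
have E xi x : D xi x = (m x)%:C%C * xi x by rewrite DE hT.
exists D => //; apply: adjoint_of_deltas => x y; rewrite !E conjcM conjc_real /=.
by rewrite conjc_nat [y == x]eq_sym; case: eqP => [->|_]; rewrite ?mulr0.
Qed.

End Diagonal.

Definition commutator D a : B := D * a - a * D.

Lemma commutatorB D a b : commutator D (a - b) = commutator D a - commutator D b.
Proof.
rewrite /commutator mulrBr mulrBl opprB -!addrA; congr (_ + _).
by rewrite addrCA addrC -!addrA opprB addrC -addrA; congr (_ + _); rewrite addrC.
Qed.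

Lemma commutatorM D a b : commutator D (a * b) = commutator D a * b + a * commutator D b.
Proof. by rewrite /commutator mulrBl mulrBr !mulrA addrA subrK. Qed.

Lemma commutator_adjoint D a b : Defs.adjoint D D -> Defs.adjoint a b ->
  Defs.adjoint (commutator D a) (- commutator D b).
Proof.
by move=> DD ab; rewrite /commutator opprB; apply: adjointB; apply: adjointM.
Qed.

Lemma commutator_delta D (m : X -> R) a x y :
  (forall xi x, D xi x = (m x)%:C%C * xi x) ->
  commutator D a (delta R y) x = (m x - m y)%:C%C * a (delta R y) x.
Proof.
move=> DE; rewrite -[LHS]/(D (a (delta R y)) x - a (D (delta R y)) x) DE.
have -> : D (delta R y) = (m y)%:C%C *: delta R y.
  apply/val_inj/funext => z; rewrite /= DE -[RHS]/((m y)%:C%C * (z == y)%:R) /=.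
  by case: eqP => [->|]; rewrite ?mulr0.
by rewrite linearZ -[X in _ - X]/((m y)%:C%C * _) rmorphB mulrBl.
Qed.

(** A commutator with a diagonal operator multiplies the matrix coefficient at [(x, y)] by
    [m x - m y]. Bounding this factor from above, and evaluating it at the base point [y], are the
    two halves of the description of H^oo by commutators. *)
Lemma iter_commutator_delta D (m : X -> R) a k x y :
  (forall xi x, D xi x = (m x)%:C%C * xi x) ->
  iter k (commutator D) a (delta R y) x = ((m x - m y) ^+ k)%:C%C * a (delta R y) x.
Proof.
move=> DE; elim: k => [|k IH]; first by rewrite expr0 mul1r.
by rewrite iterS (commutator_delta _ _ _ DE) IH mulrA -rmorphM -exprS.
Qed.

End Adjoints.

(** * Operators commuting with right translations *)

Section Equivariant.
Variables (R : realType) (G : groupType) (H : set G).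
Hypothesis hH : hecke_pair H.
Local Notation C := R[i].
Local Notation X := (rcosets H).
Local Notation ell2 := (ell2 R X).
Local Notation B := (bop ell2).
Local Notation rclass := (rclass H).
Local Notation x0 := (rclass 1%g).
Implicit Types (xi eta : ell2) (S T : B) (g h k : G) (x y : X) (f : G -> C).

Let sH : subgroup H := hH.1.

Lemma rreprE g : exists2 h, H h & rrepr (rclass g) = (h * g)%g.
Proof. by have [h Hh <-] := rrepr_class sH g; exists h. Qed.

Lemma rclassMl h g : H h -> rclass (h * g) = rclass g.
Proof. by move=> Hh; apply: eq_rclass => //; exists h. Qed.

Lemma rclass_eqP g g' : rclass g = rclass g' <-> H (g' * g^-1)%g.
Proof.
split=> [/(congr1 val)/= e|h].
  have : rcoset H g' g' by exact: rcoset_refl.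
  by rewrite -e => -[h Hh <-]; rewrite mulgK.
by rewrite -(rclassMl g h) mulgVK.
Qed.

Lemma rclass1_eqP g : rclass g = x0 <-> H g.
Proof.
rewrite rclass_eqP mul1g; case: sH => _ _ HV.
by split=> [/HV|/HV//]; rewrite invgK.
Qed.

Definition rmul g x : X := rclass (rrepr x * g).

Lemma rmul_class g h : rmul g (rclass h) = rclass (h * g).
Proof. by rewrite /rmul; have [k Hk ->] := rreprE h; rewrite -mulgA [LHS]rclassMl. Qed.

Lemma rmulM g h x : rmul h (rmul g x) = rmul (g * h) x.
Proof. by rewrite [rmul g x]/rmul rmul_class -mulgA. Qed.

Lemma rmul1 x : rmul 1 x = x.
Proof. by rewrite /rmul mulg1 rreprK. Qed.

Lemma rmulK g : cancel (rmul g) (rmul g^-1).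
Proof. by move=> x; rewrite rmulM mulgV rmul1. Qed.

Lemma rmulVK g : cancel (rmul g^-1) (rmul g).
Proof. by move=> x; rewrite rmulM mulVg rmul1. Qed.

(** Commutation with right translations is stated through a pair of vectors that are pointwise
    translates of each other, so no translation operator on [ell2] has to be constructed. *)
Definition equivariant T := forall g xi eta,
  (forall x, eta x = xi (rmul g x)) -> forall x, T eta x = T xi (rmul g x).

Definition symbol T : G -> C := fun g => T (delta R x0) (rclass g).

(** The delta at Hh is a right translate of the delta at H, so equivariance reduces the whole matrix
    of [T] to its column at H. *)
Lemma symbol_coef T g h : equivariant T ->
  T (delta R (rclass h)) (rclass g) = symbol T (g * h^-1)%g.
Proof.
move=> eT; rewrite (eT (h^-1)%g (delta R x0)) ?rmul_class// => x.
rewrite -[LHS]/((x == rclass h)%:R) -[RHS]/((rmul h^-1 x == x0)%:R).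
have -> : x0 = rmul h^-1 (rclass h) by rewrite rmul_class mulgV.
by rewrite (can_eq (rmulK h^-1)).
Qed.

Lemma symbol_coef_repr T x y : equivariant T ->
  T (delta R y) x = symbol T (rrepr x * (rrepr y)^-1)%g.
Proof. by move=> eT; rewrite -symbol_coef// !rreprK. Qed.

Lemma symbol_bi_invariant T : equivariant T -> bi_invariant H (symbol T).
Proof.
move=> eT h k g Hh Hk; rewrite -[LHS]/(T _ _) -mulgA rclassMl//.
have -> : (g * k = g * (k^-1)^-1)%g by rewrite invgK.
rewrite -[LHS]/(symbol T (g * (k^-1)^-1)%g) -symbol_coef//; congr (T (delta R _) _).
by apply/rclass1_eqP; case: sH => _ _; apply.
Qed.

Lemma symbol_inj S T : equivariant S -> equivariant T -> symbol S = symbol T -> S = T.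
Proof.
move=> eS eT ST; apply: bop_ext => y; apply/val_inj/funext => x /=.
by rewrite !symbol_coef_repr// ST.
Qed.

Lemma equivariant1 : equivariant 1.
Proof. by []. Qed.

Lemma equivariantB S T : equivariant S -> equivariant T -> equivariant (S - T).
Proof.
move=> eS eT g xi eta h x.
by rewrite !bop_subE (eS _ _ _ h) (eT _ _ _ h).
Qed.

Lemma equivariantZ (c : C) T : equivariant T -> equivariant (c *: T).
Proof.
by move=> eT g xi eta h x; rewrite !bop_scaleE (eT _ _ _ h).
Qed.

Lemma equivariantM S T : equivariant S -> equivariant T -> equivariant (S * T).
Proof.
by move=> eS eT g xi eta h x; apply: eS => y; exact: eT.
Qed.

Lemma equivariant_limit u T : (forall n, equivariant (u n)) ->
  converges (@bnorm R X) u T -> equivariant T.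
Proof.
move=> eu uT g xi eta h x.
apply: (converges_unique (normc_zmod R)
  (ell2_converges_at x (bop_converges_at eta uT))).
apply: converges_ext (ell2_converges_at (rmul g x) (bop_converges_at xi uT)) => n.
by rewrite (eu n _ _ _ h).
Qed.

Lemma lcoset_repr K : range (lcoset H) K -> K = lcoset H (xget 1%g K).
Proof.
move=> [g _ gK]; set k := xget 1%g K.
have Kk : K k.
  apply: (@xgetI _ 1%g K g); rewrite -gK; exists 1%g; rewrite ?mulg1//.
  by case: sH.
have gk : lcoset H g k by rewrite gK.
by rewrite (eq_lcoset sH gk) gK.
Qed.

(** The convolution is defined through the chosen representative of the coset, which is [h * g] with
    [h] in H. Reindexing the left cosets by left multiplication with [h] removes this choice. *)
Lemma convolution_at f xi g : bi_invariant H f ->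
  convolution f xi (rclass g) = \sum_(K \in range (lcoset H))
    let k := xget 1%g K in f k * xi (rclass (k^-1 * g)%g).
Proof.
move=> bf; rewrite /convolution; have [h Hh ->] := rreprE g.
have [H1 HM HV] := sH.
pose mv K := [set (h * k)%g | k in K] : set G.
have mvl k : mv (lcoset H k) = lcoset H (h * k)%g.
  apply/seteqP; split=> [_ [_ [k' Hk' <-] <-]|_ [k' Hk' <-]].
    by exists k' => //; rewrite mulgA.
  by exists (k * k')%g; rewrite ?mulgA//; exists k'.
have mvK (K K' : set G) : mv K = mv K' -> K = K'.
  move=> e; apply/seteqP; split=> k Kk.
    have : mv K (h * k)%g by exists k.
    by rewrite e => -[k' K'k' /mulgI <-].
  have : mv K' (h * k)%g by exists k.
  by rewrite -e => -[k' K'k' /mulgI <-].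
rewrite (@reindex_fsbig _ _ _ _ _ mv (range (lcoset H)) (range (lcoset H))); last first.
  split=> [_ [k _ <-]|K K' _ _ /mvK//|_ [k _ <-]].
    by rewrite mvl; exists (h * k)%g.
  by exists (lcoset H (h^-1 * k)%g); [exists (h^-1 * k)%g|rewrite mvl mulVKg].
apply: eq_fsbigr => K /set_mem rK /=.
have rmK : range (lcoset H) (mv K).
  by case: rK => k _ <-; rewrite mvl; exists (h * k)%g.
set k' := xget 1%g (mv K); set k := xget 1%g K.
(* The chosen representative of hK and [h] times that of K differ by a right factor in H, which
   neither [f] nor the coset in the argument of [xi] sees. *)
have : lcoset H (h * k)%g k'.
  rewrite -mvl -(lcoset_repr rK) (lcoset_repr rmK) -/k'.
  by exists 1%g => //; rewrite mulg1.
move=> [m Hm <-]; rewrite bf// ; congr (_ * xi _).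
rewrite !invgM -!mulgA mulKg.
by rewrite rclassMl//; exact: HV.
Qed.

End Equivariant.

(** * The reduced Hecke algebra *)

Section HeckeOperators.
Variables (R : realType) (G : groupType) (H : set G).
Hypothesis hH : hecke_pair H.
Local Notation C := R[i].
Local Notation X := (rcosets H).
Local Notation ell2 := (ell2 R X).
Local Notation B := (bop ell2).
Local Notation rclass := (rclass H).
Local Notation x0 := (rclass 1%g).
Local Notation equivariant := (@equivariant R G H).
Implicit Types (xi eta : ell2) (S T a b : B) (g h k : G) (x y : X) (f : G -> C).

Let sH : subgroup H := hH.1.

Lemma lambda_at f xi g : hecke_algebra H f ->
  lambda H f xi (rclass g) = \sum_(K \in range (lcoset H))
    let k := xget 1%g K in f k * xi (rclass (k^-1 * g)%g).
Proof. by move=> hf; rewrite lambdaE// convolution_at//; case: hf. Qed.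

Lemma lambda_equivariant f : hecke_algebra H f -> equivariant (lambda H f).
Proof.
move=> hf g xi eta h x; rewrite -(rreprK sH x) rmul_class// !lambda_at//.
apply: eq_fsbigr => K _ /=; rewrite h rmul_class//.
by rewrite mulgA.
Qed.

Lemma symbol_lambda f : hecke_algebra H f -> symbol (lambda H f) = f.
Proof.
move=> hf; apply/funext => g; rewrite /symbol lambda_at//.
have rg : range (lcoset H) (lcoset H g) by exists g.
have [H1 HM HV] := sH.
(* Only the left coset gH contributes, since the delta at H asks for [k^-1 * g] in H. *)
rewrite -(@fsbig_widen _ _ _ _ [set lcoset H g]) ?fsbig_set1/=; last 2 first.
- by move=> _ ->.
- move=> K [/= rK Kg].
  rewrite -[X in _ * X]/((rclass _ == x0)%:R); case: eqP => [e|_]; last by rewrite mulr0.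
  exfalso; apply: Kg => /=; rewrite (lcoset_repr hH rK); apply/esym/eq_lcoset => //.
  exists ((xget 1 K)^-1 * g)%g; last by rewrite mulVKg.
  exact/(rclass1_eqP hH).
have := lcoset_repr hH rg; set k := xget 1%g _ => e.
have : lcoset H k g by rewrite -e; exists 1%g; rewrite ?mulg1.
move=> [h Hh <-]; rewrite mulKg.
rewrite -[X in _ * X]/((rclass _ == x0)%:R) (_ : rclass h = x0) ?eqxx ?mulr1.
  by case: hf => bf _; rewrite -[(k * h)%g]mul1g mulgA bf.
exact/rclass1_eqP.
Qed.

(** An intrinsic description of the operators of the Hecke algebra, see [hecke_operator_image]. It
    makes closure under products and differences visible without associativity or linearity of the
    convolution. *)
Definition hecke_operator T :=
  equivariant T /\ finite_set [set x | T (delta R x0) x != 0].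

Lemma dcoset_refl g : dcoset H g g.
Proof. by case: sH => H1 _ _; exists 1%g => //; exists 1%g => //; rewrite mul1g mulg1. Qed.

Lemma eq_dcoset g h k : H h -> H k -> dcoset H (h * g * k)%g = dcoset H g.
Proof.
move=> Hh Hk; have [H1 HM HV] := sH; apply/seteqP; split=> _ [a Ha [b Hb <-]].
  exists (a * h)%g; first exact: HM.
  by exists (k * b)%g; [exact: HM|rewrite !mulgA].
exists (a * h^-1)%g; first by apply: HM => //; exact: HV.
exists (k^-1 * b)%g; first by apply: HM => //; exact: HV.
by rewrite !mulgA mulgVK mulgK.
Qed.

(** Inversion exchanges left and right cosets, so the decomposition of the double coset of [g^-1]
    into left cosets gives one of HgH into right cosets. *)
Lemma finite_dcoset g : finite_set [set x : X | dcoset H g (rrepr x)].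
Proof.
have [s es] := hH.2 g^-1%g; have [H1 HM HV] := sH.
apply: (@sub_finite_set _ _ ((fun y : G => rclass y^-1%g) @` [set` s])).
  move=> x [h Hh [k Hk e]].
  have : dcoset H g^-1%g (rrepr x)^-1%g.
    by exists k^-1%g; [exact: HV|exists h^-1%g; [exact: HV|rewrite -e !invgM mulgA]].
  rewrite es => -[y ys [m Hm ym]]; exists y => //.
  rewrite -(rreprK sH x) -[rrepr x]invgK -ym invgM rclassMl//; exact: HV.
by apply: finite_image; exact: finite_seq.
Qed.

Lemma hecke_operator_lambda f : hecke_algebra H f -> hecke_operator (lambda H f).
Proof.
move=> hf; split; first exact: lambda_equivariant.
have [bf ff] := hf.
apply: (@sub_finite_set _ _ (\bigcup_(D in [set dcoset H g | g in [set g | f g != 0]])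
  [set x : X | D (rrepr x)])).
  move=> x /= fx; exists (dcoset H (rrepr x)); last exact: dcoset_refl.
  exists (rrepr x) => //=; rewrite -(symbol_lambda hf) /symbol.
  by rewrite rreprK.
apply: bigcup_finite => // _ [g _ <-]; exact: finite_dcoset.
Qed.

Lemma hecke_operator_symbol T : hecke_operator T -> hecke_algebra H (symbol T).
Proof.
move=> [eT fT]; split; first exact: symbol_bi_invariant.
apply: (@sub_finite_set _ _ ((fun x => dcoset H (rrepr x)) @`
  [set x | T (delta R x0) x != 0])); last exact: finite_image.
move=> _ [g /= Tg <-]; exists (rclass g) => //.
have [h Hh ->] := rreprE hH g; rewrite -[(h * g)%g]mulg1 eq_dcoset//.
by case: sH.
Qed.

Lemma hecke_operatorE T : hecke_operator T -> lambda H (symbol T) = T.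
Proof.
move=> hT; have hs := hecke_operator_symbol hT.
apply: (symbol_inj hH (lambda_equivariant hs) hT.1); exact: symbol_lambda.
Qed.

Lemma hecke_operator_image T :
  (lambda H @` @hecke_algebra R G H) T <-> hecke_operator T.
Proof.
split=> [[f hf <-]|hT]; first exact: hecke_operator_lambda.
by exists (symbol T); [exact: hecke_operator_symbol|exact: hecke_operatorE].
Qed.

Lemma hecke_operator1 : hecke_operator 1.
Proof.
split; first exact: equivariant1.
apply: (@sub_finite_set _ _ [set x0]); last exact: finite_set1.
move=> x /=; rewrite -[X in X != 0]/((x == x0)%:R).
by case: (x =P x0) => // _; rewrite eqxx.
Qed.

Lemma hecke_operatorB S T : hecke_operator S -> hecke_operator T -> hecke_operator (S - T).
Proof.
move=> [eS fS] [eT fT]; split; first exact: equivariantB.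
apply: (@sub_finite_set _ _ ([set x | S (delta R x0) x != 0] `|`
  [set x | T (delta R x0) x != 0])); last by rewrite finite_setU.
move=> x; rewrite /mkset bop_subE => h.
case: (eqVneq (S (delta R x0) x) 0) => [Sx|]; [right|by left].
by move: h; rewrite Sx sub0r oppr_eq0.
Qed.

Lemma hecke_operatorZ (c : C) T : hecke_operator T -> hecke_operator (c *: T).
Proof.
move=> [eT fT]; split; first exact: equivariantZ.
apply: sub_finite_set fT => x; rewrite /mkset bop_scaleE; apply: contra => /eqP ->.
by rewrite mulr0.
Qed.

Lemma hecke_operator_delta T y : hecke_operator T -> finite_set [set x | T (delta R y) x != 0].
Proof.
move=> [eT fT].
apply: (@sub_finite_set _ _ (@rmul G H (rrepr y) @` [set x | T (delta R x0) x != 0])).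
  move=> x /= h; exists (rmul (rrepr y)^-1%g x); last by rewrite rmulVK.
  rewrite /=; apply: contra h => /eqP e; apply/eqP; rewrite -e.
  rewrite symbol_coef_repr// /symbol; congr (T _ _).
exact: finite_image.
Qed.

Lemma hecke_operatorM S T : hecke_operator S -> hecke_operator T -> hecke_operator (S * T).
Proof.
move=> hS [eT fT]; split; first exact: equivariantM hS.1 eT.
set F := [set x | T (delta R x0) x != 0] in fT.
have TF : T (delta R x0) = truncation (T (delta R x0)) (fset_set F).
  apply/val_inj/funext => x /=; rewrite truncationE in_fset_set//; case: ifPn => //.
  by move=> /negP xF; apply/eqP; apply: contrapT => /negP h; apply: xF; exact: mem_set.
apply: (@sub_finite_set _ _ (\bigcup_(y in F) [set x | S (delta R y) x != 0])).
  move=> x; rewrite /mkset bop_mulE TF bop_truncation => h.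
  apply: contrapT => nx; move/eqP: h; apply; rewrite big_seq big1// => y.
  rewrite in_fset_set// => /set_mem Fy.
  have [->|Sx] := eqVneq (S (delta R y) x) 0; first by rewrite mulr0.
  by case: nx; exists y.
by apply: bigcup_finite => // y _; exact: hecke_operator_delta.
Qed.

Lemma hecke_operator_adjoint T : hecke_operator T ->
  exists2 S, hecke_operator S & Defs.adjoint T S.
Proof.
move=> hT; have [bf ff] := hecke_operator_symbol hT; set f := symbol T in bf ff.
have [H1 HM HV] := sH.
(* The involution of the Hecke algebra; inversion carries double cosets to double cosets, so the
   support stays finite. *)
pose fs g := conjc (f g^-1%g).
have hfs : hecke_algebra H fs.
  split=> [h k g Hh Hk|].
    by rewrite /fs !invgM mulgA bf//; exact: HV.
  apply: (@sub_finite_set _ _ ((fun D : set G => [set g^-1%g | g in D]) @`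
    [set dcoset H g | g in [set g | f g != 0]])); last exact: finite_image.
  move=> _ [g /= fg <-]; exists (dcoset H g^-1%g).
    exists g^-1%g => //=; apply: contra fg => /eqP e.
    by rewrite /fs e conjc0.
  apply/seteqP; split=> [_ [_ [h Hh [k Hk <-]] <-]|_ [h Hh [k Hk <-]]].
    exists k^-1%g; first exact: HV.
    by exists h^-1%g; [exact: HV|rewrite !invgM invgK mulgA].
  exists (k^-1 * g^-1 * h^-1)%g; last by rewrite !invgM !invgK mulgA.
  by exists k^-1%g; [exact: HV|exists h^-1%g; [exact: HV|]].
exists (lambda H fs); first exact: hecke_operator_lambda.
apply: adjoint_of_deltas => x y.
rewrite !symbol_coef_repr//; [|exact: lambda_equivariant|exact: hT.1].
by rewrite symbol_lambda// /fs conjcK invgM invgK.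
Qed.

Local Notation A := (reduced_hecke_algebra R H).
Local Notation bnorm := (@bnorm R X).

Lemma reducedP T : A T <-> exists2 u : nat -> B,
  (forall n, hecke_operator (u n)) & converges bnorm u T.
Proof.
split=> [/closure_seq[u uA uT]|[u hu uT]].
  by exists u => // n; apply/hecke_operator_image.
by apply: (seq_closure (u := u)) => // n; apply/hecke_operator_image.
Qed.

Lemma reduced_hecke T : hecke_operator T -> A T.
Proof.
move=> hT; apply/reducedP; exists (fun=> T) => //.
exact: converges_cst (bnorm_ring R X).1 T.
Qed.

Lemma reduced_equivariant T : A T -> equivariant T.
Proof. by move=> /reducedP[u hu]; apply: equivariant_limit => n; case: (hu n). Qed.

Lemma reduced_closed : seq_closed bnorm A.
Proof. exact: closure_seq_closed. Qed.

Lemma reduced_subring : set_subring A.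
Proof.
split; first exact: reduced_hecke hecke_operator1.
  move=> S T /reducedP[u hu uS] /reducedP[v hv vT]; apply/reducedP.
  exists (fun n => u n - v n); first by move=> n; exact: hecke_operatorB.
  by have := convergesB (bnorm_ring R X).1 uS vT.
move=> S T /reducedP[u hu uS] /reducedP[v hv vT]; apply/reducedP.
exists (fun n => u n * v n); first by move=> n; exact: hecke_operatorM.
by have := convergesM (bnorm_ring R X) uS vT.
Qed.

Lemma reducedZ (c : C) T : A T -> A (c *: T).
Proof.
move=> AT; have -> : c *: T = ((c *: (1 : B)) : B) * T by exact: val_inj.
have [_ _] := reduced_subring; apply => //; apply: reduced_hecke.
exact: hecke_operatorZ hecke_operator1.
Qed.

(** Passing to adjoints is isometric, so the adjoints of an approximating sequence of Hecke
    operators are again Cauchy, and their limit is the adjoint. This replaces a construction by the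
    Riesz theorem. *)
Lemma reduced_adjoint T : A T -> exists2 S, A S & Defs.adjoint T S.
Proof.
move=> /reducedP[u hu uT].
have /choice[v hv] n : exists S, hecke_operator S /\ Defs.adjoint (u n) S.
  by have [S hS TS] := hecke_operator_adjoint (hu n); exists S.
have [|S vS] := @bop_complete R X v.
  move=> e e0; have [N hN] := converges_cauchy (bnorm_ring R X).1 uT e0.
  exists N => m n Nm Nn.
  by rewrite (adjoint_norm (adjointB (hv m).2 (hv n).2)); exact: hN.
exists S; first by apply/reducedP; exists v => // n; case: (hv n).
by apply: (adjoint_limit (u := u) (v := v)) => // n; case: (hv n).
Qed.

Lemma representsP a f : represents a f <-> A a /\ symbol a = f.
Proof.
by split=> [[Aa h]|[Aa <-]]; split => //; apply/funext => g; exact: h.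
Qed.

End HeckeOperators.

(** * Rapidly decreasing functions as operators *)

Section RapidDecayRepresentation.
Variables (R : realType) (G : groupType) (H : set G) (L : G -> R).
Hypotheses (hH : hecke_pair H) (hL : length_function H L) (hRD : property_RD H L).
Local Notation C := R[i].
Local Notation X := (rcosets H).
Local Notation ell2 := (ell2 R X).
Local Notation B := (bop ell2).
Local Notation rclass := (rclass H).
Local Notation x0 := (rclass 1%g).
Local Notation A := (reduced_hecke_algebra R H).
Local Notation bnorm := (@bnorm R X).
Implicit Types (xi eta : ell2) (S T a b : B) (g h k : G) (x y : X) (f : G -> C).

Let sH : subgroup H := hH.1.

Lemma length_ge0 g : 0 <= L g. Proof. by case: hL. Qed.

Lemma length_bi_invariant : bi_invariant H L.
Proof.
case: hL => _ LM LV _ LH h k g Hh Hk; have [_ _ HV] := sH.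
apply/eqP; rewrite eq_le; apply/andP; split.
  by have := LM (h * g)%g k; have := LM h g; rewrite (LH h)// (LH k)//; lra.
have := LM h^-1%g (h * g)%g; have := LM (h * g * k)%g k^-1%g.
rewrite mulgK mulKg !LV (LH h)// (LH k)//; lra.
Qed.

Lemma bi_invariant_repr (V : Type) (f : G -> V) g :
  bi_invariant H f -> f (rrepr (rclass g)) = f g.
Proof.
move=> bf; have [h Hh ->] := rreprE hH g; rewrite -[(h * g)%g]mulg1 bf//.
by case: sH.
Qed.

Lemma square_summable_mono (u v : X -> C) : (forall x, normc (u x) <= normc (v x)) ->
  v \in @square_summable R X -> u \in @square_summable R X.
Proof.
move=> uv; rewrite !inE; apply: le_lt_trans; apply: le_esum => x _.
by rewrite lee_fin lerXn2r ?nnegrE ?normc_ge0.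
Qed.

Definition weighted_fun (s : R) f : X -> C :=
  fun x => f (rrepr x) * ((1 + L (rrepr x)) `^ s)%:C%C.

Lemma weighted_sqsum s f : weighted_norm H L s f = ((sqsum (weighted_fun s f)) `^ 2^-1)%E.
Proof.
rewrite /weighted_norm; congr (_ `^ _)%E; apply: eq_esum => x _; congr (_%:E).
rewrite Normc.normcM exprMn normc_real ?powR_ge0//; congr (_ * _).
by rewrite [2 * s]mulrC powRrM -powR_mulrn ?powR_ge0.
Qed.

Lemma weighted_norm_lty s f :
  (weighted_norm H L s f < +oo)%E <-> weighted_fun s f \in @square_summable R X.
Proof.
rewrite weighted_sqsum inE; split; last exact: poweR_lty.
by apply: lty_poweRy; rewrite invr_eq0 pnatr_eq0.
Qed.

Lemma weighted_normE s f xi : xi = weighted_fun s f :> (X -> C) ->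
  weighted_norm H L s f = (ell2_norm xi)%:E.
Proof.
move=> e; rewrite weighted_sqsum -e sqsumE poweR_EFin powR12_sqrt ?sqr_ge0//.
by rewrite sqrtr_sqr ger0_norm ?ell2_norm_ge0.
Qed.

Definition weighted_pow (n : nat) f : X -> C :=
  fun x => f (rrepr x) * ((1 + L (rrepr x)) ^+ n)%:C%C.

Lemma one_le_weight g : 1 <= 1 + L g.
Proof. by rewrite lerDl length_ge0. Qed.

(** As [1 + L >= 1], a real weight is dominated by the next integer one. Integer powers are what
    iterated commutators control. *)
Lemma rapidP f : rapidly_decreasing H L f <->
  bi_invariant H f /\ forall n, weighted_pow n f \in @square_summable R X.
Proof.
have powE n : weighted_pow n f = weighted_fun n%:R f.
  apply/funext => x; rewrite /weighted_fun powR_mulrn//.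
  by apply: le_trans (one_le_weight _); exact: ler01.
split=> [h|[bf h] s s0].
  split=> [|n]; first by have [] := h 0 (lexx 0).
  by rewrite powE; apply/weighted_norm_lty; have [] := h n%:R (ler0n _ _).
split => //; apply/weighted_norm_lty.
apply: square_summable_mono (h (Num.truncn s).+1) => x.
rewrite powE !Normc.normcM ler_wpM2l ?normc_ge0// !normc_real ?powR_ge0//.
apply: ler_powR; first exact: one_le_weight.
exact/ltW/truncnS_gt.
Qed.

Lemma lambdaB f f' : hecke_algebra H f -> hecke_algebra H f' ->
  hecke_algebra H (fun g => f g - f' g) /\
  lambda H (fun g => f g - f' g) = lambda H f - lambda H f' :> B.
Proof.
move=> hf hf'.
have e : symbol (lambda H f - lambda H f') = (fun g => f g - f' g).
  by apply/funext => g; rewrite /symbol bop_subE -!/(symbol _ g) !symbol_lambda.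
have hB := hecke_operatorB (hecke_operator_lambda hH hf) (hecke_operator_lambda hH hf').
by rewrite -e; split; [exact: hecke_operator_symbol|exact: hecke_operatorE].
Qed.

(** Finite cut-offs of [f] converge in a weighted norm; property (RD), applied to their differences,
    turns this into convergence of operators. The symbol of the limit is then identified
    pointwise. *)
Lemma rapid_represented f : rapidly_decreasing H L f ->
  exists2 a, A a & symbol a = f.
Proof.
move=> rf; have [C0 [s [C0p s0 RD]]] := hRD.
have [bf fin] := rf s (ltW s0); have ss := (weighted_norm_lty s f).1 fin.
pose eta := Ell2 ss; have [F hF] := truncation_converges eta.
have zE := ell2_zmod R X.
(* The finite sets [F n] consist of right cosets, but a cut-off must be H-bi-invariant; so [f] is
   kept on every double coset that meets them. This only decreases the error of the truncation. *)
pose fn n g : C := if `[< exists2 x, x \in F n & dcoset H (rrepr x) g >] then f g else 0.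
have [H1 HM HV] := sH.
have sub (x : X) g h k : H h -> H k -> dcoset H (rrepr x) g -> dcoset H (rrepr x) (h * g * k)%g.
  move=> Hh Hk [h' Hh' [k' Hk' <-]]; exists (h * h')%g; first exact: HM.
  by exists (k' * k)%g; [exact: HM|rewrite !mulgA].
have hfn n : hecke_algebra H (fn n).
  split=> [h k g Hh Hk|].
    rewrite /fn bf//; congr (if _ then _ else _); apply: asbool_equiv_eq.
    split=> -[x xF xg]; exists x => //; last exact: sub.
    have := sub x _ _ _ (HV _ Hh) (HV _ Hk) xg.
    by rewrite !mulgA mulVg mul1g mulgK.
  apply: (@sub_finite_set _ _ ((fun x : X => dcoset H (rrepr x)) @` [set` F n])).
    move=> _ [g /= + <-]; rewrite /fn; case: asboolP; last by rewrite eqxx.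
    move=> [x xF [h Hh [k Hk <-]]] _; exists x => //.
    by rewrite eq_dcoset.
  by apply: finite_image; exact: finite_fset.
have diff n x : weighted_fun s f x - weighted_fun s (fn n) x =
    if `[< exists2 y, y \in F n & dcoset H (rrepr y) (rrepr x) >] then 0 else eta x.
  by rewrite /weighted_fun /fn; case: asboolP => _; rewrite ?subrr// mul0r subr0.
have /choice[en hen] n : exists xi, xi = weighted_fun s (fn n) :> (X -> C).
  have h : weighted_fun s (fn n) \in @square_summable R X.
    apply: (square_summable_mono _ ss) => x; rewrite /weighted_fun /fn.
    by case: asboolP => // _; rewrite mul0r Normc.normc0 normc_ge0.
  by exists (Ell2 h).
have cen : converges (@ell2_norm R X) en eta.
  move=> e /hF[N hN]; exists N => n /hN; apply: le_lt_trans.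
  rewrite (zn_distC zE) (zn_distC zE (truncation _ _)).
  apply: ell2_norm_mono => x.
  rewrite -[X in normc X <= _]/(eta x - en n x) -[X in _ <= normc X]/(eta x - truncation eta (F n) x).
  rewrite hen truncationE diff; case: asboolP => [_|nF].
    by rewrite Normc.normc0 normc_ge0.
  rewrite ifF ?subr0//; apply/negP => xF; apply: nF; exists x => //.
  exact: (dcoset_refl hH).
have bnd m n : bnorm (lambda H (fn m) - lambda H (fn n)) <= C0 * ell2_norm (en m - en n).
  have [hd <-] := lambdaB (hfn m) (hfn n).
  have := RD _ hd; rewrite (@weighted_normE _ _ (en m - en n)) ?lee_fin//.
  apply/funext => x; rewrite -[LHS]/(en m x - en n x) !hen.
  by rewrite /weighted_fun mulrBl.
have [|a ha] := @bop_complete R X (fun n => lambda H (fn n)).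
  move=> e e0; have [|N hN] := converges_cauchy zE cen (e := e / C0); first by rewrite divr_gt0.
  exists N => m n Nm Nn; apply: le_lt_trans (bnd m n) _.
  by rewrite mulrC -ltr_pdivlMr//; exact: hN.
exists a.
  apply/reducedP => //; exists (fun n => lambda H (fn n)) => // n.
  exact: hecke_operator_lambda.
apply/funext => g; apply: (@converges_unique _ _ _ (normc_zmod R) (fun n => fn n g)).
  apply: converges_ext (ell2_converges_at (rclass g) (bop_converges_at (delta R x0) ha)) => n.
  by rewrite -[LHS]/(symbol _ g) symbol_lambda.
(* The weight is at least 1, so convergence of the weighted values forces that of the values
   themselves. *)
move=> e /(ell2_converges_at (rclass g) cen)[N hN]; exists N => n /hN.
rewrite hen /= /weighted_fun -mulrBl Normc.normcM normc_real ?powR_ge0//.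
rewrite !bi_invariant_repr//; [|exact: length_bi_invariant|by case: (hfn n)].
apply: le_lt_trans; rewrite ler_peMr ?normc_ge0//.
by rewrite -[leLHS](powRr0 (1 + L g)); apply: ler_powR; [exact: one_le_weight|exact: ltW].
Qed.

End RapidDecayRepresentation.

(** * Rapidly decreasing operators and commutators *)

Lemma iter_derive_family (B : pzRingType) (I : Type) (d : I -> B -> B) (a : I -> B) j i :
  iter j (derive_family d) a i = iter j (d i) (a i).
Proof. by elim: j => [//|j IH]; rewrite !iterS -IH. Qed.

Section RapidOperators.
Variables (R : realType) (G : groupType) (H : set G) (L : G -> R).
Hypotheses (hH : hecke_pair H) (hL : length_function H L) (hRD : property_RD H L).
Local Notation C := R[i].
Local Notation X := (rcosets H).
Local Notation ell2 := (ell2 R X).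
Local Notation B := (bop ell2).
Local Notation rclass := (rclass H).
Local Notation x0 := (rclass 1%g).
Local Notation A := (reduced_hecke_algebra R H).
Local Notation S := (rapid_operators H L).
Local Notation bnorm := (@bnorm R X).
Local Notation l x := (L (rrepr x)).
Implicit Types (xi eta : ell2) (T a b : B) (g h : G) (x y : X) (f : G -> C) (k n : nat).

Let sH : subgroup H := hH.1.
Let bR := bnorm_ring R X.
Let L0 := length_ge0 hL.

Lemma finite_support_summable (u : X -> C) :
  finite_set [set x | u x != 0] -> u \in @square_summable R X.
Proof.
set F := [set x | _] => finF; rewrite inE.
apply: (@le_lt_trans _ _ (\sum_(x <- fset_set F) normc (u x) ^+ 2)%:E); last exact: ltry.
apply/esum_fset_le => [x|K]; first exact: sqr_ge0.
rewrite (big_fsetID _ (mem (fset_set F)))/= [X in _ + X]big1_fset => [|x].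
  rewrite addr0; apply: ler_sum_fsubset => [|x]; last exact: sqr_ge0.
  by apply/fsubsetP => x; rewrite !inE/= => /andP[].
rewrite !inE/= in_fset_set// => /andP[_ xF] _.
have -> : u x = 0 by apply/eqP; apply: contraNT xF => h; exact: mem_set.
by rewrite Normc.normc0 expr0n.
Qed.

Lemma rapid_operatorsE a : S a <-> A a /\ rapidly_decreasing H L (symbol a).
Proof.
split=> [[f rf /representsP[Aa fa]]|[Aa ra]]; first by rewrite fa.
by exists (symbol a) => //; apply/representsP.
Qed.

Lemma hecke_rapid T : hecke_operator T -> S T.
Proof.
move=> hT; apply/rapid_operatorsE; split; first exact: reduced_hecke.
apply/rapidP => //; split; first exact: symbol_bi_invariant hT.1.
move=> n; apply: finite_support_summable; apply: sub_finite_set hT.2 => x /=.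
apply: contra => /eqP e; rewrite /weighted_pow /symbol rreprK// e mul0r.
by [].
Qed.

Lemma rapid_dense a : A a -> forall e, 0 < e -> exists2 s, S s & bnorm (a - s) < e.
Proof.
move=> /(reducedP hH)[u hu ua] e /ua[N /(_ N (leqnn N)) hN].
exists (u N); first exact: hecke_rapid.
by rewrite (zn_distC bR.1).
Qed.

Definition truncated_length (n : nat) x : R := Num.min (l x) n%:R.

Lemma truncated_length_le n x : `|truncated_length n x| <= n%:R.
Proof.
by rewrite /truncated_length ger0_norm ?le_min ?L0 ?ler0n// ge_min lexx orbT.
Qed.

Lemma truncated_length_ops : exists D : nat -> B, forall n,
  (forall xi x, D n xi x = (truncated_length n x)%:C%C * xi x) /\
  Defs.adjoint (D n) (D n).
Proof.
have /choice[D hD] n : exists D : B,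
    (forall xi x, D xi x = (truncated_length n x)%:C%C * xi x) /\ Defs.adjoint D D.
  by have [D DE DD] := diagonal_ex (truncated_length_le n); exists D.
by exists D.
Qed.

Lemma length_sub_le g h : `|L g - L h| <= L (g * h^-1)%g.
Proof.
have [_ LM LV _ _] := hL.
have := LM (g * h^-1)%g h; have := LM (h * g^-1)%g g; rewrite !mulgVK.
rewrite -(LV (h * g^-1)%g) invgM invgK ler_norml => ? ?; apply/andP; split; lra.
Qed.

(** Both L and min(., n) are Lipschitz with constant 1. The bound does not contain [n], which is
    what makes the commutators uniformly bounded. *)
Lemma truncated_length_lip n x y :
  `|truncated_length n x - truncated_length n y| <= L (rrepr x * (rrepr y)^-1)%g.
Proof.
apply: le_trans (length_sub_le _ _); rewrite /truncated_length.
have n0 : (0 : R) <= n%:R by [].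
rewrite !minEle ler_norml.
have h1 := ler_norm (l x - l y).
have h2 : l y - l x <= `|l x - l y| by rewrite distrC ler_norm.
by case: (leP (l x) n%:R) => ?; case: (leP (l y) n%:R) => ?; apply/andP; split; lra.
Qed.

Section Tameness.
Variable D : nat -> B.
Hypothesis DE : forall n xi x, D n xi x = (truncated_length n x)%:C%C * xi x.
Hypothesis DD : forall n, Defs.adjoint (D n) (D n).

Let d n : B -> B := commutator (D n).
Let dB n (a b : B) : d n (a - b) = d n a - d n b := commutatorB (D n) a b.
Let dM n (a b : B) : d n (a * b) = d n a * b + a * d n b := commutatorM (D n) a b.

Definition tame_operator a := forall k, tame bnorm d k (fun=> a).

Lemma tame_operatorP a : tame_operator a <->
  forall k, exists M, forall n, bnorm (iter k (d n) a) <= M.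
Proof.
split=> [ta k|h k].
  have [M hM] := (tame_iter bnorm d k (fun=> a)).2 (ta k) k (leqnn k).
  by exists M => n; have := hM n; rewrite iter_derive_family.
apply/tame_iter => j _; have [M hM] := h j; exists M => n.
by rewrite iter_derive_family; exact: hM.
Qed.

Lemma rapid_tame a : S a -> tame_operator a.
Proof.
move=> /rapid_operatorsE[Aa ra]; apply/tame_operatorP => k.
have ea := reduced_equivariant hH Aa.
have /(rapidP hL)[bf fss] := ra; set f := symbol a in ra bf fss.
(* This is again rapidly decreasing, because its weight of order [n] is dominated by the weight of
   order [k + n] of [f]. The operator [c] that it represents has nonnegative coefficients, as
   [domination] requires. *)
pose fk g : C := (L g ^+ k * normc (f g))%:C%C.
have [|c Ac cf] := rapid_represented hH hL hRD (f := fk).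
  apply/rapidP => //; split=> [h k' g Hh Hk|n].
    by rewrite /fk bf// (length_bi_invariant hH hL).
  apply: (square_summable_mono _ (fss (k + n)%N)) => x.
  rewrite /weighted_pow /fk !Normc.normcM !normc_real ?mulr_ge0 ?exprn_ge0 ?normc_ge0//;
    try by rewrite addr_ge0.
  rewrite exprD [leLHS]mulrAC [_ * normc _]mulrC ler_wpM2l ?normc_ge0//.
  rewrite ler_wpM2r ?exprn_ge0 ?addr_ge0// lerXn2r ?nnegrE ?addr_ge0//.
  by rewrite lerDr.
have ec := reduced_equivariant hH Ac.
exists (bnorm c) => n.
apply: (@domination _ _ _ _ (fun x y => L (rrepr x * (rrepr y)^-1)%g ^+ k *
    normc (f (rrepr x * (rrepr y)^-1)%g))) => x y.
  by rewrite symbol_coef_repr// cf.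
rewrite (iter_commutator_delta _ _ _ _ (DE n)) Normc.normcM symbol_coef_repr//.
rewrite ler_wpM2r ?normc_ge0//.
rewrite /= expr0n addr0 sqrtr_sqr normrX lerXn2r ?nnegrE//.
exact: truncated_length_lip.
Qed.

Lemma tame_rapid a : A a -> tame_operator a -> S a.
Proof.
move=> Aa /tame_operatorP ta; apply/rapid_operatorsE; split=> //.
have ea := reduced_equivariant hH Aa.
apply/rapidP => //; split; first exact: symbol_bi_invariant.
set f := symbol a => n.
have [_ _ _ _ LH] := hL.
have lx0 : l x0 = 0.
  by have [h Hh ->] := rreprE hH 1%g; rewrite mulg1 LH.
(* On a finite set [K] of cosets a large truncation agrees with the length, and the base coset has
   length 0. So the k-th commutator applied to its delta has the values [l x ^+ k * f x] on [K],
   with a norm bound independent of [K]. *)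
have fl k : (fun x => f (rrepr x) * (l x ^+ k)%:C%C) \in @square_summable R X.
  have [M hM] := ta k; rewrite inE.
  pose d0 := ell2_norm (delta R x0).
  have M0 : 0 <= M by apply: le_trans (hM 0%N); exact: bnorm_ge0.
  apply: (@le_lt_trans _ _ ((M * d0) ^+ 2)%:E); last exact: ltry.
  apply/esum_fset_le => [x|K]; first exact: sqr_ge0.
  pose N := (\max_(x <- K) (Num.truncn (l x)).+1)%N.
  have lN x : x \in K -> truncated_length N x = l x.
    move=> xK; apply/min_idPl; apply/ltW; apply: lt_le_trans (truncnS_gt _) _.
    by rewrite ler_nat; exact: (@leq_bigmax_seq _ _ _ (fun x => (Num.truncn (l x)).+1)).
  have tr0 : truncated_length N x0 = 0.
    by rewrite /truncated_length lx0; apply/min_idPl.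
  apply: (@le_trans _ _ (ell2_norm (iter k (d N) a (delta R x0)) ^+ 2)); last first.
    rewrite lerXn2r ?nnegrE ?mulr_ge0 ?ell2_norm_ge0//.
    by apply: le_trans (bnormP _ _) _; rewrite ler_wpM2r ?ell2_norm_ge0.
  apply: le_trans (ell2_sum_le _ K); rewrite big_seq [leRHS]big_seq.
  apply: ler_sum => x xK; rewrite (iter_commutator_delta _ _ _ _ (DE N)) tr0 subr0 lN//.
  by rewrite /f /symbol (rreprK sH) mulrC.
(* The majorant comes from [(1 + l) ^ n <= 2 ^ n * (1 + l ^ n)], checked separately for [l <= 1] and
   [l > 1]. *)
have h : (2 ^+ n)%:C%C *: ((fun x => f (rrepr x) * (l x ^+ 0)%:C%C) +
    (fun x => f (rrepr x) * (l x ^+ n)%:C%C)) \in @square_summable R X.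
  by apply: rpredZ; apply: rpredD.
apply: (square_summable_mono _ h) => x.
rewrite -[X in _ <= normc X]/((2 ^+ n)%:C%C * (f (rrepr x) * (l x ^+ 0)%:C%C +
  f (rrepr x) * (l x ^+ n)%:C%C)) -mulrDr -rmorphD mulrCA -rmorphM/=.
have p0 : 0 <= l x ^+ n by rewrite exprn_ge0.
rewrite !Normc.normcM !normc_real ?exprn_ge0 ?addr_ge0// ?mulr_ge0 ?exprn_ge0 ?addr_ge0//.
rewrite ler_wpM2l ?normc_ge0// expr0.
have [l1|l1] := leP (l x) 1.
  apply: (@le_trans _ _ (2 ^+ n)); last by rewrite ler_peMr ?exprn_ge0// lerDl.
  by rewrite lerXn2r ?nnegrE ?addr_ge0//; have := L0 (rrepr x); lra.
apply: (@le_trans _ _ ((2 * l x) ^+ n)).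
  by rewrite lerXn2r ?nnegrE ?addr_ge0 ?mulr_ge0//; lra.
by rewrite exprMn ler_wpM2l ?exprn_ge0// lerDr.
Qed.

Lemma rapid_iff_tame a : S a <-> A a /\ tame_operator a.
Proof.
split=> [Sa|[]]; last exact: tame_rapid.
by split; [case/rapid_operatorsE: Sa|exact: rapid_tame].
Qed.

Lemma rapid_subring : set_subring S.
Proof.
have [A1 AB AM] := @reduced_subring R G H hH.
split.
- by apply/rapid_iff_tame; split=> // k; exact: tame1.
- move=> a b /rapid_iff_tame[Aa ta] /rapid_iff_tame[Ab tb].
  by apply/rapid_iff_tame; split=> [|k]; [exact: AB|exact: (tameB bR dB (ta k) (tb k))].
- move=> a b /rapid_iff_tame[Aa ta] /rapid_iff_tame[Ab tb].
  by apply/rapid_iff_tame; split=> [|k]; [exact: AM|exact: (tameM bR dB dM (ta k) (tb k))].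
Qed.

Lemma rapid_scale (c : C) a : S a -> S (c *: a).
Proof.
move=> Sa; have [_ _ SM] := rapid_subring.
have -> : c *: a = ((c *: (1 : B)) : B) * a by exact: val_inj.
by apply: SM => //; apply: hecke_rapid; apply: hecke_operatorZ; exact: hecke_operator1.
Qed.

(** For self-adjoint [T] the adjoint of a commutator is minus the commutator of the adjoint. The
    sign after [k] steps is irrelevant for the norm, so the induction keeps it as an alternative. *)
Lemma iter_commutator_adjoint T a b k : Defs.adjoint T T -> Defs.adjoint a b ->
  bnorm (iter k (commutator T) b) = bnorm (iter k (commutator T) a).
Proof.
move=> TT ab.
have N c : commutator T (- c) = - commutator T c.
  by have := commutatorB T 0 c; rewrite /commutator mulr0 mul0r subrr !sub0r.
suff [s [hs [->|e]]] : exists s, Defs.adjoint (iter k (commutator T) a) s /\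
    (iter k (commutator T) b = s \/ iter k (commutator T) b = - s).
- exact: adjoint_norm.
- by rewrite e (zn_N bR.1); exact: adjoint_norm.
elim: k => [|k [s [hs e]]]; first by exists b; split => //; left.
exists (- commutator T s); split; first exact: commutator_adjoint.
by case: e => /= ->; [right; rewrite opprK|left; rewrite N].
Qed.

Lemma rapid_adjoint a : S a -> exists2 b, S b & Defs.adjoint a b.
Proof.
move=> /rapid_iff_tame[Aa ta]; have [b Ab ab] := reduced_adjoint hH Aa.
exists b => //; apply/rapid_iff_tame; split=> //; apply/tame_operatorP => k.
have [M hM] := (tame_operatorP a).1 ta k; exists M => n.
by rewrite (iter_commutator_adjoint _ (DD n) ab); exact: hM.
Qed.

Lemma rapid_mx_inverse n (M W : 'M[B]_n) : mx_in S M -> mx_in A W ->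
  W * M = 1 -> M * W = 1 -> mx_in S W.
Proof.
move=> SM AW WM MW i j; apply/rapid_iff_tame; split; first exact: AW.
move=> k; have tM : tame (@mxnorm _ _ bnorm n n) (mx_derive d (n := n)) k (fun=> M).
  by apply/tame_mx => // a b; have /rapid_iff_tame[_] := SM a b; apply.
have bW : uniformly_bounded (@mxnorm _ _ bnorm n n) (fun _ : nat => W).
  by exists (mxnorm bnorm W).
have tW := tame_inv (mxnorm_ring bR n) (mx_deriveB dB (n := n)) (mx_deriveM dB dM (n := n))
  (b := fun=> W) (fun=> conj WM MW) bW tM.
exact: (tame_mx bR d k (fun=> W)).1 tW i j.
Qed.

Lemma rapid_mx_idempotent n (b q : 'M[B]_n) : mx_in S b -> mx_in A q ->
  q * q = q -> q * b = b * q ->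
  4 * mxnorm bnorm (2 * q - 1) * mxnorm bnorm (b - q) <= 1 -> mx_in S q.
Proof.
move=> Sb Aq qq qb small i j; apply/rapid_iff_tame; split; first exact: Aq.
move=> k; have tb k' : tame (@mxnorm _ _ bnorm n n) (mx_derive d (n := n)) k' (fun=> b).
  by apply/tame_mx => // u v; have /rapid_iff_tame[_] := Sb u v; apply.
have tq := tame_idempotent (mxnorm_ring bR n) (mx_deriveB dB (n := n))
  (mx_deriveM dB dM (n := n)) k qq qb small tb.
exact: (tame_mx bR d k (fun=> q)).1 tq i j.
Qed.

End Tameness.
End RapidOperators.

(** * Riemann sums on the unit interval *)

Section UnitInterval.
Variables (R : realType) (V : zmodType) (nu : V -> R).
Hypothesis nuP : zmod_norm nu.
Implicit Types (phi : R -> V) (s t e d : R).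

Definition unit_continuous phi := forall t, 0 <= t <= 1 -> forall e, 0 < e ->
  exists2 d, 0 < d & forall s, 0 <= s <= 1 -> `|s - t| < d -> nu (phi s - phi t) < e.

(** Compactness in the form: what holds near each point for all small parameters holds everywhere
    for one parameter. It yields both uniform continuity and boundedness. *)
Lemma unit_covering (P : R -> R -> Prop) :
  (forall t, 0 <= t <= 1 -> exists2 d, 0 < d & forall s e, 0 <= s <= 1 ->
     `|s - t| < d -> 0 < e -> e < d -> P e s) ->
  exists2 e, 0 < e & forall s, 0 <= s <= 1 -> P e s.
Proof.
move=> h.
have cpt : compact (`[0, 1]%classic : set R) by exact: segment_compact.
have cov := (compact_near_coveringP _).1 cpt R (0^'+)
  (fun e s => 0 <= s <= 1 -> P e s) _.
have [e [e0 eP]] : exists e, 0 < e /\ `[0, 1]%classic `<=` (fun s => 0 <= s <= 1 -> P e s).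
  have /cov C : forall x : R, `[0, 1]%classic x ->
      \forall x' \near x & i \near 0^'+, 0 <= x' <= 1 -> P i x'.
    move=> t; rewrite /= in_itv/= => /h[d d0 hd].
    exists (ball t d, [set i | 0 < i < d]) => /=.
      split; first exact: nbhsx_ballx.
      by near=> i; apply/andP; split=> //; near: i; exact: nbhs_right_lt.
    move=> [s i] /= [ts /andP[i0 id]] s01; apply: hd => //.
    by rewrite distrC; move: ts; rewrite -ball_normE.
  near (0 : R)^'+ => e; exists e; split => //.
  by near: e; exact: C.
by exists e => // s s01; apply: eP => //; rewrite /= in_itv.
Unshelve. all: by end_near. Qed.

Lemma unit_uniform phi : unit_continuous phi -> forall e, 0 < e ->
  exists2 d, 0 < d & forall s t, 0 <= s <= 1 -> 0 <= t <= 1 -> `|s - t| < d ->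
    nu (phi s - phi t) < e.
Proof.
move=> cphi e e0.
have [|d d0 hd] := @unit_covering (fun d s => forall t, 0 <= t <= 1 -> `|s - t| < d ->
    nu (phi s - phi t) < e).
  move=> t t01; have e2 : 0 < e / 2 by rewrite divr_gt0.
  have [d d0 hd] := cphi t t01 _ e2; have d2 : 0 < d / 2 by rewrite divr_gt0.
  exists (d / 2) => // s d' s01 st d'0 d'd s' s'01 ss'.
  apply: le_lt_trans (zn_distD nuP (phi t) _ _) _; rewrite [e]splitr; apply: ltrD.
    by apply: hd => //; lra.
  rewrite (zn_distC nuP); apply: hd => //.
  have := ler_distD s s' t; rewrite (distrC s' s); lra.
by exists d => // s t s01 t01; apply: hd.
Qed.

Lemma unit_bounded phi : unit_continuous phi ->
  exists M, forall t, 0 <= t <= 1 -> nu (phi t) <= M.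
Proof.
move=> cphi.
(* The bound is phrased as an inverse, so that a large bound becomes a small parameter. *)
have [|d d0 hd] := @unit_covering (fun d s => nu (phi s) <= d^-1).
  move=> t t01; have [d d0 hd] := cphi t t01 1 ltr01.
  pose M := nu (phi t) + 1; have M0 : 0 < M by rewrite ltr_wpDl// (zn_ge0 nuP).
  exists (Num.min d M^-1); first by rewrite lt_min d0 invr_gt0.
  move=> s e s01; rewrite lt_min => /andP[sd _] e0; rewrite lt_min => /andP[_ eM].
  apply: le_trans (_ : M <= _); last by rewrite -[M]invrK lef_pV2 ?posrE ?invr_gt0// ltW.
  have h1 := hd s s01 sd; apply: le_trans (zn_sub_le nuP _ (phi t)) _.
  by rewrite lerD2l ltW.
by exists d^-1.
Qed.

End UnitInterval.

Section RiemannSums.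
Variables (R : realType) (V : lmodType R[i]) (nu : V -> R).
Local Notation C := R[i].
Hypotheses (nuP : zmod_norm nu) (nuZ : forall (c : C) x, nu (c *: x) = normc c * nu x).
Implicit Types (phi : R -> V).

Definition unit_riemann phi n : V := \sum_(k < n) (n%:R^-1 : C) *: phi (k%:R / n%:R).

Lemma sum_ord_mul (g : nat -> V) n m :
  \sum_(j < n * m) g j = \sum_(k < n) \sum_(i < m) g (k * m + i)%N.
Proof.
elim: n => [|n IH]; first by rewrite !big_ord0.
rewrite big_ord_recr/= -IH -!(big_mkord xpredT) mulSnr (@big_cat_nat _ _ _ (n * m)) ?leq_addr//=.
congr (_ + _); rewrite -{1}[(n * m)%N]add0n big_addn addKn big_mkord.
by apply: eq_bigr => i _; rewrite addnC.
Qed.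

Lemma normc_nat_inv n : normc (n%:R^-1 : C) = n%:R^-1.
Proof.
have -> : (n%:R^-1 : C) = (n%:R^-1 : R)%:C%C by rewrite fmorphV rmorph_nat.
by rewrite normc_real ?invr_ge0.
Qed.

Lemma unit_riemann_le phi n (M : R) : (forall t, 0 <= t <= 1 -> nu (phi t) <= M) ->
  nu (unit_riemann phi n) <= M.
Proof.
move=> h; have M0 : 0 <= M by apply: le_trans (zn_ge0 nuP _) (h 0 _); rewrite lexx ler01.
apply: le_trans (zn_sum nuP _ _ _) _.
apply: (@le_trans _ _ (\sum_(k < n) (n%:R^-1 * M))).
  apply: ler_sum => k _; rewrite nuZ normc_nat_inv ler_wpM2l ?invr_ge0//; apply: h.
  have n0 : (0 < n)%N by apply: leq_ltn_trans (ltn_ord k).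
  by rewrite divr_ge0//= ler_pdivrMr ?ltr0n// mul1r ler_nat ltnW.
rewrite sumr_const card_ord -[leLHS]mulr_natl mulrA.
case: n => [|n]; first by rewrite mul0r mul0r.
by rewrite divff ?pnatr_eq0// mul1r.
Qed.

(** Each node of the finer partition lies within [1 / n] of the coarse node that starts its
    interval, so corresponding values differ by less than [e]. *)
Lemma unit_riemann_refine phi (e d : R) n m : 0 < e ->
  (forall s t, 0 <= s <= 1 -> 0 <= t <= 1 -> `|s - t| < d -> nu (phi s - phi t) < e) ->
  n%:R^-1 < d -> (0 < n)%N -> (0 < m)%N ->
  nu (unit_riemann phi n - unit_riemann phi (n * m)) <= e.
Proof.
move=> e0 h nd n0 m0.
have n0' : 0 < n%:R :> R by rewrite ltr0n.
have m0' : 0 < m%:R :> R by rewrite ltr0n.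
pose c : C := (n * m)%:R^-1.
have -> : unit_riemann phi n = \sum_(k < n) \sum_(i < m) c *: phi (k%:R / n%:R).
  apply: eq_bigr => k _; rewrite sumr_const card_ord -[RHS]scaler_nat scalerA; congr (_ *: _).
  by rewrite /c natrM invfM mulrCA divff ?mulr1// pnatr_eq0 -lt0n.
rewrite /unit_riemann (sum_ord_mul (fun j => c *: phi (j%:R / (n * m)%:R))) -sumrB.
apply: le_trans (zn_sum nuP _ _ _) _.
apply: (@le_trans _ _ (\sum_(k < n) \sum_(i < m) ((n * m)%:R^-1 * e))).
  apply: ler_sum => k _; rewrite -sumrB; apply: le_trans (zn_sum nuP _ _ _) _.
  apply: ler_sum => i _; rewrite -scalerBr nuZ normc_nat_inv ler_wpM2l ?invr_ge0//.
  have kn : (k * m + i < n * m)%N.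
    apply: (@leq_trans (k.+1 * m)); first by rewrite mulSnr ltn_add2l.
    by rewrite leq_mul2r ltn_ord orbT.
  have nm0 : 0 < (n * m)%:R :> R by rewrite ltr0n muln_gt0 n0.
  apply/ltW/h.
  - by rewrite divr_ge0//= ler_pdivrMr// mul1r ler_nat ltnW.
  - by rewrite divr_ge0//= ler_pdivrMr// mul1r ler_nat ltnW.
  - have -> : k%:R / n%:R - (k * m + i)%:R / (n * m)%:R = - (i%:R / m%:R / n%:R) :> R.
      by rewrite natrD !natrM; field; rewrite !gt_eqF.
    rewrite normrN ger0_norm ?divr_ge0//; apply: le_lt_trans nd.
    by rewrite ler_piMl ?invr_ge0// ler_pdivrMr// mul1r ler_nat ltnW.
rewrite !sumr_const !card_ord -mulrnA -[leLHS]mulr_natl mulrA [(m * n)%N]mulnC divff ?mul1r//.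
by rewrite pnatr_eq0 muln_eq0 negb_or -!lt0n n0.
Qed.

(** The sums of sizes [m] and [n] are both compared with their common refinement of size [m * n];
    the integral itself never has to be known. *)
Lemma unit_riemann_cauchy phi : unit_continuous nu phi -> norm_cauchy nu (unit_riemann phi).
Proof.
move=> cphi e e0; have e2 : 0 < e / 3 by rewrite divr_gt0.
have [d d0 hd] := unit_uniform nuP cphi e2.
exists (Num.truncn d^-1).+1 => m n Nm Nn.
have key p : (Num.truncn d^-1 < p)%N -> p%:R^-1 < d /\ (0 < p)%N.
  move=> Np; have p0 : (0 < p)%N by apply: leq_ltn_trans Np.
  split=> //; rewrite invf_plt ?posrE ?ltr0n//; apply: lt_le_trans (truncnS_gt _) _.
  by rewrite ler_nat.
have [md m0] := key m Nm; have [nd n0] := key n Nn.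
have h1 := unit_riemann_refine e2 hd md m0 n0.
have h2 := unit_riemann_refine e2 hd nd n0 m0.
rewrite mulnC (zn_distC nuP) in h2.
apply: le_lt_trans (zn_distD nuP (unit_riemann phi (m * n)) _ _) _.
by apply: le_lt_trans (lerD h1 h2) _; lra.
Qed.

End RiemannSums.

(** * Resolvents and contour integrals *)

Section Calculus.
Variables (R : realType) (X : choiceType).
Local Notation C := R[i].
Local Notation ell2 := (ell2 R X).
Local Notation B := (bop ell2).
Local Notation bnorm := (@bnorm R X).
Implicit Types (a b T : B) (z w : C) (e : C * C).

Let bR := bnorm_ring R X.
Let bP := bR.1.

Lemma bop_mulZr T (c : C) a : T * (c *: a) = c *: (T * a).
Proof.
by apply/val_inj/funext => xi /=; rewrite linearZ.
Qed.

Lemma bop_mulZl T (c : C) a : (c *: a) * T = c *: (a * T).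
Proof. exact: val_inj. Qed.

Lemma commutatorZ T (c : C) a : commutator T (c *: a) = c *: commutator T a.
Proof. by rewrite /commutator bop_mulZr bop_mulZl scalerBr. Qed.

Lemma iter_commutatorB T k a b :
  iter k (commutator T) (a - b) = iter k (commutator T) a - iter k (commutator T) b.
Proof. by elim: k => //= k ->; rewrite commutatorB. Qed.

Lemma iter_commutatorZ T k (c : C) a :
  iter k (commutator T) (c *: a) = c *: iter k (commutator T) a.
Proof. by elim: k => //= k ->; rewrite commutatorZ. Qed.

Lemma iter_commutator0 T k : iter k (commutator T) 0 = 0.
Proof. by have := iter_commutatorB T k 0 0; rewrite !subrr. Qed.

Lemma iter_commutatorD T k a b :
  iter k (commutator T) (a + b) = iter k (commutator T) a + iter k (commutator T) b.
Proof.
have := iter_commutatorB T k a (- b).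
have := iter_commutatorB T k 0 b.
by rewrite opprK iter_commutator0 !sub0r => -> ->; rewrite opprK.
Qed.

Lemma iter_commutator_converges T k u a : converges bnorm u a ->
  converges bnorm (fun n => iter k (commutator T) (u n)) (iter k (commutator T) a).
Proof.
move=> ua; elim: k => [//|k IH].
have h := convergesB bP (converges_mull bR T IH) (converges_mulr bR T IH).
exact: h.
Qed.

Section Resolvent.
Variables (A : set B) (a : B).

Lemma resolventP z : ~ spectrum A a z ->
  [/\ A (resolvent A a z), resolvent A a z * (z *: (1 : B) - a) = 1 &
    (z *: (1 : B) - a) * resolvent A a z = 1].
Proof.
move=> /contrapT[b Ab [ba ab]].
have [] := @xgetI _ (0 : B) [set b | A b /\
  (b * (z *: (1 : B) - a) = 1 /\ (z *: (1 : B) - a) * b = 1)] b (conj Ab (conj ba ab)).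
by move=> Ar [ra ar]; split.
Qed.

Lemma resolvent_sub z w : ~ spectrum A a z -> ~ spectrum A a w ->
  resolvent A a z - resolvent A a w =
  (w - z) *: (resolvent A a z * resolvent A a w).
Proof.
move=> /resolventP[_ rz _] /resolventP[_ _ rw].
have -> : resolvent A a z - resolvent A a w =
    resolvent A a z * ((w *: (1 : B) - a) - (z *: (1 : B) - a)) * resolvent A a w.
  by rewrite mulrBr mulrBl -mulrA rw mulr1 rz mul1r.
by rewrite opprB addrA subrK -scalerBl bop_mulZr mulr1 bop_mulZl.
Qed.

Lemma resolvent_continuous w d : ~ spectrum A a w -> 0 < d ->
  exists2 r, 0 < r & forall z, ~ spectrum A a z -> normc (z - w) < r ->
    bnorm (resolvent A a z - resolvent A a w) < d.
Proof.
move=> sw d0; set rw := resolvent A a w.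
pose M := bnorm rw + 1; have M0 : 0 < M by rewrite ltr_wpDl ?bnorm_ge0.
have hM : bnorm rw <= M by rewrite lerDl.
(* By the resolvent identity the difference is at most [t] times the product of the two norms, with
   [t] the distance from [z] to [w]. The first bound on [t] gives norm at most [2 * M] for the
   resolvent at [z]; the second then makes the difference smaller than [d]. *)
exists (Num.min (2 * M)^-1 (d / (2 * M * M))).
  by rewrite lt_min invr_gt0 divr_gt0 ?mulr_gt0.
move=> z sz; rewrite lt_min => /andP[z1 z2].
have aux (x y t D : R) : 0 <= x -> 0 <= y -> 0 <= t -> y <= M -> D <= t * (x * y) ->
    x <= y + D -> t * (2 * M) < 1 -> t * (2 * M * M) < d -> D < d.
  move=> x0 y0 t0 yM Dt xy tM td.
  have ty : 2 * (t * y) <= 1 by nra.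
  have Dx : 2 * D <= x by nra.
  have Dy : D <= t * (2 * M * M) by have : x * y <= 2 * M * M; nra.
  exact: le_lt_trans Dy td.
apply: (aux (bnorm (resolvent A a z)) (bnorm rw) (normc (z - w))) => //.
- exact: bnorm_ge0.
- exact: bnorm_ge0.
- exact: normc_ge0.
- rewrite resolvent_sub// bnormZ (zn_distC (normc_zmod R)) ler_wpM2l ?normc_ge0//.
  exact: bnormM.
- exact: zn_sub_le.
- by rewrite -ltr_pdivlMr ?mulr_gt0// div1r.
- by rewrite -ltr_pdivlMr ?mulr_gt0.
Qed.

End Resolvent.

Definition edge_path e (t : R) : C := e.1 + t%:C%C * (e.2 - e.1).

Lemma path_segment e t : 0 <= t <= 1 -> segment e (edge_path e t).
Proof. by move=> t01; exists t => //=; rewrite in_itv. Qed.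

Lemma path_continuous (V : zmodType) (nu : V -> R) (g : C -> V) e :
  (forall w, segment e w -> forall d, 0 < d -> exists2 r, 0 < r &
    forall z, segment e z -> normc (z - w) < r -> nu (g z - g w) < d) ->
  unit_continuous nu (fun t => g (edge_path e t)).
Proof.
move=> h t t01 d d0; have [r r0 hr] := h _ (path_segment e t01) _ d0.
have n1 : 0 < normc (e.2 - e.1) + 1 by rewrite ltr_wpDl ?normc_ge0.
exists (r / (normc (e.2 - e.1) + 1)); first by rewrite divr_gt0.
move=> s s01 st; apply: hr; first exact: path_segment.
have -> : edge_path e s - edge_path e t = (s - t)%:C%C * (e.2 - e.1).
  by rewrite /edge_path opprD addrACA subrr add0r -mulrBl -rmorphB.
rewrite Normc.normcM; move: st; rewrite ltr_pdivlMr// => st.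
apply: le_lt_trans st.
have -> : normc (s - t)%:C%C = `|s - t| by rewrite /= expr0n addr0 sqrtr_sqr.
by rewrite ler_wpM2l// lerDl.
Qed.

Lemma unit_continuousZ (f : R -> C) (r : R -> B) :
  unit_continuous (@normc R) f -> unit_continuous bnorm r ->
  unit_continuous bnorm (fun t => f t *: r t).
Proof.
move=> cf cr t t01 d d0.
pose M := normc (f t) + bnorm (r t) + 1.
have nf := normc_ge0 (f t); have nr := bnorm_ge0 (r t).
have M1 : 1 <= M by rewrite /M lerDr addr_ge0.
have M0 : 0 < M by apply: lt_le_trans M1.
pose q := Num.min 1 (d / (2 * M)).
have q0 : 0 < q by rewrite lt_min ltr01 divr_gt0 ?mulr_gt0.
have [d1 d10 h1] := cf t t01 q q0; have [d2 d20 h2] := cr t t01 q q0.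
exists (Num.min d1 d2); first by rewrite lt_min d10.
move=> s s01; rewrite lt_min => /andP[/(h1 s s01) fs /(h2 s s01) rs].
have -> : f s *: r s - f t *: r t = (f s - f t) *: r t + f s *: (r s - r t).
  by rewrite scalerBl scalerBr [RHS]addrC addrA subrK.
apply: le_lt_trans (zn_D bP _ _) _; rewrite !bnormZ.
have fsM : normc (f s) <= normc (f t) + q.
  apply: le_trans (zn_sub_le (normc_zmod R) _ (f t)) _; rewrite lerD2l; exact: ltW.
have q1 : q <= 1 by rewrite ge_min lexx.
have qd : q * (2 * M) <= d by rewrite -ler_pdivlMr ?mulr_gt0// ge_min lexx orbT.
have aux (x y a' b' : R) : 0 <= a' -> 0 <= b' -> x < q -> y < q -> 0 <= y -> a' + b' + 1 = M ->
    forall c', 0 <= c' -> c' <= a' + q -> x * b' + c' * y < d.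
  move=> a0 b0 xq yq y0 E c' c0 cq.
  have h3 : x * b' <= q * b' by nra.
  have h4 : c' * y <= (a' + 1) * q by nra.
  have : q * M < d; nra.
apply: (aux _ _ (normc (f t)) (bnorm (r t))) => //; [exact: bnorm_ge0|exact: normc_ge0].
Qed.

Lemma seq_bound (T : eqType) (s : seq T) (g : T -> R -> R) :
  (forall x, x \in s -> exists M, forall t, 0 <= t <= 1 -> g x t <= M) ->
  exists M, forall x, x \in s -> forall t, 0 <= t <= 1 -> g x t <= M.
Proof.
elim: s => [|x s IH] h; first by exists 0.
have [M hM] := h x (mem_head _ _).
have [|N hN] := IH; first by move=> y ys; apply: h; rewrite inE ys orbT.
exists (Num.max M N) => y; rewrite inE => /orP[/eqP ->|ys] t t01; rewrite le_max.
  by rewrite hM.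
by rewrite hN ?orbT.
Qed.

Lemma riemann_sumE (F : C -> B) Gamma n : riemann_sum F Gamma n =
  \sum_(e <- edges Gamma) (e.2 - e.1) *: unit_riemann (fun t => F (edge_path e t)) n.
Proof.
apply: eq_bigr => e _; rewrite scaler_sumr; apply: eq_bigr => k _.
by rewrite scalerA /edge_path rmorphM fmorphV !rmorph_nat.
Qed.

Lemma riemann_sum_converges (F : C -> B) Gamma :
  (forall e, e \in edges Gamma -> unit_continuous bnorm (fun t => F (edge_path e t))) ->
  exists v, converges bnorm (riemann_sum F Gamma) v.
Proof.
move=> h.
suff [v hv] : exists v, converges bnorm (fun n => \sum_(e <- edges Gamma)
    (e.2 - e.1) *: unit_riemann (fun t => F (edge_path e t)) n) v.
  by exists v; apply: converges_ext hv => n; rewrite riemann_sumE.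
elim: (edges Gamma) h => [|e s IH] h.
  by exists 0; apply: converges_ext (converges_cst bP 0) => n; rewrite big_nil.
have [|v hv] := IH; first by move=> e' e's; apply: h; rewrite inE e's orbT.
have [l hl] := bop_complete (unit_riemann_cauchy bP (@bnormZ R X) (h e (mem_head _ _))).
have c1 := converges_mull bR ((e.2 - e.1) *: (1 : B)) hl.
have c2 := convergesB bP c1 (convergesB bP (converges_cst bP 0) hv).
eexists; apply: converges_ext c2 => n.
by rewrite bop_mulZl mul1r sub0r opprK big_cons.
Qed.

Lemma converges_cvg u a : converges bnorm u a -> u @ \oo --> a.
Proof.
move=> ua; apply/cvgrPdist_lt => e e0.
have eR : e = (complex.Re e)%:C%C by rewrite RRe_real// gtr0_real.
have [|N hN] := ua (complex.Re e); first by rewrite -ltcR -eR.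
exists N => // n Nn; rewrite eR -[X in X < _]/((bnorm (a - u n))%:C%C) ltcR.
by rewrite (zn_distC bP); exact: hN.
Qed.

Lemma holomorphic_continuous (U : set C) (f : C -> C) w : holomorphic U f -> U w ->
  forall d, 0 < d -> exists2 r, 0 < r & forall z, normc (z - w) < r ->
    normc (f z - f w) < d.
Proof.
move=> hf Uw d d0.
have df : differentiable (f : C^o -> C^o) (w : C^o) by exact/derivable1_diffP/hf.
have /cvgrPdist_lt cf := differentiable_continuous df.
have [|r /= r0 hr] := (nbhs_ballP _ _).1 (cf d%:C%C _).
  by rewrite -(rmorph0 (real_complex R)) ltcR.
have rR : r = (complex.Re r)%:C%C by rewrite RRe_real// gtr0_real.
exists (complex.Re r); first by rewrite -ltcR -rR.
move=> z zw; have /= := hr z; rewrite -ball_normE /ball_/= !complex_normE rR !ltcR.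
by rewrite (zn_distC (normc_zmod R) w) (zn_distC (normc_zmod R) (f w)); apply.
Qed.

End Calculus.

(** * Holomorphic functional calculus *)

Section RapidCalculus.
Variables (R : realType) (G : groupType) (H : set G) (L : G -> R).
Hypotheses (hH : hecke_pair H) (hL : length_function H L) (hRD : property_RD H L).
Local Notation C := R[i].
Local Notation X := (rcosets H).
Local Notation B := (bop (ell2 R X)).
Local Notation A := (reduced_hecke_algebra R H).
Local Notation S := (rapid_operators H L).
Local Notation bnorm := (@bnorm R X).
Variable D : nat -> B.
Hypothesis DE : forall n xi x, D n xi x = (truncated_length L n x)%:C%C * xi x.

Let bR := bnorm_ring R X.
Let bP := bR.1.
Let d n : B -> B := commutator (D n).
Let dB n (a b : B) : d n (a - b) = d n a - d n b := commutatorB (D n) a b.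
Let dM n (a b : B) : d n (a * b) = d n a * b + a * d n b := commutatorM (D n) a b.

Variables (a : B) (U : set C) (f : C -> C) (Gamma : seq (seq C)).
Hypotheses (Sa : S a) (hf : holomorphic U f) (hG : surrounds Gamma (spectrum A a) U).

Let r z := resolvent A a z.
Let F z := f z *: r z.

Lemma segment_resolvent e z : e \in edges Gamma -> segment e z -> U z /\ ~ spectrum A a z.
Proof. by case: hG => seg _ _ eG ez; have [] := seg e eG z ez. Qed.

Lemma resolvent_path e : e \in edges Gamma ->
  unit_continuous bnorm (fun t => r (edge_path e t)).
Proof.
move=> eG; apply: path_continuous => w ew q q0.
have [_ sw] := segment_resolvent eG ew.
have [p p0 hp] := resolvent_continuous sw q0; exists p => // z ez.
by apply: hp; have [] := segment_resolvent eG ez.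
Qed.

Lemma function_path e : e \in edges Gamma ->
  unit_continuous (@normc R) (fun t => f (edge_path e t)).
Proof.
move=> eG; apply: path_continuous => w ew q q0.
have [Uw _] := segment_resolvent eG ew.
by have [p p0 hp] := holomorphic_continuous hf Uw q0; exists p => // z _; exact: hp.
Qed.

(** The points of the contour form a type so that the resolvents, paired with the truncation index,
    become one family; a single use of [tame_inv] then gives bounds uniform in both. *)
Definition contour : Type := {z : C | exists2 e, e \in edges Gamma &
  exists2 t, 0 <= t <= 1 & z = edge_path e t}.

Let dI (i : nat * contour) : B -> B := d i.1.
Let dIB i (a b : B) : dI i (a - b) = dI i a - dI i b := dB i.1 a b.
Let dIM i (a b : B) : dI i (a * b) = dI i a * b + a * dI i b := dM i.1 a b.

Lemma tame_resolvents k : tame bnorm dI k (fun i => r (sval i.2)).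
Proof.
apply: (tame_inv bR dIB dIM (a := fun i => sval i.2 *: (1 : B) - a)).
- move=> [n [z zP]] /=; have [e eG [t t01 ->]] := zP.
  have [_ sz] := segment_resolvent eG (path_segment e t01).
  by have [_ rz zr] := resolventP sz.
- have [|M hM] := @seq_bound R _ (edges Gamma) (fun e t => bnorm (r (edge_path e t))).
    by move=> e eG; exact: (unit_bounded bP (resolvent_path eG)).
  by exists M => -[n [z zP]] /=; have [e eG [t t01 ->]] := zP; exact: hM.
(* The scalars [z] are bounded on the contour and have zero commutators; the other term [a] is tame
   because it is rapidly decreasing. *)
apply: (tameB bR dIB).
  apply/tame_iter => j _.
  have [|M hM] := @seq_bound R _ (edges Gamma) (fun e t => normc (edge_path e t)).
    move=> e eG; apply: (unit_bounded (normc_zmod R)).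
    apply: (@path_continuous R C (@normc R) id) => w _ q q0.
    by exists q.
  exists (M * bnorm 1) => -[n [z zP]].
  rewrite iter_derive_family /dI /= iter_commutatorZ bnormZ.
  have zM : normc z <= M by have [e eG [t t01 ->]] := zP; exact: hM.
  apply: ler_pM; [exact: normc_ge0|exact: bnorm_ge0|exact: zM|].
  case: j => [//|j]; rewrite iterSr.
  by rewrite /commutator mulr1 mul1r subrr iter_commutator0 (zn_0 bP) bnorm_ge0.
apply/tame_iter => j _.
have [M hM] := (tame_operatorP D a).1 (rapid_tame hH hL hRD DE Sa) j.
by exists M => i; rewrite iter_derive_family; exact: hM.
Qed.

Lemma iter_commutator_riemann T k (phi : R -> B) n :
  iter k (commutator T) (unit_riemann phi n) =
  unit_riemann (fun t => iter k (commutator T) (phi t)) n.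
Proof.
rewrite /unit_riemann (big_morph _ (iter_commutatorD T k) (iter_commutator0 T k)).
by apply: eq_bigr => i _; rewrite iter_commutatorZ.
Qed.

(** Iterated commutators of a Riemann sum are Riemann sums of the commutators of the integrand. They
    are bounded by the lengths of the edges, the supremum of [f] and the bound on the resolvents,
    independently of the partition and of the truncation, so the bound survives in the limit. *)
Lemma rapid_calculus : exists2 b, holomorphic_calculus A a f Gamma b & S b.
Proof.
have [|v hv] := @riemann_sum_converges R X F Gamma.
  by move=> e eG; apply: unit_continuousZ; [exact: function_path|exact: resolvent_path].
have tpi : two_pi_i R != 0.
  rewrite eq_complex /= negb_and; apply/orP; right.
  by rewrite gt_eqF// mulr_gt0// pi_gt0.
have sA := @reduced_subring R G H hH.
have Av : A v.
  apply: (reduced_closed (u := riemann_sum F Gamma)) => [n|]; last exact: hv.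
  have [_ _ AM] := sA; rewrite /riemann_sum big_seq.
  apply: (set_subring_sum sA) => e eG; apply: (set_subring_sum sA) => k _.
  apply: (reducedZ hH); apply: (reducedZ hH).
  have e01 : segment e (e.1 + (k%:R / n%:R) * (e.2 - e.1)).
    have -> : e.1 + (k%:R / n%:R) * (e.2 - e.1) = edge_path e (k%:R / n%:R).
      by rewrite /edge_path rmorphM fmorphV !rmorph_nat.
    have n0 : (0 < n)%N by apply: leq_ltn_trans (ltn_ord k).
    apply: path_segment; rewrite divr_ge0//= ler_pdivrMr ?ltr0n// mul1r ler_nat.
    exact: ltnW.
  by have [_ sz] := segment_resolvent eG e01; have [] := resolventP sz.
have Sv : S v.
  apply: (tame_rapid hH hL DE) => //; apply/tame_operatorP => k.
  have [M hM] := (tame_iter bnorm dI k _).2 (tame_resolvents k) k (leqnn k).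
  have [|N hN] := @seq_bound R _ (edges Gamma) (fun e t => normc (f (edge_path e t))).
    by move=> e eG; exact: (unit_bounded (normc_zmod R) (function_path eG)).
  exists (\sum_(e <- edges Gamma) normc (e.2 - e.1) * (N * M)) => n.
  have cv := iter_commutator_converges (D n) k hv.
  apply: (converges_le bP _ cv) => m; rewrite riemann_sumE.
  rewrite (big_morph _ (iter_commutatorD (D n) k) (iter_commutator0 (D n) k)).
  apply: le_trans (zn_sum bP _ _ _) _; rewrite big_seq [leRHS]big_seq.
  apply: ler_sum => e eG; rewrite iter_commutatorZ bnormZ ler_wpM2l ?normc_ge0//.
  rewrite iter_commutator_riemann; apply: (unit_riemann_le bP (@bnormZ R X)) => t t01.
  rewrite iter_commutatorZ bnormZ; apply: ler_pM; [exact: normc_ge0|exact: bnorm_ge0|exact: hN|].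
  have := hM (n, exist _ (edge_path e t) (ex_intro2 _ _ e eG (ex_intro2 _ _ t t01 erefl))).
  by rewrite iter_derive_family.
exists ((two_pi_i R)^-1 *: v); last exact: (rapid_scale hH hL hRD DE).
rewrite /holomorphic_calculus /contour_integral scalerA mulfV// scale1r.
exact: converges_cvg.
Qed.

End RapidCalculus.

Theorem corollary3p12 (R : realType) (G : groupType) (H : set G) (L : G -> R)
    (hH : hecke_pair H) (hL : length_function H L) (hRD : property_RD H L) :
  (forall f, rapidly_decreasing H L f ->
     exists! a : bop (ell2 R (rcosets H)), represents a f) /\
  smooth_subalgebra (reduced_hecke_algebra R H) (rapid_operators H L) /\
  exists (sS : set_subring (rapid_operators H L))
         (sA : set_subring (reduced_hecke_algebra R H))
         (SA : rapid_operators H L `<=` reduced_hecke_algebra R H),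
    bijective (K0_map (subring_incl sS sA SA)).
Proof.
have [D hD] := truncated_length_ops hL.
have DE n := (hD n).1; have DD n := (hD n).2.
have SA : rapid_operators H L `<=` reduced_hecke_algebra R H.
  by move=> a /rapid_operatorsE[].
have sS := rapid_subring hH hL hRD DE.
have sA := @reduced_subring R G H hH.
have dense := rapid_dense hH hL.
split; [|split].
- move=> f rf; have [a Aa af] := rapid_represented hH hL hRD rf.
  exists a; split; first exact/representsP.
  move=> b /representsP[Ab bf]; apply: (symbol_inj hH).
  + exact: reduced_equivariant.
  + exact: reduced_equivariant.
  + by rewrite af bf.
- split.
  + split=> // [c a|a]; first exact: (rapid_scale hH hL hRD DE).
    exact: (rapid_adjoint hH hL hRD DE DD).
  + exact: SA.
  + by move=> a Aa; apply/closure_bnormP; exact: dense.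
  + by move=> a U f Gamma Sa _ _ hf hG; exact: (rapid_calculus hH hL hRD DE Sa hf hG).
- exists sS, sA, SA.
  apply: (dense_subring_K0 (bnorm_ring R (rcosets H)) (@bop_complete R (rcosets H))).
  + exact: reduced_closed.
  + exact: dense.
  + exact: (rapid_mx_inverse hH hL hRD DE).
  + exact: (rapid_mx_idempotent hH hL hRD DE).
Qed.
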